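(* There exists a regular Toeplitz sequence $x\in\{0,1\}^{\mathbb{Z}}$ with a periodic structure $(n_t)_{t\ge1}$ satisfying $$n_{t+1}=k_{t+1}n_t\ \text{ with } (k_{t+1},n_t)=1,\qquad n_{t+1}\ge 2^4n_t^2,\qquad \sum_{p\in\mathbb{P}_{(n_t)}}\frac1p<+\infty,$$ such that $$\lim_{t\to\infty}\frac{1}{\sqrt{n_t}}\sum_{0\le m<\sqrt{n_t}}F(S^{m^2}x)\quad\text{does not exist},$$ where $F(y)=(-1)^{y(0)}$, and such that the subshift $(X_x,S)$ satisfies a PNT.
   Context: $\mathbb{P}_{(n_t)}$ denotes the set of all prime divisors of elements of the sequence $(n_t)_{t\ge1}$; $(a,b)$ denotes the greatest common divisor. A topological dynamical system $(X,T)$ satisfies a PNT if for every $y\in X$ and every $f\in C(X)$ the limit $\lim_{N\to\infty}\frac{1}{\pi(N)}\sum_{p<N}f(T^py)$ exists, where $p$ runs over primes and $\pi(N)$ is the number of primes up to $N$. $S$ is the left shift on $\{0,1\}^{\mathbb{Z}}$. A sequence $x$ is Toeplitz if for every $a\in\mathbb{Z}$ there is $\ell\ge1$ with $x(a)=x(a+j\ell)$ for all $j\in\mathbb{Z}$; $X_x$ is the orbit closure of $x$ under $S$. Let $\mathrm{Per}_n(x)=\{a\in\mathbb{Z}:x(a)=x(a+jn)\text{ for all }j\in\mathbb{Z}\}$. A periodic structure of $x$ is a sequence $(n_t)$ with $n_t\mid n_{t+1}$ and $\bigcup_t\mathrm{Per}_{n_t}(x)=\mathbb{Z}$; $x$ is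 regular if the density of $\mathrm{Per}_{n_t}(x)$ tends to $1$ as $t\to\infty$. *)

(* Defs.v *)
From HB Require Import structures.
From mathcomp Require Import all_boot all_order all_algebra.
From mathcomp Require Import all_classical all_reals all_analysis.
Set Implicit Arguments.
Unset Strict Implicit.
Unset Printing Implicit Defensive.
Import Order.TTheory GRing.Theory Num.Theory.
Import numFieldNormedType.Exports.
Local Open Scope classical_set_scope.
Local Open Scope ring_scope.

(* {0,1}^Z with the product of the discrete topologies. *)
Definition bisequence : Type := prod_topology (fun _ : int => bool).

HB.instance Definition _ := Pointed.on bisequence.
HB.instance Definition _ := Nbhs.on bisequence.
HB.instance Definition _ := Topological.on bisequence.

Definition left_shift (y : bisequence) : bisequence := fun a : int => y (a + 1).

(* The orbit is two-sided: the second disjunct says y = S^{-m} x. *)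
Definition orbit_closure (x : bisequence) : set bisequence :=
  closure [set y | exists m : nat,
    y = iter m left_shift x \/ x = iter m left_shift y].

Definition Toeplitz (x : bisequence) : Prop :=
  forall a : int, exists l : nat,
    (0 < l)%N /\ forall j : int, x a = x (a + j * l%:Z).

Definition Per (x : bisequence) (n : nat) : set int :=
  [set a | forall j : int, x a = x (a + j * n%:Z)].

(* Sequences (n_t)_{t >= 1} are indexed from 0: [n t] stands for n_{t+1}. *)
Definition periodic_structure (x : bisequence) (n : nat -> nat) : Prop :=
  [/\ forall t, (0 < n t)%N,
      forall t, (n t %| n t.+1)%N
    & \bigcup_t Per x (n t) = [set: int]].

Definition prime_divisors (n : nat -> nat) : set nat :=
  [set p | prime p /\ exists t, (p %| n t)%N].

(* The proportion of A in [-N, N] tends to d. *)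
Definition has_density (R : realType) (A : set int) (d : R) : Prop :=
  (\sum_(0 <= i < (2 * N).+1 | (i%:Z - N%:Z)%R \in A) 1) / (2 * N).+1%:R
    @[N --> \oo] --> d.

Definition Toeplitz_regular (R : realType) (x : bisequence)
    (n : nat -> nat) : Prop :=
  exists d : nat -> R,
    (forall t, has_density (Per x (n t)) (d t)) /\ d t @[t --> \oo] --> (1 : R).

Definition prime_pi (N : nat) : nat := count prime (iota 0 N.+1).

(* A system is given as a subset A of an ambient space, stable under T;
   C(A) is the set of real functions continuous for the topology induced
   on A. *)
Definition satisfies_PNT (R : realType) (X : topologicalType)
    (A : set X) (T : X -> X) : Prop :=
  forall y : X, A y -> forall f : X -> R, {within A, continuous f} ->
    cvg ((prime_pi N)%:R^-1 * \sum_(0 <= p < N | prime p) f (iter p T y)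
           @[N --> \oo]).

(* The exponent is the boolean y(0) read as 0 or 1. *)
Definition sign0 (R : realType) (y : bisequence) : R := (-1) ^+ y 0.

(* The sum over 0 <= m < sqrt n; the bound m < n is implied. *)
Definition square_average (R : realType) (x : bisequence) (n : nat) : R :=
  (Num.sqrt n%:R)^-1 *
    \sum_(0 <= m < n | m%:R < Num.sqrt (n%:R : R))
      sign0 R (iter (m ^ 2)%N left_shift x).

(* Main.v *)
Require Import Defs.
From HB Require Import structures.
From mathcomp Require Import all_boot all_order all_algebra.
From mathcomp Require Import all_classical all_reals all_analysis.
From mathcomp Require Import ring lra zify.
From mathcomp Require cyclic.
Set Implicit Arguments.
Unset Strict Implicit.
Unset Printing Implicit Defensive.
Import Order.TTheory GRing.Theory Num.Theory.
Import numFieldNormedType.Exports.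
Local Open Scope classical_set_scope.
Local Open Scope ring_scope.

(* Take primes k_{t+1} much larger than n_t.  Say that a is hit at s if a is a
   nonsquare modulo k_{s+1} or lies within n_s of 0 modulo n_{s+1}, and let x(a)
   be the parity of the first s at which a is hit.  About half of the residues
   survive each step, so those modulo n_t which survive t steps number at most
   (2/3)^t phi(n_t).  A square m^2 < n_t is hit at t, and can be hit at s < t
   only if it lies within n_s of 0 modulo n_{s+1}; as a residue modulo the prime
   k_{s+1} has at most two square roots, this is rare.  Hence the averages along
   squares are at least 1/2 for even t and at most -1/2 for odd t.

   Every y in X_x agrees with an n_t-periodic sequence off a translate of the
   surviving set, which is small even compared with phi(n_t).  So a PNT for
   X_x follows from the equidistribution of primes in the reduced classes modulo
   n_t, relative to pi(N) only.  By Dirichlet's hyperbola method the latter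
   reduces to m_w(x) := (1/x) sum_{n <= x} mu(n) w(n) -> 0 for q-periodic w.
   To see this, put w_b(n) := w(b n):
   - a Turan-Kubilius inequality gives m_w(x) ~ - m_{w_p}(x / p) for most primes
     p, and Selberg's formula provides pairs of such primes p = p' (mod q) with
     ln (p / p') close to a prescribed value, so that m_w varies slowly;
   - hence m_w ~ - m_{w_b} for every class b with divergent sum of 1 / p;
   - these relations force m_w -> 0 unless some real character chi has a
     convergent sum of 1 / p over chi(p) = 1, which L(1, chi) <> 0 excludes. *)

(** * Arithmetic functions *)

(* [lra] distinguishes inverses elaborated along different structure paths. *)
Ltac inv_lra :=
  repeat match goal with |- context [GRing.inv ?x] => move: (x^-1) => ? end; lra.

(** What separates squares from primes is that half of the reduced classes modulo each [k_{s+1}]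
    contain no square. Filling these classes at step [s] settles a fixed proportion of what the
    primes still see, yet leaves the squares alone, so that the values along squares are decided
    much later, at the scale [n_t] and by the parity of [t]. Since equidistribution is measured
    against [pi(N)], only periodic [w] of mean zero occur, together with their dilates. The sums of
    [w (u v)] over [v] are then bounded, the hyperbola method has no main term, and bounds of
    Chebyshev type do the work of an asymptotic formula for [pi]. The obstacle is to treat all
    residue classes at once by real estimates. Iterating [m_w ~ - m_{w_b}] along a product of primes
    equal to 1 modulo [q] leads back to [w] with the sign given by the parity of the number of
    factors. One return with the sign -1 suffices; if every return had the sign +1, the sign would
    be well defined on classes and multiplicative, that is, a real character, which is how such a
    character becomes the only possible obstruction. *)

Lemma ler_sum_sub_seq (R : numDomainType) (T : eqType) (s t : seq T) (f : T -> R) :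
  (forall i, 0 <= f i) -> uniq s -> uniq t -> {subset s <= t} ->
  \sum_(i <- s) f i <= \sum_(i <- t) f i.
Proof.
move=> f0 us ut st.
have pe : perm_eq t (s ++ [seq i <- t | i \notin s]).
  apply: uniq_perm => //.
    rewrite cat_uniq us filter_uniq// andbT -all_predC.
    by apply/allP => i; rewrite mem_filter => /andP[].
  by move=> i; rewrite mem_cat mem_filter; case: (boolP (i \in s)) => //= /st.
by rewrite [leRHS](perm_big _ pe) big_cat/= lerDl sumr_ge0.
Qed.

Section DivisorSums.
Variable V : nmodType.
Implicit Types F : nat -> nat -> V.

Lemma sum_le_divn (G : nat -> V) (a x : nat) : (0 < a)%N ->
  \sum_(1 <= b < (x %/ a).+1) G b = \sum_(1 <= b < x.+1 | (a * b <= x)%N) G b.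
Proof.
move=> a0; rewrite (big_nat_widen _ _ x.+1); last by rewrite ltnS leq_div.
by apply: eq_bigl => b /=; rewrite ltnS leq_divRL// mulnC.
Qed.

Lemma sum_hyperbola_exchange F (x : nat) :
  \sum_(1 <= a < x.+1) \sum_(1 <= b < (x %/ a).+1) F a b =
  \sum_(1 <= b < x.+1) \sum_(1 <= a < (x %/ b).+1) F a b.
Proof.
rewrite (eq_big_nat _ _ (F2 := fun a =>
    \sum_(1 <= b < x.+1 | (a * b <= x)%N) F a b)); last first.
  by move=> a /andP[a0 _]; exact: sum_le_divn.
rewrite (exchange_big_dep_nat xpredT)//=; apply: eq_big_nat => b /andP[b0 _].
by rewrite sum_le_divn//; apply: eq_bigl => a; rewrite mulnC.
Qed.

Lemma sum_multiples (G : nat -> V) (a x : nat) : (0 < a)%N ->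
  \sum_(1 <= n < x.+1 | (a %| n)%N) G n = \sum_(1 <= b < (x %/ a).+1) G (a * b)%N.
Proof.
move=> a0; elim: x => [|x IH]; first by rewrite div0n !big_geq.
rewrite big_mkcond big_nat_recr//= -big_mkcond IH divnS//.
case: ifP => [ax|]; last by rewrite addr0.
rewrite add1n [RHS]big_nat_recr//=; congr (_ + G _).
by have := divnK ax; rewrite divnS// ax add1n mulnC => ->.
Qed.

Lemma sum_divisors_exchange F (x : nat) :
  \sum_(1 <= a < x.+1) \sum_(1 <= b < (x %/ a).+1) F a (a * b)%N =
  \sum_(1 <= n < x.+1) \sum_(1 <= d < n.+1 | (d %| n)%N) F d n.
Proof.
rewrite (eq_big_nat _ _ (F2 := fun a =>
    \sum_(1 <= n < x.+1 | (a %| n)%N) F a n)); last first.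
  by move=> a /andP[a0 _]; rewrite sum_multiples.
rewrite (exchange_big_dep_nat xpredT)//=.
apply: eq_big_nat => n /andP[n0 nx].
rewrite [RHS](big_nat_widen _ _ x.+1)//.
apply: eq_bigl => d; case: (boolP (d %| n)%N) => //= dn.
by rewrite ltnS dvdn_leq.
Qed.

(** Both sides run over the pairs with [d * e] dividing [n]; this exchange is what Moebius inversion
    rests on. *)
Lemma sum_divisorsC F (n : nat) : (0 < n)%N ->
  \sum_(1 <= d < n.+1 | (d %| n)%N) \sum_(1 <= e < (n %/ d).+1 | (e %| n %/ d)%N) F d e =
  \sum_(1 <= e < n.+1 | (e %| n)%N) \sum_(1 <= d < (n %/ e).+1 | (d %| n %/ e)%N) F d e.
Proof.
move=> n0.
have E (G : nat -> V) a : (a %| n)%N ->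
    \sum_(1 <= e < (n %/ a).+1 | (e %| n %/ a)%N) G e =
    \sum_(1 <= e < n.+1 | (a * e %| n)%N) G e.
  move=> an; rewrite (big_nat_widen _ _ n.+1); last by rewrite ltnS leq_div.
  apply: eq_bigl => e; rewrite dvdn_divRL// mulnC.
  case: (boolP (a * e %| n)%N) => //= aen; rewrite ltnS.
  by rewrite leq_divRL ?(dvdn_gt0 n0 an)// mulnC dvdn_leq.
rewrite (eq_bigr (fun d => \sum_(1 <= e < n.+1 | (d * e %| n)%N) F d e)); last first.
  by move=> d dn; rewrite E.
rewrite (exchange_big_dep_nat (fun e => (e %| n)%N))/=; last first.
  by move=> d e _ _ _ h; rewrite (dvdn_trans _ h)// dvdn_mull.
apply: eq_bigr => e en; rewrite E//; apply: eq_bigl => d.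
rewrite [(e * d)%N]mulnC andbC; case: (boolP (d * e %| n)%N) => //= h.
by rewrite (dvdn_trans _ h)// dvdn_mulr.
Qed.

End DivisorSums.

Section ArithmeticFunctions.
Variable R : realType.
Implicit Types (n m p x : nat).

Definition moebius n : R :=
  \prod_(p <- primes n) (if logn p n == 1%N then -1 else 0).

(** At most one pair [(p, k)] contributes. A double sum, in place of a case distinction on prime
    powers, lets sums over [n] be exchanged with sums over [p] and [k]. *)
Definition mangoldt n : R :=
  \sum_(1 <= p < n.+1 | prime p) \sum_(1 <= k < n.+1 | (p ^ k == n)%N) ln p%:R.

Lemma moebius1 : moebius 1 = 1.
Proof. by rewrite /moebius big_nil. Qed.

Lemma normr_moebius_le1 n : `|moebius n| <= 1.
Proof.
rewrite /moebius normr_prod; apply: prodr_ile1 => p _.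
by case: ifP => _; rewrite ?normrN ?normr1 ?normr0 lexx ?ler01.
Qed.

Lemma moebius_primeM p m : prime p -> (0 < m)%N ->
  moebius (p * m) = if (p %| m)%N then 0 else - moebius m.
Proof.
move=> pp m0; have p0 := prime_gt0 pp.
have pm0 : (0 < p * m)%N by rewrite muln_gt0 p0.
case: ifP => pm.
  have pin : p \in primes (p * m) by rewrite mem_primes pp pm0 dvdn_mulr.
  rewrite /moebius (big_rem p)//= lognM// (logn_prime _ pp) eqxx add1n eqSS.
  have : (0 < logn p m)%N by rewrite logn_gt0 mem_primes pp m0 pm.
  by rewrite lt0n => /negbTE ->; rewrite mul0r.
have perm : perm_eq (primes (p * m)) (p :: primes m).
  apply: uniq_perm; rewrite ?primes_uniq//=.
    by rewrite primes_uniq mem_primes pm !andbF.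
  by move=> r; rewrite primesM// (primes_prime pp) !inE.
rewrite /moebius (perm_big _ perm)/= big_cons lognM// (logn_prime _ pp) eqxx.
have -> : logn p m = 0%N by apply/eqP; rewrite -leqn0 leqNgt logn_gt0 mem_primes pm !andbF.
rewrite eqxx mulN1r; congr (- _); apply: eq_big_seq => r rm.
rewrite lognM// (logn_prime _ pp).
suff /negbTE -> : r != p by [].
by apply: contraFN pm => /eqP <-; move: rm; rewrite mem_primes => /and3P[].
Qed.

(** With [p] the least prime factor of [n], the divisors [d] prime to [p] cancel against the
    divisors [p * d]; a divisor [p * d] with [p] dividing [d] contributes [0]. *)
Lemma sum_moebius n : (0 < n)%N ->
  \sum_(1 <= d < n.+1 | (d %| n)%N) moebius d = (n == 1)%N%:R.
Proof.
move=> n0; have [->|n1] := eqVneq n 1%N.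
  by rewrite big_mkcond big_nat1 moebius1.
have n1' : (1 < n)%N by rewrite ltn_neqAle eq_sym n1.
have pp := pdiv_prime n1'; set p := pdiv n in pp.
have pn : (p %| n)%N := pdiv_dvd n; have p0 := prime_gt0 pp.
rewrite (bigID (fun d => (p %| d)%N))/=.
under eq_bigl do rewrite andbC.
rewrite big_mkcondr/= sum_multiples//.
rewrite (_ : \sum_(1 <= b < _) _ =
    - \sum_(1 <= d < n.+1 | (d %| n)%N && ~~ (p %| d)%N) moebius d) ?addNr//.
rewrite -sumrN (big_nat_widen _ (n %/ p).+1 n.+1); last by rewrite ltnS leq_div.
rewrite [LHS]big_mkcond [RHS]big_mkcond; apply: eq_big_nat => d /andP[d0 dn].
rewrite moebius_primeM// ltnS leq_divRL// mulnC.
case: (boolP (p %| d)%N) => [pd|pd]; first by rewrite andbF !if_same.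
have [pdn|pdn] := boolP (p * d %| n)%N.
  by rewrite (dvdn_trans _ pdn) ?dvdn_mull// dvdn_leq.
rewrite if_same; case: ifP => // /andP[dn' _].
by rewrite Gauss_dvd ?pn ?dn'// in pdn; rewrite prime_coprime.
Qed.

Lemma mangoldt_widen n x : (n <= x)%N ->
  mangoldt n = \sum_(1 <= p < x.+1 | prime p)
                 \sum_(1 <= k < x.+1 | (p ^ k == n)%N) ln p%:R.
Proof.
move=> nx; rewrite /mangoldt (big_nat_widen _ _ x.+1)//.
rewrite big_mkcondr [LHS]big_nat_cond [RHS]big_nat_cond/=.
apply: eq_bigr => p /andP[_ pp].
have inner : \sum_(1 <= k < x.+1 | (p ^ k == n)%N) ln p%:R =
    \sum_(1 <= k < n.+1 | (p ^ k == n)%N) ln p%:R :> R.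
  rewrite [RHS](big_nat_widen _ _ x.+1)//; apply: eq_bigl => k.
  case: eqP => //= pkn; rewrite ltnS ltnW// -pkn.
  by rewrite ltn_expl// prime_gt1.
rewrite -inner; case: ifP => // /negbT; rewrite -leqNgt => np.
rewrite big_nat_cond big1// => k /andP[/andP[k1 _] /eqP pkn].
suff : (p <= n)%N by rewrite leqNgt np.
by rewrite -pkn -[leqLHS]expn1 leq_exp2l// prime_gt1.
Qed.

Lemma sum_prime_powers (P : pred nat) (G : nat -> R) x :
  \sum_(1 <= n < x.+1 | P n) mangoldt n * G n =
  \sum_(1 <= p < x.+1 | prime p)
    \sum_(1 <= k < x.+1 | (p ^ k <= x)%N && P (p ^ k)%N) ln p%:R * G (p ^ k)%N.
Proof.
transitivity (\sum_(1 <= n < x.+1 | P n) \sum_(1 <= p < x.+1 | prime p)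
    \sum_(1 <= k < x.+1 | (p ^ k == n)%N) ln p%:R * G (p ^ k)%N).
  rewrite big_nat_cond [RHS]big_nat_cond; apply: eq_bigr => n /andP[/andP[_ nx] _].
  rewrite (mangoldt_widen (x := x))// mulr_suml; apply: eq_bigr => p _.
  by rewrite mulr_suml; apply: eq_bigr => k /eqP ->.
rewrite exchange_big/=; apply: eq_bigr => p pp.
rewrite (exchange_big_dep_nat xpredT)//= [RHS]big_mkcond.
apply: eq_bigr => k _; rewrite big_mkcond/=.
have pk0 : (0 < p ^ k)%N by rewrite expn_gt0 prime_gt0.
case: ifP => [/andP[pkx Ppk]|/negbT npk].
  rewrite (bigD1_seq (p ^ k)%N)/= ?mem_index_iota ?pk0 ?iota_uniq//.
  rewrite Ppk eqxx/= big1 ?addr0// => n /negbTE nk.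
  by rewrite [(p ^ k == n)%N]eq_sym nk andbF.
rewrite big_nat_cond big1// => n /andP[/andP[_ nx] _].
case: ifP => // /andP[Pn /eqP pkn]; move: npk.
by rewrite pkn Pn andbT -ltnNge ltnNge -ltnS nx.
Qed.

Lemma mangoldt_ge0 n : 0 <= mangoldt n.
Proof.
apply: sumr_ge0 => p pp; apply: sumr_ge0 => k _.
by rewrite ln_ge0// ler1n prime_gt0.
Qed.

Lemma ln_prod_primes n : (0 < n)%N ->
  ln n%:R = \sum_(p <- primes n) ln p%:R *+ logn p n :> R.
Proof.
move=> n0; rewrite {1}[n]prod_prime_decomp// prime_decompE big_map/=.
rewrite natr_prod.
have : all [pred p | (0 < p)%N] (primes n).
  by apply/allP => p; rewrite mem_primes => /and3P[/prime_gt0].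
elim: (primes n) => [|p s IH]; first by rewrite !big_nil ln1.
move=> /andP[/= p0 s0]; rewrite !big_cons lnM ?posrE ?natrX ?exprn_gt0 ?ltr0n//.
  by rewrite IH// lnXn// ltr0n.
rewrite big_seq prodr_gt0// => r rs; rewrite natrX exprn_gt0// ltr0n.
by have /allP := s0; apply.
Qed.

Lemma sum_mangoldt n : (0 < n)%N ->
  \sum_(1 <= d < n.+1 | (d %| n)%N) mangoldt d = ln n%:R.
Proof.
move=> n0; transitivity (\sum_(1 <= d < n.+1 | (d %| n)%N) mangoldt d * 1).
  by apply: eq_bigr => d _; rewrite mulr1.
rewrite (sum_prime_powers _ (fun=> 1)) ln_prod_primes//.
rewrite -[X in _ = X](big_map id predT (fun p => ln p%:R *+ logn p n)).
rewrite map_id; have -> : primes n = [seq p <- index_iota 1 n.+1 | prime p & (p %| n)%N].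
  apply: (irr_sorted_eq ltn_trans ltnn); first exact: sorted_primes.
    by apply: sorted_filter; [exact: ltn_trans|exact: iota_ltn_sorted].
  move=> p; rewrite mem_filter mem_index_iota mem_primes n0 ltnS.
  case: (boolP (prime p)) => //= pp; case: (boolP (p %| n)%N) => //= pn.
  by rewrite prime_gt0// dvdn_leq.
rewrite big_filter big_mkcondr/=; apply: eq_bigr => p pp.
rewrite (eq_bigl (fun k => (k <= logn p n)%N)); last first.
  move=> k; rewrite pfactor_dvdn//; case: (leqP k (logn p n)) => kl; rewrite ?andbF// andbT.
  by apply: dvdn_leq => //; rewrite pfactor_dvdn.
have lnn : (logn p n <= n)%N.
  by apply: leq_trans (ltnW (ltn_expl _ (prime_gt1 pp))) _; exact: dvdn_leq (pfactor_dvdnn _ _).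
rewrite (_ : \sum_(_ <= _ < _ | _) _ = \sum_(1 <= k < (logn p n).+1) ln p%:R); last first.
  by rewrite (big_nat_widen _ (logn p n).+1 n.+1)//; apply: eq_big => // k _; rewrite mulr1.
rewrite sumr_const_nat subn1/=; case: ifP => // /negbT pn.
by move: (logn_gt0 p n); rewrite mem_primes (negbTE pn) !andbF lt0n => /negbFE/eqP ->.
Qed.

(* Dirichlet convolution of [moebius] with the identity [mangoldt * 1 = ln]. *)
Lemma moebius_inversion_ln n : (0 < n)%N ->
  \sum_(1 <= d < n.+1 | (d %| n)%N) moebius d * ln (n %/ d)%:R = mangoldt n.
Proof.
move=> n0.
transitivity (\sum_(1 <= d < n.+1 | (d %| n)%N)
   \sum_(1 <= e < (n %/ d).+1 | (e %| n %/ d)%N) moebius d * mangoldt e).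
  rewrite big_nat_cond [RHS]big_nat_cond; apply: eq_bigr => d /andP[/andP[d0 _] dn].
  rewrite -mulr_sumr sum_mangoldt// divn_gt0//; exact: dvdn_leq.
rewrite (sum_divisorsC (fun d e => moebius d * mangoldt e))//.
transitivity (\sum_(1 <= e < n.+1 | (e %| n)%N) (n %/ e == 1)%N%:R * mangoldt e).
  rewrite big_nat_cond [RHS]big_nat_cond; apply: eq_bigr => d /andP[/andP[d0 _] dn].
  rewrite -mulr_suml sum_moebius// divn_gt0//; exact: dvdn_leq.
rewrite big_mkcond (bigD1_seq n)/= ?iota_uniq ?mem_index_iota ?n0 ?ltnSn//.
rewrite dvdnn divnn n0 eqxx mul1r big_nat_cond big1 ?addr0//.
move=> e /andP[/andP[e0 en] ne]; case: ifP => // edn.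
have [h|] := eqVneq (n %/ e)%N 1%N; last by rewrite mul0r.
by move: (divnK edn); rewrite h mul1n => en'; rewrite en' eqxx in ne.
Qed.

End ArithmeticFunctions.

(** * Elementary estimates for primes *)

Section LogBounds.
Variable R : realType.
Implicit Types (a b y : R) (n x : nat).

Lemma lnB_le a b : 0 < a -> 0 < b -> ln a - ln b <= (a - b) / b.
Proof.
move=> a0 b0; rewrite -ln_div ?posrE//.
have -> : a / b = 1 + (a - b) / b by field; rewrite gt_eqF.
apply: le_ln1Dx; rewrite -subr_gt0 opprK mulrBl divff ?gt_eqF// subrK divr_gt0//.
Qed.

Lemma ln_natS_bounds n : (0 < n)%N ->
  (n.+1%:R : R)^-1 <= (ln n.+1%:R - ln n%:R : R) <= (n%:R : R)^-1.
Proof.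
move=> n0; have n0' : (0 : R) < n%:R by rewrite ltr0n.
have h1 := lnB_le (ltr0Sn R n) n0'; have h2 := lnB_le n0' (ltr0Sn R n).
apply/andP; split.
  rewrite -lerN2 opprB; apply: le_trans h2 _.
  by rewrite -natr1 opprD addrA subrr sub0r mulN1r.
by apply: le_trans h1 _; rewrite -natr1 addrAC subrr add0r mul1r.
Qed.

Lemma ln_nat_ge0 n : 0 <= ln (n%:R : R).
Proof. by case: n => [|n]; [rewrite ln0|rewrite ln_ge0// ler1n]. Qed.

Lemma ln_le_sqrt y : 0 < y -> ln y <= 2 * Num.sqrt y.
Proof.
move=> y0; have s0 : 0 < Num.sqrt y by rewrite sqrtr_gt0.
rewrite -{1}(sqr_sqrtr (ltW y0)) lnXn// mulr_natl lerMn2r.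
by rewrite ltW// ln_sublinear.
Qed.

(** Fourth roots serve for products of two logarithms: such a product is then at most a constant
    times [Num.sqrt y], and [sum_ln_divn_sqrt] sums these to [O(x)]. *)
Lemma ln_le_root4 y : 0 < y -> ln y <= 4 * Num.sqrt (Num.sqrt y).
Proof.
move=> y0; have s0 : 0 < Num.sqrt y by rewrite sqrtr_gt0.
rewrite -{1}(sqr_sqrtr (ltW y0)) lnXn//.
by have := ln_le_sqrt s0; lra.
Qed.

Lemma sum_inv_sqrt x :
  \sum_(1 <= n < x.+1) (Num.sqrt n%:R)^-1 <= 2 * Num.sqrt x%:R :> R.
Proof.
elim: x => [|x IH]; first by rewrite big_geq// sqrtr0 mulr0.
rewrite big_nat_recr//=; apply: le_trans (lerD IH (lexx _)) _.
set s := Num.sqrt x.+1%:R; set r := Num.sqrt x%:R.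
have s0 : 0 < s by rewrite sqrtr_gt0 ltr0Sn.
have E : s ^+ 2 = r ^+ 2 + 1 by rewrite !sqr_sqrtr// natr1.
have : 1 <= 2 * s * (s - r) by nra.
rewrite -(ler_pM2l (x := s^-1)) ?invr_gt0// mulr1 => h.
have : s^-1 * (2 * s * (s - r)) = 2 * s - 2 * r by field; rewrite gt_eqF.
by lra.
Qed.

Lemma sum_ln_divn_sqrt x : (0 < x)%N ->
  \sum_(1 <= n < x.+1) Num.sqrt (x%:R / n%:R) <= 2 * x%:R :> R.
Proof.
move=> x0; rewrite (eq_big_nat _ _ (F2 := fun n =>
  Num.sqrt x%:R * (Num.sqrt n%:R)^-1)); last first.
  by move=> n /andP[n0 _]; rewrite sqrtrM// sqrtrV.
rewrite -mulr_sumr; have s0 : 0 <= Num.sqrt x%:R :> R := sqrtr_ge0 _.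
have := sum_inv_sqrt x; have := sqr_sqrtr (ler0n R x); rewrite expr2.
by move: (Num.sqrt x%:R) s0 => s s0 h1 h2; nra.
Qed.

Definition harmonic_sum n : R := \sum_(1 <= k < n.+1) k%:R^-1.

(* The constant [g] is Euler's. *)
Lemma harmonic_asymptotic : exists g : R, 0 <= g <= 1 /\
  forall n, (0 < n)%N ->
    0 <= harmonic_sum n - ln n%:R - g <= n%:R^-1.
Proof.
pose a n : R := harmonic_sum n.+1 - ln n.+1%:R.
pose b n : R := a n - n.+1%:R^-1.
have HS n : harmonic_sum n.+2 = harmonic_sum n.+1 + n.+2%:R^-1.
  by rewrite /harmonic_sum big_nat_recr.
have aS n : a n.+1 <= a n.
  rewrite /a HS; have /andP[h _] := ln_natS_bounds (ltn0Sn n).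
  by move: (n.+2%:R^-1) h => u h; lra.
have bS n : b n <= b n.+1.
  rewrite /b /a HS; have /andP[_ h] := ln_natS_bounds (ltn0Sn n).
  by move: (n.+1%:R^-1) (n.+2%:R^-1) h => u v h; lra.
have am : nonincreasing_seq a by exact/nonincreasing_seqP.
have bm : nondecreasing_seq b by exact/nondecreasing_seqP.
have ba m n : b m <= a n.
  have [mn|/ltnW nm] := leqP m n.
    by rewrite (le_trans (bm _ _ mn))// gerBl.
  by rewrite (le_trans _ (am _ _ nm))// gerBl.
have hs : has_sup [set b n | n in [set: nat]].
  by split; [exists (b 0%N), 0%N|exists (a 0%N) => _ [n _ <-]].
exists (sup [set b n | n in [set: nat]]).
have ub n : b n <= sup [set b n | n in [set: nat]].
  by apply: sup_upper_bound => //; exists n.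
have lb n : sup [set b n | n in [set: nat]] <= a n.
  by apply: ge_sup => [|_ [m _ <-]//]; exists (b 0%N), 0%N.
split.
  have := ub 0%N; have := lb 0%N; rewrite /b /a /harmonic_sum big_nat1 ln1 invr1.
  by move=> h1 h2; apply/andP; split; lra.
case=> // n _; have := ub n; have := lb n; rewrite /b /a => h1 h2.
by apply/andP; split; move: h1 h2; inv_lra.
Qed.

End LogBounds.

(** * Estimates of Chebyshev and Mertens *)

Section Chebyshev.
Variable R : realType.
Implicit Types (n x y : nat).
Local Notation vM := (@mangoldt R).

Definition psi x : R := \sum_(1 <= n < x.+1) vM n.
Definition lnfact x : R := \sum_(1 <= n < x.+1) ln n%:R.

Lemma lnfact_bounds x : (0 < x)%N ->
  x%:R * ln x%:R - x%:R <= lnfact x <= x%:R * ln x%:R - x%:R + ln x%:R + 1.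
Proof.
case: x => // x _; elim: x => [|x /andP[IH1 IH2]].
  by rewrite /lnfact big_nat1 ln1; apply/andP; split; lra.
rewrite /lnfact big_nat_recr//= -/(lnfact x.+1).
have /andP[h1 h2] := ln_natS_bounds R (ltn0Sn x).
have x0 : (0 : R) < x.+1%:R by rewrite ltr0Sn.
have E : x.+2%:R = x.+1%:R + 1 :> R by rewrite natr1.
set L := ln x.+2%:R in h1 h2 *; set l := ln x.+1%:R in h1 h2 IH1 IH2 *.
have k1 : x.+1%:R * (L - l) <= 1.
  by rewrite -ler_pdivlMl// mulr1.
have k2 : 1 <= x.+2%:R * (L - l).
  by rewrite -ler_pdivrMl ?ltr0Sn// mulr1.
rewrite E in k2 *; move: (x.+1%:R) x0 IH1 IH2 k1 k2 => z z0 IH1 IH2 k1 k2.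
by apply/andP; split; lra.
Qed.

Lemma psi_ge0 x : 0 <= psi x.
Proof. by apply: sumr_ge0 => n _; exact: mangoldt_ge0. Qed.

Lemma psi_mono x y : (x <= y)%N -> psi x <= psi y.
Proof.
move=> xy; rewrite /psi (big_cat_nat (n := x.+1) (p := y.+1))//= lerDl.
by apply: sumr_ge0 => n _; exact: mangoldt_ge0.
Qed.

Lemma sum_psi_divn x : \sum_(1 <= k < x.+1) psi (x %/ k) = lnfact x.
Proof.
rewrite /psi (sum_hyperbola_exchange (fun a b => vM b)).
rewrite (sum_divisors_exchange (fun a n => vM a)).
by apply: eq_big_nat => n /andP[n0 _]; rewrite sum_mangoldt.
Qed.

Lemma lnfact_mangoldt x y : (y <= x)%N ->
  lnfact y = \sum_(1 <= d < x.+1) vM d * (y %/ d)%:R.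
Proof.
move=> yx; rewrite -sum_psi_divn /psi (sum_hyperbola_exchange (fun a b => vM b)).
rewrite (big_cat_nat (n := y.+1) (p := x.+1))//=.
rewrite [X in _ = _ + X]big_nat_cond [X in _ = _ + X]big1 ?addr0; last first.
  by move=> d /andP[/andP[yd _] _]; rewrite divn_small// mulr0.
by apply: eq_bigr => d _; rewrite sumr_const_nat subn1/= mulr_natr.
Qed.

(** Chebyshev's argument: on the right [mangoldt d] has the coefficient
    [x %/ d - 2 * ((x %/ 2) %/ d)], which is never negative and is at least [1] for
    [x %/ 2 < d <= x]. *)
Lemma psi_half x : psi x - psi (x %/ 2) <= lnfact x - 2 * lnfact (x %/ 2).
Proof.
have hx : (x %/ 2 <= x)%N by exact: leq_div.
rewrite (lnfact_mangoldt (leqnn x)) (lnfact_mangoldt hx).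
rewrite {1}/psi (big_cat_nat (n := (x %/ 2).+1) (p := x.+1))//= addrAC subrr add0r.
rewrite mulr_sumr -sumrB.
rewrite [leRHS](big_cat_nat (n := (x %/ 2).+1) (p := x.+1))//= -[leLHS]add0r lerD//.
  apply: sumr_ge0 => d _; rewrite mulrCA -mulrBr mulr_ge0 ?mangoldt_ge0// subr_ge0.
  by rewrite -natrM ler_nat -divnMA [(2 * d)%N]mulnC divnMA mulnC leq_trunc_div.
apply: ler_sum_nat => d /andP[yd dx].
rewrite (divn_small (m := x %/ 2))// mulr0 mulr0 subr0 ler_peMr ?mangoldt_ge0//.
by rewrite ler1n divn_gt0 ?(leq_trans _ yd).
Qed.

Lemma lnfact_half x : lnfact x - 2 * lnfact (x %/ 2) <= 5 * x%:R.
Proof.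
have [x1|x1] := leqP x 1.
  case: x x1 => [|[|//]] _; rewrite /lnfact.
    by rewrite !big_geq//; lra.
  by rewrite big_nat1 big_geq// ln1; lra.
set y := (x %/ 2)%N.
have y0 : (0 < y)%N by rewrite divn_gt0.
have /andP[_ h1] := lnfact_bounds (ltnW x1).
have /andP[h2 _] := lnfact_bounds y0.
have x3 : (x%:R : R) <= 3 * y%:R by rewrite -natrM ler_nat; lia.
have Y0 : (0 : R) < y%:R by rewrite ltr0n.
have X0 : (1 : R) <= x%:R by rewrite ler1n ltnW.
have X2 : 2 * (y%:R : R) <= x%:R by rewrite -natrM ler_nat; lia.
have X2' : x%:R <= 2 * (y%:R : R) + 1 by rewrite -natrM natr1 ler_nat; lia.
have l0 : 0 <= ln (y%:R : R) by rewrite ln_ge0// ler1n.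
have lx : ln (x%:R : R) < x%:R by rewrite ln_sublinear//; lra.
have ly : ln (y%:R : R) < y%:R by rewrite ln_sublinear.
have lxy : ln (x%:R : R) - ln y%:R <= 2.
  apply: le_trans (lnB_le _ Y0) _; first by lra.
  by rewrite ler_pdivrMr//; lra.
move: (ln (x%:R : R)) (ln (y%:R : R)) (x%:R : R) (y%:R : R) h1 h2 x3 Y0 X0 X2 X2' l0 lx ly lxy.
move=> lx ly X Y; nra.
Qed.

(** Successive halvings form a geometric series, hence twice the constant of [lnfact_half]. *)
Lemma psi_le x : psi x <= 10 * x%:R.
Proof.
elim/ltn_ind: x => -[|x] IH; first by rewrite /psi big_geq// mulr0.
have := psi_half x.+1; have := lnfact_half x.+1.
have /IH : (x.+1 %/ 2 < x.+1)%N by rewrite ltn_Pdiv.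
have : 2 * (x.+1 %/ 2)%:R <= x.+1%:R :> R by rewrite -natrM ler_nat mulnC leq_trunc_div.
lra.
Qed.

(** Stirling's bounds are compared with [lnfact x], the sum of [mangoldt d * (x %/ d)], after
    division by [x]. Replacing [x %/ d] by [x / d] costs at most [psi x <= 10 * x], and the lower
    order terms of Stirling account for the rest of [11]. *)
Lemma mertens x : (0 < x)%N ->
  ln x%:R - 1 <= \sum_(1 <= d < x.+1) vM d / d%:R <= ln x%:R + 11.
Proof.
move=> x0; have X0 : (0 : R) < x%:R by rewrite ltr0n.
have X1 : (1 : R) <= x%:R by rewrite ler1n.
have /andP[h1 h2] := lnfact_bounds x0.
have E := lnfact_mangoldt (leqnn x).
set S := \sum_(_ <= _ < _) _.
have k1 : lnfact x <= x%:R * S.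
  rewrite E /S mulr_sumr.
  apply: ler_sum_nat => d /andP[d0 _].
  rewrite mulrCA ler_wpM2l ?mangoldt_ge0// ler_pdivlMr ?ltr0n// -natrM ler_nat.
  exact: leq_trunc_div.
have k2 : x%:R * S <= lnfact x + psi x.
  rewrite E /S /psi -big_split/= mulr_sumr.
  apply: ler_sum_nat => d /andP[d0 _] /=.
  rewrite mulrCA -[X in _ + X]mulr1 -mulrDr ler_wpM2l ?mangoldt_ge0//.
  rewrite ler_pdivrMr ?ltr0n// natr1 -natrM ler_nat ltnW//.
  by rewrite ltn_ceil.
have k3 := psi_le x.
have k4 : ln (x%:R : R) < x%:R by rewrite ln_sublinear.
apply/andP; split; rewrite -(ler_pM2l X0); nra.
Qed.

Lemma mangoldt_window x y : (0 < x)%N -> (x <= y)%N ->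
  ln y%:R - ln x%:R - 12 <= \sum_(x.+1 <= d < y.+1) vM d / d%:R.
Proof.
move=> x0 xy; have /andP[h1 _] := mertens (leq_trans x0 xy).
have /andP[_] := mertens x0; move: h1.
rewrite (big_cat_nat (n := x.+1) (p := y.+1))//=.
by lra.
Qed.

End Chebyshev.

(** * Selberg's formula and primes in short intervals *)

Section Selberg.
Variable R : realType.
Implicit Types (n x y : nat).
Local Notation vM := (@mangoldt R).
Local Notation mu := (@moebius R).
Local Notation psi := (@psi R).

Definition selberg_sum x : R :=
  psi x * ln x%:R + \sum_(1 <= d < x.+1) vM d * psi (x %/ d).

(** Write [ln (x / n) = ln (x / d) + ln (d / n)]: the first part survives only at [d = 1], the
    second is Moebius inversion of [ln]. *)
Lemma sum_moebius_ln x d : (0 < x)%N -> (0 < d)%N ->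
  \sum_(1 <= n < d.+1 | (n %| d)%N) mu n * ln (x%:R / n%:R) =
  (d == 1)%N%:R * ln x%:R + vM d.
Proof.
move=> x0 d0.
transitivity (\sum_(1 <= n < d.+1 | (n %| d)%N)
    (mu n * ln (x%:R / d%:R) + mu n * ln (d %/ n)%:R)).
  rewrite big_nat_cond [RHS]big_nat_cond; apply: eq_bigr => n.
  move=> /andP[/andP[n0 nd1] nd]; rewrite -mulrDr; congr (_ * _).
  have dn : (0 < d %/ n)%N by rewrite divn_gt0.
  have E : d%:R = (d %/ n)%:R * n%:R :> R by rewrite -natrM divnK.
  rewrite -lnM ?posrE ?divr_gt0 ?ltr0n//; congr ln; rewrite E; field.
  by rewrite !pnatr_eq0 -!lt0n dn n0.
rewrite big_split/= -mulr_suml sum_moebius// moebius_inversion_ln//.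
by case: eqP => [->|]; rewrite ?mul0r// divr1.
Qed.

Lemma selberg_identity x (F : nat -> R) : (0 < x)%N ->
  \sum_(1 <= n < x.+1) mu n * ln (x%:R / n%:R) *
    \sum_(1 <= k < (x %/ n).+1) F (n * k)%N =
  ln x%:R * F 1%N + \sum_(1 <= d < x.+1) vM d * F d.
Proof.
move=> x0; under eq_bigr do rewrite mulr_sumr.
rewrite (sum_divisors_exchange (fun n d => mu n * ln (x%:R / n%:R) * F d)).
transitivity (\sum_(1 <= d < x.+1) ((d == 1)%N%:R * ln x%:R * F d + vM d * F d)).
  by apply: eq_big_nat => d /andP[d0 _]; rewrite -mulr_suml sum_moebius_ln// mulrDl.
rewrite big_split/=; congr (_ + _).
rewrite (big_cat_nat (n := 2))//= big_nat1 eqxx mul1r big_nat_cond big1 ?addr0//.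
by move=> d /andP[/andP[d1 _] _]; rewrite gtn_eqF// !mul0r.
Qed.

(* Tatuzawa and Iseki: apply [selberg_identity] to the error term
   [psi (x / d) - x / d + 1 + g], with [g] Euler's constant: its sums over
   multiples are logarithmically small. *)
Lemma selberg_sum_bound x : (0 < x)%N ->
  `|selberg_sum x - 2 * x%:R * ln x%:R| <= 100 * x%:R.
Proof.
move=> x0; have [g [/andP[g0 g1] gP]] := harmonic_asymptotic R.
pose F d : R := psi (x %/ d) - x%:R / d%:R + (1 + g).
have X1 : (1 : R) <= x%:R by rewrite ler1n.
have inner n : (0 < n <= x)%N ->
    `|\sum_(1 <= k < (x %/ n).+1) F (n * k)%N| <= ln (x %/ n)%:R + 3.
  move=> /andP[n0 nx]; set N := (x %/ n)%N.
  have N0 : (0 < N)%N by rewrite divn_gt0.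
  have N0' : (1 : R) <= N%:R by rewrite ler1n.
  have n0' : (0 : R) < n%:R by rewrite ltr0n.
  have -> : \sum_(1 <= k < N.+1) F (n * k)%N =
      lnfact R N - x%:R / n%:R * harmonic_sum R N + (1 + g) * N%:R.
    rewrite /F big_split/= big_split/= sumr_const_nat subn1/= mulr_natr.
    congr (_ + _ + _); first by rewrite -sum_psi_divn; apply: eq_bigr => k _; rewrite divnMA.
    rewrite sumrN mulr_sumr; congr (- _); apply: eq_big_nat => k /andP[k0 _].
    by rewrite natrM invfM mulrA.
  have yN : N%:R <= x%:R / n%:R :> R.
    by rewrite ler_pdivlMr// -natrM ler_nat leq_trunc_div.
  have yN' : x%:R / n%:R <= N%:R + 1 :> R.
    by rewrite ler_pdivrMr// natr1 -natrM ler_nat ltnW// ltn_ceil.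
  have /andP[h1 h2] := lnfact_bounds R N0.
  have /andP[h3 h4] := gP _ N0.
  have h5 : N%:R * (harmonic_sum R N - ln N%:R - g) <= 1.
    by rewrite -ler_pdivlMl ?mulr1// (lt_le_trans _ N0').
  have l0 : 0 <= ln (N%:R : R) by rewrite ln_ge0.
  move: (x%:R / n%:R) (harmonic_sum R N) (lnfact R N) (ln (N%:R : R)) (N%:R : R) N0' yN yN' h1 h2 h3 h5 l0 {h4}.
  move=> y H T l M M1 yM yM' h1 h2 h3 h5 l0.
  rewrite ler_norml; apply/andP; split; nra.
have I : `|\sum_(1 <= n < x.+1) mu n * ln (x%:R / n%:R) *
    \sum_(1 <= k < (x %/ n).+1) F (n * k)%N| <= 56 * x%:R.
  apply: le_trans (ler_norm_sum _ _ _) _.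
  apply: (@le_trans _ _ (\sum_(1 <= n < x.+1) 28 * Num.sqrt (x%:R / n%:R))); last first.
    by rewrite -mulr_sumr; have := sum_ln_divn_sqrt R x0; lra.
  apply: ler_sum_nat => n /andP[n0 nx]; rewrite ltnS in nx.
  have n0' : (0 : R) < n%:R by rewrite ltr0n.
  have y1 : (1 : R) <= x%:R / n%:R by rewrite ler_pdivlMr// mul1r ler_nat.
  have y0 : (0 : R) < x%:R / n%:R by exact: lt_le_trans y1.
  have N0 : (0 < x %/ n)%N by rewrite divn_gt0.
  have := inner n; rewrite n0 nx => /(_ isT) hin.
  rewrite normrM normrM (ger0_norm (ln_ge0 y1)).
  have lN : ln (x %/ n)%:R <= ln (x%:R / n%:R) :> R.
    rewrite ler_ln ?posrE ?ltr0n//.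
    by rewrite ler_pdivlMr// -natrM ler_nat leq_trunc_div.
  have l4 := ln_le_root4 y0; have l0 := ln_ge0 y1.
  have m1 := normr_moebius_le1 R n.
  rewrite -(sqr_sqrtr (sqrtr_ge0 (x%:R / n%:R : R))).
  have r1 : 1 <= Num.sqrt (Num.sqrt (x%:R / n%:R)) :> R.
    by rewrite -[leLHS]sqrtr1 ler_wsqrtr// -[leLHS]sqrtr1 ler_wsqrtr.
  have m0 := normr_ge0 (mu n).
  have s0 := normr_ge0 (\sum_(1 <= k < (x %/ n).+1) F (n * k)%N).
  move: (Num.sqrt _) (ln (x%:R / n%:R)) (ln (x %/ n)%:R) `|mu n| `|\sum_(_ <= _ < _) _| hin lN l4 l0 m1 r1 m0 s0.
  move=> r l l' m s hin lN l4 l0 m1 r1 m0 s0.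
  have h1 : s <= 7 * r by lra.
  have h2 : m * l <= 4 * r by nra.
  have h3 : 0 <= m * l by rewrite mulr_ge0.
  by apply: le_trans (ler_pM h3 s0 h2 h1) _; rewrite expr2; lra.
have E : \sum_(1 <= d < x.+1) vM d * F d =
    \sum_(1 <= d < x.+1) vM d * psi (x %/ d) -
    x%:R * (\sum_(1 <= d < x.+1) vM d / d%:R) + (1 + g) * psi x.
  rewrite /F; under eq_bigr do rewrite mulrDr mulrBr.
  rewrite big_split/= big_split/= sumrN; congr (_ - _ + _).
    by rewrite mulr_sumr; apply: eq_bigr => d _; rewrite mulrCA.
  by rewrite -mulr_suml mulrC.
move: I; rewrite selberg_identity// E /F divn1 divr1 /selberg_sum.
have /andP[m1 m2] := mertens R x0.
have p1 := psi_le R x; have p0 := psi_ge0 R x.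
have l0 : 0 <= ln (x%:R : R) by rewrite ln_ge0.
have l1 : ln (x%:R : R) <= x%:R by rewrite ltW// ln_sublinear// (lt_le_trans _ X1).
move: (\sum_(1 <= d < x.+1) vM d / d%:R) (\sum_(1 <= d < x.+1) vM d * psi (x %/ d)) m1 m2.
move=> M S m1 m2.
move: (psi x) (ln (x%:R : R)) (x%:R : R) p1 p0 l0 l1 X1 m1 m2 => p l X p1 p0 l0 l1 X1 m1 m2.
rewrite !ler_norml => /andP[i1 i2]; apply/andP; split; nra.
Qed.

(* A Brun-Titchmarsh inequality, since both terms of [selberg_sum] increase. *)
Lemma psi_short_interval x y : (0 < x)%N -> (x <= y)%N -> (y <= 2 * x)%N ->
  (psi y - psi x) * ln x%:R <= 2 * (y%:R - x%:R) * ln x%:R + 304 * x%:R.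
Proof.
move=> x0 xy y2x; have y0 := leq_trans x0 xy.
have X0 : (0 : R) < x%:R by rewrite ltr0n.
have X1 : (1 : R) <= x%:R by rewrite ler1n.
have Y0 : (0 : R) < y%:R by rewrite ltr0n.
have XY : (x%:R : R) <= y%:R by rewrite ler_nat.
have YX : (y%:R : R) <= 2 * x%:R by rewrite -natrM ler_nat.
have hS : \sum_(1 <= d < x.+1) vM d * psi (x %/ d) <=
    \sum_(1 <= d < y.+1) vM d * psi (y %/ d).
  rewrite [leRHS](big_cat_nat (n := x.+1))//= ler_wpDr//.
    by apply: sumr_ge0 => d _; rewrite mulr_ge0 ?mangoldt_ge0 ?psi_ge0.
  by apply: ler_sum => d _; rewrite ler_wpM2l ?mangoldt_ge0// psi_mono ?leq_div2r.
have := selberg_sum_bound x0; have := selberg_sum_bound y0.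
rewrite !ler_norml /selberg_sum => /andP[_ h1] /andP[h2 _].
have l0 : 0 <= ln (x%:R : R) by rewrite ln_ge0.
have l1 : ln (x%:R : R) <= ln (y%:R : R) by rewrite ler_ln.
have l2 : ln (y%:R : R) - ln (x%:R : R) <= 1.
  by apply: le_trans (lnB_le Y0 X0) _; rewrite ler_pdivrMr//; lra.
have py := psi_ge0 R y.
move: (psi x) (psi y) (\sum_(1 <= d < x.+1) vM d * psi (x %/ d))
 (\sum_(1 <= d < y.+1) vM d * psi (y %/ d)) py hS h1 h2.
move=> px py S T py0 hS h1 h2.
move: (ln (x%:R : R)) (ln (y%:R : R)) l0 l1 l2 h1 h2 => l m.
move: (x%:R : R) (y%:R : R) X0 X1 XY YX => X Y X0 X1 XY YX l0 l1 l2 h1 h2.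
nra.
Qed.

Lemma ler_sum_subrange (f : nat -> R) (P Q : pred nat) a b c d :
  (forall n, 0 <= f n) ->
  (forall n, (a <= n < b)%N -> P n -> (c <= n < d)%N && Q n) ->
  \sum_(a <= n < b | P n) f n <= \sum_(c <= n < d | Q n) f n.
Proof.
move=> f0 h; rewrite -!(big_filter (index_iota _ _)).
apply: ler_sum_sub_seq; rewrite ?filter_uniq ?iota_uniq// => n.
rewrite !mem_filter !mem_index_iota => /andP[Pn nab].
by have /andP[-> ->] := h n nab Pn.
Qed.

Lemma expR_le1D2x (h : R) : 0 <= h <= 1 / 2 -> expR h <= 1 + 2 * h.
Proof.
move=> /andP[h0 h1]; have := expR_ge1Dx (- h); rewrite expRN => k.
have e0 := expR_gt0 h.
have : (1 - h) * expR h <= 1 by rewrite -ler_pdivlMr// mul1r.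
by nra.
Qed.

(** A bound linear in [h] with an absolute constant will force the primes to occupy a positive
    proportion of such windows. The factor [2] of [psi_short_interval] and [expR h - 1 <= 2 * h]
    give [4 * h]; the lower bound on [v] makes the error of order [1 / v] small against [h], and [6]
    leaves room for rounding. *)
Lemma mangoldt_log_window (h v : R) (N : nat) : 0 < h <= 1 / 4 -> (100 * 100) / h <= v ->
  \sum_(1 <= n < N | v <= ln n%:R < v + h) vM n / n%:R <= 6 * h.
Proof.
move=> /andP[h0 h1] hv.
have v4 : (400 * 100) <= v.
  by apply: le_trans hv; rewrite ler_pdivlMr//; lra.
have vh : (100 * 100) <= v * h by rewrite -ler_pdivrMr.
have := expR_ge1Dx v; set E := expR v => Ev.
have E0 : 0 < E := expR_gt0 v.
have eh : expR h <= 1 + 2 * h by apply: expR_le1D2x; lra.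
have eh1 : 1 <= expR h by rewrite -expR0 ler_expR ltW.
have Eh : E * expR h = expR (v + h) by rewrite expRD.
set x := Num.truncn E; set y := Num.truncn (E * expR h).
have /andP[x1 x2] := truncn_itv (ltW E0).
have Eh0 : 0 <= E * expR h by rewrite mulr_ge0 ?expR_ge0.
have /andP[y1 y2] := truncn_itv Eh0.
rewrite -/x -/y -natr1 in x1 x2 y1 y2.
have x0 : (2 < x)%N by rewrite -(ltr_nat R); lra.
have [x' xE] : exists x', x = x'.+1 by exists x.-1; rewrite prednK// (ltn_trans _ x0).
have X' : x%:R = x'%:R + 1 :> R by rewrite xE -natr1.
have x'0 : (0 < x')%N by move: x0; rewrite xE; case: (x').
have xy' : (x' <= y)%N by rewrite -(ler_nat R); nra.
have y2x : (y <= 2 * x')%N by rewrite -(ler_nat R) natrM; nra.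
apply: (@le_trans _ _ (\sum_(x'.+1 <= n < y.+1) vM n / n%:R)).
  apply: ler_sum_subrange => [n|n /andP[n0 _] /andP[v1 v2]].
    by rewrite divr_ge0 ?mangoldt_ge0.
  have n0' : (0 : R) < n%:R by rewrite ltr0n.
  rewrite -xE ltnS andbT; apply/andP; split.
    rewrite -(ler_nat R) (le_trans x1)// /E -[leRHS]lnK ?posrE//.
    by rewrite ler_expR.
  have : n%:R <= E * expR h :> R.
    by rewrite Eh -[leLHS]lnK ?posrE// ler_expR ltW.
  by rewrite -truncn_ge_nat.
apply: (@le_trans _ _ ((psi y - psi x') / x%:R)).
  have -> : psi y = psi x' + \sum_(x'.+1 <= n < y.+1) vM n.
    by rewrite /psi -(big_cat_nat (p := y.+1)).
  rewrite addrAC subrr add0r mulr_suml; apply: ler_sum_nat => n /andP[n1 _].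
  by rewrite ler_wpM2l ?mangoldt_ge0// lef_pV2 ?posrE ?ltr0n ?ler_nat ?xE// (leq_trans _ n1).
have lx : v - 1 <= ln (x'%:R : R).
  rewrite -ler_expR lnK ?posrE ?ltr0n// expRB -/E ler_pdivrMr ?expR_gt0//.
  by have := expR_ge1Dx (1 : R); nra.
have := psi_short_interval x'0 xy' y2x; rewrite ler_pdivrMr ?ltr0n ?(ltn_trans _ x0)// X'.
have : y%:R - x'%:R <= 2 * h * E + 2 by nra.
move: (y%:R - x'%:R) (psi y - psi x') (ln (x'%:R : R)) lx => d P l lx hd hP.
have l0 : 0 < l by lra.
rewrite -(ler_pM2r l0); apply: le_trans hP _.
have hl : 304 * x'%:R <= h / 10 * x'%:R * l.
  rewrite mulrAC ler_wpM2r//.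
  have : (99 * 100) <= l * h by nra.
  lra.
have hE : 0 <= (6 * h * (x'%:R + 1) - h / 10 * x'%:R - 2 * d).
  have : (400 * 100) * h <= E * h by nra.
  have : (100 * 100) <= E * h by nra.
  by nra.
have := mulr_ge0 hE (ltW l0); nra.
Qed.

End Selberg.

(** * Mean values of the Moebius function *)

Section TuranKubilius.
Variable R : realType.
Implicit Types (n x : nat) (w : nat -> R) (P : seq nat).
Local Notation mu := (@moebius R).

Definition moebius_sum w x : R := \sum_(1 <= n < x.+1) mu n * w n.

Definition bounded1 w := forall n, `|w n| <= 1.

Lemma normr_moebius_sumB w x y : bounded1 w -> (x <= y)%N ->
  `|moebius_sum w y - moebius_sum w x| <= y%:R - x%:R.
Proof.
move=> w1 xy; rewrite /moebius_sum (big_cat_nat (n := x.+1) (p := y.+1))//=.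
rewrite addrAC subrr add0r (le_trans (ler_norm_sum _ _ _))//.
have -> : y%:R - x%:R = \sum_(x.+1 <= n < y.+1) 1 :> R by rewrite sumr_const_nat subSS natrB.
by apply: ler_sum => n _; rewrite normrM mulr_ile1 ?normr_moebius_le1.
Qed.

Lemma normr_moebius_sum_le w x : bounded1 w -> `|moebius_sum w x| <= x%:R.
Proof.
move=> w1; have := normr_moebius_sumB w1 (leq0n x).
by rewrite {2}/moebius_sum big_geq// !subr0.
Qed.

Lemma sum_inv_sqr_le1 P : uniq P -> all [pred p | (1 < p)%N] P ->
  \sum_(p <- P) (p%:R ^+ 2)^-1 <= 1 :> R.
Proof.
move=> uP /allP P1; pose N := (\max_(p <- P) p).+2.
apply: (@le_trans _ _ (\sum_(2 <= p < N) (p%:R ^+ 2)^-1)).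
  apply: ler_sum_sub_seq; rewrite ?iota_uniq// => p pP.
  have /= p1 := P1 p pP; rewrite mem_index_iota p1/= /N ltnS ltnW// ltnS.
  by rewrite (bigD1_seq p)//= leq_maxl.
apply: (@le_trans _ _ (\sum_(2 <= p < N) (p.-1%:R^-1 - p%:R^-1))).
  apply: ler_sum_nat => -[|[|p]]// _ /=.
  have p0 : (0 : R) < p.+1%:R by rewrite ltr0n.
  rewrite -[p.+2%:R]natr1; move: (p.+1%:R) p0 => z z0.
  have z1 : 0 < z + 1 by lra.
  have -> : z^-1 - (z + 1)^-1 = (z * (z + 1))^-1 by field; rewrite !gt_eqF.
  by rewrite lef_pV2 ?posrE ?exprn_gt0 ?mulr_gt0// expr2 ler_wpM2r//; lra.
suff -> : \sum_(2 <= p < N) (p.-1%:R^-1 - p%:R^-1) = 1 - (N.-1%:R)^-1 :> R.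
  by rewrite gerBl.
rewrite /N; elim: (\max_(p <- P) p) => [|k IH].
  by rewrite big_geq//= invr1 subrr.
by rewrite big_nat_recr//= IH/= addrA subrK.
Qed.

Lemma sum_multiples_const x p : (0 < p)%N ->
  \sum_(1 <= n < x.+1) (p %| n)%N%:R = (x %/ p)%:R :> R.
Proof.
move=> p0; transitivity (\sum_(1 <= n < x.+1 | (p %| n)%N) (1 : R)).
  by rewrite [RHS]big_mkcond; apply: eq_bigr => n _; case: ifP.
by rewrite (sum_multiples (fun=> 1))// sumr_const_nat subn1.
Qed.

Let Y p n : R := (p %| n)%N%:R - p%:R^-1.

(** [Y p] is the centred indicator of the multiples of [p]. For distinct primes these are
    independent up to the rounding of [x / p], [x / r] and [x / (p * r)], whence the absolute
    constant [2]. *)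
Lemma sum_dvdn_covariance x p r : prime p -> prime r ->
  \sum_(1 <= n < x.+1) Y p n * Y r n <= (p == r)%:R * (x%:R / p%:R) + 2 /\
  - 2 <= \sum_(1 <= n < x.+1) Y p n * Y r n.
Proof.
move=> pp pr; have p0 := prime_gt0 pp; have r0 := prime_gt0 pr.
have E : \sum_(1 <= n < x.+1) Y p n * Y r n =
  \sum_(1 <= n < x.+1) ((p %| n) && (r %| n))%N%:R -
  (x %/ p)%:R / r%:R - (x %/ r)%:R / p%:R + x%:R / p%:R / r%:R.
  rewrite -!sum_multiples_const// !mulr_suml -!sumrB.
  have -> : x%:R / p%:R / r%:R = \sum_(1 <= n < x.+1) p%:R^-1 / r%:R :> R.
    by rewrite sumr_const_nat subn1/= mulr_natl mulrnAl.
  rewrite -big_split/=; apply: eq_bigr => n _; rewrite /Y.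
  by case: (p %| n)%N; case: (r %| n)%N => /=; ring.
have P0 : (0 : R) < p%:R by rewrite ltr0n.
have R0 : (0 : R) < r%:R by rewrite ltr0n.
have P1 : p%:R^-1 <= 1 :> R by rewrite invf_le1// ler1n.
have R1 : r%:R^-1 <= 1 :> R by rewrite invf_le1// ler1n.
have Pi0 : 0 < p%:R^-1 :> R by rewrite invr_gt0.
have Ri0 : 0 < r%:R^-1 :> R by rewrite invr_gt0.
have fl a : (0 < a)%N -> x%:R / a%:R - 1 <= ((x %/ a)%:R : R) <= x%:R / a%:R.
  move=> a0; have A0 : (0 : R) < a%:R by rewrite ltr0n.
  rewrite lerBlDr ler_pdivrMr// ler_pdivlMr// natr1 -!natrM !ler_nat.
  by rewrite leq_trunc_div ltnW// ltn_ceil.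
have /andP[fp1 fp2] := fl p p0; have /andP[fr1 fr2] := fl r r0.
have x0 : (0 : R) <= x%:R by [].
case: eqP => [pr'|/eqP pr'] in E *.
  have -> : \sum_(1 <= n < x.+1) Y p n * Y r n = \sum_(1 <= n < x.+1) Y p n ^+ 2.
    by rewrite -pr'; apply: eq_bigr => n _; rewrite expr2.
  split; last by rewrite (@le_trans _ _ 0)// sumr_ge0// => n _; exact: sqr_ge0.
  move: E; rewrite -pr'; under eq_bigr do rewrite -expr2.
  move=> ->; under eq_bigr do rewrite andbb.
  rewrite sum_multiples_const// mul1r.
  move: (p%:R^-1) (x%:R : R) ((x %/ p)%:R : R) P1 Pi0 fp1 fp2 x0 => u X X' *; nra.
rewrite E (eq_bigr (fun n => (p * r %| n)%N%:R : R)); last first.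
  by move=> n _; rewrite Gauss_dvd// prime_coprime// dvdn_prime2.
rewrite sum_multiples_const ?muln_gt0 ?p0// mul0r add0r.
have /andP[f1 f2] := fl (p * r)%N (ltac:(by rewrite muln_gt0 p0)).
rewrite natrM invfM mulrA in f1 f2.
move: (p%:R^-1) (r%:R^-1) (x%:R : R) ((x %/ p)%:R : R) ((x %/ r)%:R : R) ((x %/ (p * r))%:R : R) P1 Pi0 R1 Ri0 fp1 fp2 fr1 fr2 f1 f2 x0.
move=> u v X Xp Xr Xpr u1 u0 v1 v0 fp1 fp2 fr1 fr2 f1 f2 x0.
have k1 : (X * u - 1) * v <= Xp * v by rewrite ler_pM2r.
have k2 : Xp * v <= X * u * v by rewrite ler_pM2r.
have k3 : (X * v - 1) * u <= Xr * u by rewrite ler_pM2r.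
have k4 : Xr * u <= X * v * u by rewrite ler_pM2r.
by split; lra.
Qed.

Lemma turan_kubilius (P : seq nat) (c : nat -> R) x :
  uniq P -> all prime P ->
  \sum_(1 <= n < x.+1) (\sum_(p <- P) c p * Y p n) ^+ 2 <=
  x%:R * (\sum_(p <- P) c p ^+ 2 / p%:R) + 2 * (\sum_(p <- P) `|c p|) ^+ 2.
Proof.
move=> uP /allP primeP.
have -> : \sum_(1 <= n < x.+1) (\sum_(p <- P) c p * Y p n) ^+ 2 =
    \sum_(p <- P) \sum_(r <- P) c p * c r * \sum_(1 <= n < x.+1) Y p n * Y r n.
  under eq_bigr do rewrite expr2 mulr_suml.
  rewrite exchange_big/=; apply: eq_bigr => p _.
  under eq_bigr do rewrite mulr_sumr.
  rewrite exchange_big/=; apply: eq_bigr => r _.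
  by rewrite mulr_sumr; apply: eq_bigr => n _; ring.
have -> : x%:R * (\sum_(p <- P) c p ^+ 2 / p%:R) + 2 * (\sum_(p <- P) `|c p|) ^+ 2 =
    \sum_(p <- P) \sum_(r <- P) ((p == r)%:R * (c p ^+ 2 * (x%:R / p%:R)) + 2 * (`|c p| * `|c r|)).
  rewrite mulr_sumr expr2 mulr_suml mulr_sumr -big_split/=.
  apply: eq_big_seq => p pP; rewrite big_split/= [X in _ = X + _](bigD1_seq p)//=.
  rewrite eqxx mul1r [X in _ = _ + X + _]big1 => [|r /negbTE]; last first.
    by rewrite eq_sym => ->; rewrite mul0r.
  rewrite addr0 mulrCA; congr (_ + _).
  by rewrite !mulr_sumr; apply: eq_bigr => r _.
rewrite big_seq [leRHS]big_seq; apply: ler_sum => p pP.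
rewrite big_seq [leRHS]big_seq; apply: ler_sum => r rP.
have [h1 h2] := sum_dvdn_covariance x (primeP p pP) (primeP r rP).
rewrite -normrM; set Z := \sum_(_ <= _ < _) _ in h1 h2 *.
have [pr|pr] := eqVneq p r; last first.
  rewrite (negbTE pr) mul0r add0r in h1; rewrite mul0r add0r.
  apply: le_trans (ler_norm _) _; rewrite [leLHS]normrM [leRHS]mulrC.
  by apply: ler_wpM2l => //; rewrite ler_norml h2 h1.
rewrite -pr eqxx !mul1r in h1 h2 *.
rewrite -expr2 ger0_norm ?sqr_ge0//.
have := sqr_ge0 (c p); move: (c p ^+ 2) (x%:R / p%:R) h1 => C X h1 C0; nra.
Qed.

End TuranKubilius.

Section TuranKubiliusDual.
Variable R : realType.
Implicit Types (n x : nat) (w : nat -> R) (P : seq nat).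
Local Notation mu := (@moebius R).

(* Testing [turan_kubilius] on the coefficients that occur in the conclusion. *)
Lemma turan_kubilius_dual P w x : uniq P -> all prime P -> bounded1 w ->
  (0 < x)%N -> (16 * size P ^ 2 <= x)%N ->
  \sum_(p <- P) ((moebius_sum w x +
     p%:R * moebius_sum (fun n => w (p * n)%N) (x %/ p)) / x%:R) ^+ 2 / p%:R <= 5.
Proof.
move=> uP aP w1 x0 Px; have primeP := allP aP.
pose e p := (moebius_sum w x + p%:R * moebius_sum (fun n => w (p * n)%N) (x %/ p)) / x%:R.
set Q := \sum_(p <- P) _.
have X0 : (0 : R) < x%:R by rewrite ltr0n.
have e2 p : (0 < p)%N -> `|e p| <= 2.
  move=> p0; rewrite /e normrM normfV [X in _ / X]ger0_norm ?ler0n// ler_pdivrMr//.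
  apply: le_trans (ler_normD _ _) _; rewrite normrM ger0_norm ?ler0n//.
  have h1 := normr_moebius_sum_le x w1.
  have h2 : p%:R * `|moebius_sum (fun n => w (p * n)%N) (x %/ p)| <= x%:R :> R.
    apply: (@le_trans _ _ (p%:R * (x %/ p)%:R)).
      by rewrite ler_wpM2l// normr_moebius_sum_le// => n; exact: w1.
    by rewrite -natrM ler_nat mulnC leq_trunc_div.
  by lra.
pose b n := \sum_(p <- P) e p * ((p %| n)%N%:R - p%:R^-1).
have TK : \sum_(1 <= n < x.+1) b n ^+ 2 <= x%:R * (Q + 1).
  apply: le_trans (turan_kubilius e x uP aP) _.
  rewrite mulrDr mulr1 lerD2l.
  have h : \sum_(p <- P) `|e p| <= 2 * (size P)%:R.
    have -> : 2 * (size P)%:R = \sum_(p <- P) (2 : R).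
      by rewrite big_const_seq count_predT iter_addr_0 -[RHS]mulr_natr.
    by rewrite big_seq [leRHS]big_seq; apply: ler_sum => p /primeP/prime_gt0/e2.
  have h0 : 0 <= \sum_(p <- P) `|e p| by rewrite sumr_ge0.
  have : 16 * ((size P)%:R * (size P)%:R) <= x%:R :> R.
    by rewrite -!natrM ler_nat mulnn.
  move: (\sum_(p <- P) `|e p|) ((size P)%:R : R) h h0 => s S; nra.
(* For [n = p * m] one has [mu n = - mu m], except that [mu n = 0] when [p] divides [m]. The regular
   terms assemble to [- x * Q]; the correction is controlled by the sum of [1 / p ^ 2]. *)
have Ident : \sum_(1 <= n < x.+1) mu n * w n * b n =
    - (x%:R * Q) + \sum_(p <- P) e p *
      \sum_(1 <= m < (x %/ p).+1 | (p %| m)%N) mu m * w (p * m)%N.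
  rewrite /b; under eq_bigr do rewrite mulr_sumr.
  rewrite exchange_big/= mulr_sumr -sumrN -big_split/=.
  apply: eq_big_seq => p pP; have pp := primeP p pP; have p0 := prime_gt0 pp.
  have P0 : (0 : R) < p%:R by rewrite ltr0n.
  transitivity (e p * (\sum_(1 <= n < x.+1 | (p %| n)%N) mu n * w n - p%:R^-1 * moebius_sum w x)).
    rewrite [X in _ - X]mulr_sumr [X in X - _]big_mkcond -sumrB mulr_sumr.
    by apply: eq_bigr => n _; case: (p %| n)%N => /=; ring.
  rewrite sum_multiples//.
  have -> : \sum_(1 <= m < (x %/ p).+1) mu (p * m)%N * w (p * m)%N =
      - moebius_sum (fun n => w (p * n)%N) (x %/ p) +
      \sum_(1 <= m < (x %/ p).+1 | (p %| m)%N) mu m * w (p * m)%N.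
    rewrite /moebius_sum -sumrN [X in _ = _ + X]big_mkcond -big_split/=.
    apply: eq_big_nat => m /andP[m0 _]; rewrite moebius_primeM//.
    by case: ifP => _; rewrite ?mul0r ?addNr// addr0 mulNr.
  rewrite /e; move: (\sum_(_ <= _ < _ | _) _) (moebius_sum w x) (moebius_sum _ (x %/ p)) => s S S'.
  by field; rewrite !gt_eqF.
have err : `|\sum_(p <- P) e p * \sum_(1 <= m < (x %/ p).+1 | (p %| m)%N) mu m * w (p * m)%N|
    <= 2 * x%:R.
  apply: (@le_trans _ _ (\sum_(p <- P) 2 * x%:R * (p%:R ^+ 2)^-1)); last first.
    rewrite -mulr_sumr ler_piMr ?mulr_ge0// sum_inv_sqr_le1//.
    by apply/allP => p /primeP/prime_gt1.
  apply: le_trans (ler_norm_sum _ _ _) _.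
  rewrite big_seq [leRHS]big_seq; apply: ler_sum => p /primeP pp.
  have p0 := prime_gt0 pp; have P0 : (0 : R) < p%:R by rewrite ltr0n.
  rewrite normrM -mulrA ler_pM ?e2//.
  apply: le_trans (ler_norm_sum _ _ _) _.
  apply: (@le_trans _ _ (\sum_(1 <= m < (x %/ p).+1 | (p %| m)%N) 1)).
    apply: ler_sum => m _; rewrite normrM mulr_ile1 ?normr_moebius_le1//; exact: w1.
  rewrite (sum_multiples (fun=> 1))// sumr_const_nat subn1/= -divnMA.
  by rewrite ler_pdivlMr ?exprn_gt0// -natrX -natrM ler_nat -mulnn leq_trunc_div.
(* The inequality [u <= 1 + u ^ 2 / 4] plays the part of Cauchy-Schwarz; its factor [1 / 4] lets the
   resulting [x * Q / 4] be absorbed by [x * Q]. *)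
have sb : `|\sum_(1 <= n < x.+1) mu n * w n * b n| <= x%:R + x%:R * (Q + 1) / 4.
  apply: (@le_trans _ _ (\sum_(1 <= n < x.+1) (1 + b n ^+ 2 / 4))).
    apply: le_trans (ler_norm_sum _ _ _) _; apply: ler_sum => n _.
    have mw : `|mu n * w n| <= 1 by rewrite normrM mulr_ile1 ?normr_moebius_le1.
    rewrite normrM -[b n ^+ 2]real_normK ?num_real//.
    have := normr_ge0 (b n); move: `|b n| `|mu n * w n| mw (normr_ge0 (mu n * w n)) => u v v1 v0 u0.
    have : v * u <= u by rewrite ler_piMl.
    have := sqr_ge0 (u - 2); rewrite sqrrB; lra.
  rewrite big_split/= sumr_const_nat subn1/= lerD2l -mulr_suml.
  by rewrite ler_pM2r ?invr_gt0.
move: sb; rewrite Ident => sb.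
have : x%:R * Q <= x%:R * 5.
  move: sb err; rewrite !ler_norml => /andP[sb1 sb2] /andP[e1 e2'].
  move: (\sum_(p <- P) e p * _) sb1 sb2 e1 e2' => E; nra.
by rewrite ler_pM2l.
Qed.

End TuranKubiliusDual.

(** * Prime powers, and the mass of primes in a dyadic logarithmic window *)

Section PrimePowers.
Variable R : realType.
Implicit Types (n x p : nat).
Local Notation vM := (@mangoldt R).

Lemma mangoldt1 : vM 1 = 0.
Proof.
by have := sum_mangoldt R (ltn0Sn 0); rewrite big_mkcond big_nat1 dvdn1/= ln1.
Qed.

Lemma mangoldt_prime p : prime p -> vM p = ln p%:R.
Proof.
move=> pp; have p1 := prime_gt1 pp; rewrite -(sum_mangoldt R (prime_gt0 pp)).
rewrite big_mkcond (bigD1_seq p)/= ?iota_uniq ?mem_index_iota ?prime_gt0 ?ltnSn// dvdnn.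
rewrite big1 ?addr0// => d dp; case: ifP => // dvd.
case/primeP: pp => _ /(_ d dvd); rewrite (negbTE dp) orbF => /eqP ->.
exact: mangoldt1.
Qed.

Lemma sum_geometric_ge2 (u : R) k : 0 <= u <= 1 / 2 ->
  \sum_(2 <= i < k) u ^+ i <= 2 * u ^+ 2.
Proof.
move=> /andP[u0 u1].
have [k2|k2] := leqP k 2; first by rewrite big_geq// mulr_ge0 ?exprn_ge0.
have E m : (1 - u) * \sum_(2 <= i < m.+2) u ^+ i = u ^+ 2 - u ^+ m.+2.
  elim: m => [|m IH]; first by rewrite big_geq// subrr mulr0.
  by rewrite big_nat_recr//= mulrDr IH [u ^+ m.+3]exprS; ring.
case: k k2 => [|[|k]]// _.
have := E k; have : 0 <= u ^+ k.+2 by rewrite exprn_ge0.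
have : 0 <= \sum_(2 <= i < k.+2) u ^+ i by apply: sumr_ge0 => i _; rewrite exprn_ge0.
have := sqr_ge0 u; move: (u ^+ 2) (u ^+ k.+2) (\sum_(2 <= i < k.+2) u ^+ i) => a b c; nra.
Qed.

Lemma sum_inv_3half N : \sum_(2 <= n < N) (n%:R * Num.sqrt n%:R)^-1 <= 2 :> R.
Proof.
apply: (@le_trans _ _ (\sum_(2 <= n < N) 2 * ((Num.sqrt n.-1%:R)^-1 - (Num.sqrt n%:R)^-1))).
  apply: ler_sum_nat => -[|[|n]]// _ /=.
  set a := Num.sqrt n.+1%:R; set b := Num.sqrt n.+2%:R.
  have a0 : 0 < a by rewrite sqrtr_gt0 ltr0Sn.
  have ab : a <= b by rewrite ler_wsqrtr// ler_nat.
  have b0 : 0 < b by apply: lt_le_trans ab.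
  have E : b ^+ 2 = a ^+ 2 + 1 by rewrite !sqr_sqrtr// natr1.
  have -> : n.+2%:R = b ^+ 2 :> R by rewrite sqr_sqrtr.
  have -> : 2 * (a^-1 - b^-1) = (a * b * (a + b) / 2)^-1.
    have h : (b - a) * (a + b) = 1 by move: E; rewrite !expr2; lra.
    have ab0 : a + b != 0 by rewrite gt_eqF// addr_gt0.
    rewrite invf_div -[in RHS]h; field.
    by rewrite ab0 !gt_eqF.
  rewrite lef_pV2 ?posrE ?mulr_gt0 ?invr_gt0 ?exprn_gt0 ?addr_gt0//.
  by rewrite expr2; have := mulr_ge0 (ltW b0) (ltW b0); nra.
rewrite -mulr_sumr -[leRHS]mulr1 ler_pM2l//.
suff h k : \sum_(2 <= n < k.+2) ((Num.sqrt n.-1%:R)^-1 - (Num.sqrt n%:R)^-1) =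
    1 - (Num.sqrt k.+1%:R)^-1 :> R.
  case: N => [|[|N]]; try by rewrite big_geq.
  by rewrite h gerBl invr_ge0 sqrtr_ge0.
elim: k => [|k IH]; first by rewrite big_geq// sqrtr1 invr1 subrr.
by rewrite big_nat_recr//= IH/= addrA subrK.
Qed.

Lemma sum_mangoldt_nonprime x :
  \sum_(1 <= n < x.+1 | ~~ prime n) vM n / n%:R <= 8.
Proof.
rewrite (sum_prime_powers (fun n => ~~ prime n) (fun n => n%:R^-1)).
apply: (@le_trans _ _ (\sum_(1 <= p < x.+1 | prime p) 4 * (p%:R * Num.sqrt p%:R)^-1)).
  apply: ler_sum => p pp; have p0 := prime_gt0 pp.
  have P0 : (0 : R) < p%:R by rewrite ltr0n.
  have u0 : 0 <= p%:R^-1 :> R by rewrite invr_ge0.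
  apply: (@le_trans _ _ (ln p%:R * \sum_(2 <= k < x.+1) p%:R^-1 ^+ k)).
    rewrite mulr_sumr.
    rewrite (eq_bigr (fun k => ln p%:R * p%:R^-1 ^+ k)); last first.
      by move=> k _; rewrite natrX exprVn.
    apply: ler_sum_subrange => [k|k /andP[k1 kx] /andP[_ npk]].
      by rewrite mulr_ge0 ?exprn_ge0// ln_ge0// ler1n.
    rewrite kx !andbT; case: k k1 kx npk => [|[|]]//= _ _.
    by rewrite expn1 pp.
  apply: (@le_trans _ _ (2 * Num.sqrt p%:R * (2 * p%:R^-1 ^+ 2))).
    apply: ler_pM; rewrite ?ln_le_sqrt ?ln_ge0 ?ler1n//.
      by apply: sumr_ge0 => k _; rewrite exprn_ge0.
    apply: sum_geometric_ge2; rewrite u0/= div1r lef_pV2 ?posrE//.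
    by rewrite ler_nat prime_gt1.
  have s0 : 0 < Num.sqrt (p%:R : R) by rewrite sqrtr_gt0.
  have ps : p%:R = Num.sqrt (p%:R : R) ^+ 2 by rewrite sqr_sqrtr// ltW.
  move: (Num.sqrt _) s0 ps => s s0 ->.
  by rewrite le_eqVlt; apply/orP; left; apply/eqP; field; rewrite gt_eqF.
rewrite -mulr_sumr; suff : \sum_(1 <= i < x.+1 | prime i) (i%:R * Num.sqrt i%:R)^-1 <= 2 :> R by lra.
apply: le_trans (sum_inv_3half x.+1); apply: ler_sum_subrange => [n|n /andP[_ nx] pn].
  by rewrite invr_ge0 mulr_ge0 ?sqrtr_ge0.
by rewrite prime_gt1// nx.
Qed.

(** The constant [21] collects [12] from Mertens' bounds, [8] from the prime powers and [1] from
    rounding the right endpoint. *)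
Lemma prime_log_window (v : R) N : 2 <= v -> expR (2 * v) <= N%:R ->
  v - 21 <= \sum_(1 <= n < N | prime n && (v <= ln n%:R < 2 * v)) ln n%:R / n%:R.
Proof.
move=> v2 hN; set E1 := expR v; set E2 := expR (2 * v) in hN.
have E10 : 0 < E1 := expR_gt0 v; have E20 : 0 < E2 := expR_gt0 _.
(* Both endpoints have to be rounded to integers, and these lower bounds on [E1] and [E2] keep the
   integers positive. The right one, [y], is one less than the integer part of [E2]: the window is
   open on the right and [E2] may itself be an integer. *)
have E1v : 1 + v <= E1 := expR_ge1Dx v.
have E2v : 1 + 2 * v <= E2 := expR_ge1Dx _.
have E21 : E2 = E1 * E1 by rewrite -expRD; congr expR; ring.
set x := Num.truncn E1; set y := (Num.truncn E2).-1.
have /andP[x1 x2] := truncn_itv (ltW E10).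
have /andP[y1 y2] := truncn_itv (ltW E20).
have t2 : (1 < Num.truncn E2)%N by rewrite truncn_ge_nat ?ltW//; lra.
rewrite -/x -natr1 in x1 x2; rewrite -natr1 in y2.
have yE : (Num.truncn E2) = y.+1 by rewrite prednK// ltnW.
rewrite yE -natr1 in y1 y2.
have x0 : (0 < x)%N by rewrite -(ltr_nat R); lra.
have y0 : (0 < y)%N by rewrite -ltnS -yE.
have xy : (x <= y)%N by rewrite -(ler_nat R); nra.
have lx : ln (x%:R : R) <= v by rewrite -(expRK v) ler_ln ?posrE ?ltr0n.
have ly : 2 * v - 1 <= ln (y%:R : R).
  rewrite -ler_expR lnK ?posrE ?ltr0n// expRB -/E2 ler_pdivrMr ?expR_gt0//.
  by have := expR_ge1Dx (1 : R); nra.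
have := mangoldt_window R x0 xy; have := sum_mangoldt_nonprime y.
set S := \sum_(_ <= _ < _ | ~~ _) _; set T := \sum_(_ <= _ < _) _ => hS hT.
suff : T <= S + \sum_(1 <= n < N | prime n && (v <= ln n%:R < 2 * v)) ln n%:R / n%:R by lra.
rewrite /T (bigID prime)/= addrC lerD//.
  apply: ler_sum_subrange => [n|n /andP[xn ny] ->]; first by rewrite divr_ge0 ?mangoldt_ge0.
  by rewrite ny (leq_trans _ xn).
rewrite (eq_bigr (fun n => ln n%:R / n%:R)) => [|n pn]; last by rewrite mangoldt_prime.
apply: ler_sum_subrange => [n|n /andP[xn ny] pn]; first by rewrite divr_ge0 ?ln_nat_ge0.
have n0 : (0 < n)%N by exact: leq_trans xn.
have N0 : (0 : R) < n%:R by rewrite ltr0n.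
have nE2 : n%:R + 1 <= E2 by rewrite (le_trans _ y1)// lerD2r ler_nat -ltnS.
rewrite n0 pn/=; apply/and3P; split.
- by rewrite -(ltr_nat R) (lt_le_trans _ hN)//; lra.
- rewrite -(expRK v) ler_ln ?posrE// -/E1 (le_trans (ltW x2))//.
  by rewrite natr1 ler_nat.
- by rewrite -(expRK (2 * v)) ltr_ln ?posrE// -/E2; lra.
Qed.

End PrimePowers.

(** By hypothesis the translates of the selected points by [0], [s], ..., [K * s] are pairwise
    disjoint, and all of them lie in an interval of length [J + K * s]. *)
Lemma translates_count (A : pred nat) (J K s : nat) :
  (forall j j' d, (J <= j < J + J)%N -> (J <= j' < J + J)%N -> A j -> A j' ->
     (1 <= d <= K)%N -> j' <> (j + d * s)%N) ->
  (K.+1 * count A (iota J J) <= J + K * s)%N.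
Proof.
move=> hA; set t := [seq j <- iota J J | A j].
have tP j : j \in t -> (J <= j < J + J)%N /\ A j.
  by rewrite mem_filter mem_iota => /andP[].
have inj : uniq [seq (j + i * s)%N | i <- iota 0 K.+1, j <- t].
  apply: allpairs_uniq; rewrite ?filter_uniq ?iota_uniq// => x y hx hy.
  have /allpairsP[[a b] /= [ai bt ->]] := hx.
  have /allpairsP[[a' b'] /= [ai' bt' ->]] := hy.
  rewrite -[0%N :: iota 1 K]/(iota 0 K.+1) mem_iota in ai.
  rewrite -[0%N :: iota 1 K]/(iota 0 K.+1) mem_iota in ai'.
  have [hb Ab] := tP _ bt; have [hb' Ab'] := tP _ bt' => /= E.
  case: (ltngtP a a') => [lt|lt|eq].
  - exfalso; apply: (hA b' b (a' - a)%N) => //; first by rewrite subn_gt0 lt/=; lia.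
    rewrite mulnBl; have : (a * s <= a' * s)%N by rewrite leq_mul// ltnW.
    by lia.
  - exfalso; apply: (hA b b' (a - a')%N) => //; first by rewrite subn_gt0 lt/=; lia.
    rewrite mulnBl; have : (a' * s <= a * s)%N by rewrite leq_mul// ltnW.
    by lia.
  - by rewrite eq in E *; congr (_, _); lia.
have sub : {subset [seq (j + i * s)%N | i <- iota 0 K.+1, j <- t] <= iota J (J + K * s)}.
  move=> k /allpairsP[[i j] /= [hi /tP[hj _] ->]].
  rewrite -[0%N :: iota 1 K]/(iota 0 K.+1) mem_iota in hi; rewrite mem_iota.
  have : (i * s <= K * s)%N by rewrite leq_mul2r; apply/orP; right; lia.
  by lia.
by have := uniq_leq_size inj sub; rewrite size_allpairs !size_iota size_filter.
Qed.

(** * Congruent primes at a nearly prescribed logarithmic distance *)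

Section ClosePrimePairs.
Variable R : realType.
Local Notation vM := (@mangoldt R).
Implicit Types (B : pred nat).

Lemma ler_sum_term (T : eqType) (s : seq T) (F : T -> R) i :
  (forall j, 0 <= F j) -> i \in s -> F i <= \sum_(j <- s) F j.
Proof.
by move=> F0 /perm_to_rem pe; rewrite (perm_big _ pe) big_cons lerDl sumr_ge0.
Qed.

(** The [I] windows are disjoint; if each carried more than [1 / 8] of the sum over [B], the total
    would exceed [C]. *)
Lemma exists_sparse_dyadic_window B (u C : R) (I Y : nat) : 8 * C < I%:R ->
  \sum_(1 <= p < Y | prime p && B p) (p%:R : R)^-1 <= C ->
  exists2 i, (i < I)%N &
    \sum_(1 <= p < Y | prime p && B p && (2 ^+ i * u <= ln p%:R < 2 * (2 ^+ i * u))) (p%:R : R)^-1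
      <= 1 / 8.
Proof.
move=> CI sumB; apply: contrapT => H.
pose T k := \sum_(1 <= p < Y | prime p && B p && (ln p%:R < 2 ^+ k * u)) (p%:R : R)^-1.
have hT k : (k <= I)%N -> k%:R / 8 <= T k.
  elim: k => [|k IH] kI; first by rewrite mul0r sumr_ge0.
  apply: (@le_trans _ _ (T k + 1 / 8)).
    by have := IH (ltnW kI); rewrite -natr1; lra.
  have : 1 / 8 < \sum_(1 <= p < Y | prime p && B p && (2 ^+ k * u <= ln p%:R < 2 * (2 ^+ k * u))) (p%:R : R)^-1.
    by rewrite ltNge; apply/negP => le8; apply: H; exists k.
  set W := \sum_(_ <= _ < _ | _) _ => hW; apply: (@le_trans _ _ (T k + W)).
    by rewrite lerD2l ltW.
  rewrite /T /W [X in X + _]big_mkcond [X in _ + X]big_mkcond [leRHS]big_mkcond.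
  rewrite -big_split/=; apply: ler_sum => p _.
  rewrite exprS -mulrA; case: (prime p && B p) => /=; last by rewrite addr0.
  case: (ltP (ln p%:R) (2 ^+ k * u)) => /=; rewrite ?addr0 ?add0r// => h1.
  case: ifP => // /negbT; rewrite -leNgt => h2.
  suff : 0 <= 2 ^+ k * u by lra.
  by apply: le_trans (ln_nat_ge0 R p) (ltW h1).
have := hT I (leqnn I); apply/negP; rewrite -ltNge.
apply: (@le_lt_trans _ _ C); last by rewrite ltr_pdivlMr; lra.
apply: le_trans sumB; apply: ler_sum_subrange => // p pY /andP[-> _].
by rewrite pY.
Qed.

Definition occupied_window (q : nat) (eta : R) B (Y b j : nat) :=
  has (fun p => [&& prime p, ~~ B p, (p %% q == b)%N &
    j%:R * eta <= ln p%:R < j%:R * eta + eta]) (index_iota 1 Y).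

(** Each prime counted on the left lies in an occupied window of its own class, and one window
    carries at most [6 * eta] by [mangoldt_log_window]. *)
Lemma good_window_mass q (eta : R) J B (Y : nat) : (0 < q)%N -> 0 < eta <= 1 / 4 ->
  100 * 100 / eta <= J%:R * eta ->
  \sum_(1 <= p < Y | prime p && ~~ B p && (J%:R * eta <= ln p%:R < 2 * (J%:R * eta)))
    ln p%:R / p%:R <=
  6 * eta * \sum_(0 <= b < q) (count (occupied_window q eta B Y b) (iota J J))%:R.
Proof.
move=> q0 /andP[eta0 eta4] Jeta; set A := occupied_window q eta B Y.
have f0 (p : nat) : 0 <= ln (p%:R : R) / p%:R by rewrite divr_ge0 ?ln_nat_ge0.
pose t b j p : R := if [&& A b j, prime p, (p %% q == b)%N &
  j%:R * eta <= ln p%:R < j%:R * eta + eta] then ln p%:R / p%:R else 0.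
have t0 b j p : 0 <= t b j p by rewrite /t; case: ifP.
apply: (@le_trans _ _ (\sum_(1 <= p < Y) \sum_(0 <= b < q) \sum_(j <- iota J J) t b j p)).
  rewrite big_mkcond; apply: ler_sum_nat => p /andP[p0 pY].
  case: ifP => [/andP[/andP[pp nBp] /andP[l1 l2]]|_]; last first.
    by apply: sumr_ge0 => b _; apply: sumr_ge0.
  set j := Num.truncn (ln p%:R / eta).
  have lp0 : 0 <= ln (p%:R : R) / eta by rewrite divr_ge0 ?ln_nat_ge0 ?ltW.
  have /andP[j1 j2] := truncn_itv lp0; rewrite -/j in j1 j2.
  rewrite ler_pdivlMr// in j1; rewrite ltr_pdivrMr// -natr1 in j2.
  have jJ : j \in iota J J.
    rewrite mem_iota truncn_ge_nat// ler_pdivlMr// l1/= -(ltr_nat R).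
    by rewrite natrD -(ltr_pM2r eta0); lra.
  have win : j%:R * eta <= ln p%:R < j%:R * eta + eta by rewrite j1/=; lra.
  have -> : ln p%:R / p%:R = t (p %% q)%N j p.
    rewrite /t pp eqxx win !andbT ifT//; apply/hasP; exists p; last by rewrite pp nBp eqxx win.
    by rewrite mem_index_iota p0.
  apply: (@le_trans _ _ (\sum_(j <- iota J J) t (p %% q)%N j p)).
    by apply: (ler_sum_term (F := fun j => t (p %% q)%N j p)).
  apply: (ler_sum_term (F := fun b => \sum_(j <- iota J J) t b j p)).
    by move=> b; apply: sumr_ge0.
  by rewrite mem_index_iota ltn_mod.
rewrite exchange_big/= mulr_sumr; apply: ler_sum_nat => b _.
rewrite exchange_big/= -sum1_count natr_sum mulr_sumr [leRHS]big_mkcond/=.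
rewrite big_seq [leRHS]big_seq; apply: ler_sum => j; rewrite mem_iota => /andP[Jj _].
rewrite /t; case: (A b j) => /=; last by rewrite big1.
rewrite mulr1; apply: (@le_trans _ _ (\sum_(1 <= n < Y | j%:R * eta <= ln n%:R < j%:R * eta + eta) vM n / n%:R)).
  rewrite [leRHS]big_mkcond; apply: ler_sum => p _.
  case: (boolP (prime p)) => [pp|_] /=; last by case: ifP => // _; rewrite divr_ge0 ?mangoldt_ge0.
  rewrite mangoldt_prime//; case: ifP => [/andP[_ ->]//|_]; case: ifP => // _.
apply: mangoldt_log_window; first by rewrite eta0.
by apply: le_trans Jeta _; rewrite ler_pM2r// ler_nat.
Qed.

(** The distance [d] is fixed before the exceptional set [B], which will later depend on [x], [x']
    and [w]. If each [d <= K] were blocked by a set of its own, the union of these sets would block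
    all [d] together. In a dyadic window where the union is sparse, no two occupied windows of one
    class differ by [d * s], so by [translates_count] each class occupies at most [2 * J / (K + 1)]
    of them. With [K = 100 * q] their mass is too small for Mertens' bounds. *)
Lemma close_prime_pairs (q s : nat) (h C : R) : (0 < q)%N -> (0 < s)%N ->
  0 < h -> h / s%:R <= 1 / 4 ->
  exists Y d : nat, (1 <= d <= 100 * q)%N /\
  forall B, \sum_(1 <= p < Y | prime p && B p) (p%:R : R)^-1 <= C ->
  exists p p', [/\ prime p, prime p', (p < Y)%N & (p' < Y)%N] /\
    [/\ ~~ B p, ~~ B p', p = p' %[mod q] & `|ln p'%:R - ln p%:R - d%:R * h| <= h / s%:R].
Proof.
move=> q0 s0 h0; set eta := h / s%:R => eta4.
have S0 : (0 : R) < s%:R by rewrite ltr0n.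
have eta0 : 0 < eta by rewrite divr_gt0.
pose K := (100 * q)%N.
pose C1 := K%:R * `|C|.
(* The three terms ensure [K * s <= J], then [v - 21 - v / 4 >= v / 2] (which is [v >= 84]), and
   finally the hypothesis of [mangoldt_log_window]. *)
pose J0 := (Num.truncn (K%:R * s%:R + 84 / eta + 100 * 100 / eta / eta)).+1.
have J0P : K%:R * s%:R + 84 / eta + 100 * 100 / eta / eta < J0%:R by exact: truncnS_gt.
have [a1 a2 a3] : [/\ 0 <= K%:R * s%:R :> R, 0 <= 84 / eta & 0 <= 100 * 100 / eta / eta].
  by split; rewrite ?mulr_ge0 ?invr_ge0// ltW.
have J0K : K%:R * s%:R <= J0%:R :> R by move: a2 a3 J0P; inv_lra.
have J084 : 84 <= J0%:R * eta by rewrite -ler_pdivrMr//; lra.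
have J0eta : 100 * 100 / eta <= J0%:R * eta by rewrite -ler_pdivrMr//; lra.
pose I := (Num.truncn (8 * C1)).+1.
have IP : 8 * C1 < I%:R by exact: truncnS_gt.
pose Y := (Num.truncn (expR (2 ^+ I * (J0%:R * eta)))).+1.
have YP : expR (2 ^+ I * (J0%:R * eta)) <= Y%:R by apply/ltW; exact: truncnS_gt.
exists Y; apply: contrapT => H.
have /choice[Bf BfP] : forall d : nat, exists B, (1 <= d <= K)%N ->
    \sum_(1 <= p < Y | prime p && B p) (p%:R : R)^-1 <= C /\
    forall p p', prime p -> prime p' -> (p < Y)%N -> (p' < Y)%N -> ~~ B p -> ~~ B p' ->
      p = p' %[mod q] -> ~~ (`|ln p'%:R - ln p%:R - d%:R * h| <= eta).
  move=> d; have [dK|dK] := boolP (1 <= d <= K)%N; last by exists xpred0.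
  apply: contrapT => HB; apply: H; exists d; split=> // B sB.
  apply: contrapT => Hp; apply: HB; exists B => _; split=> // p p' pp pp' pY pY' Bp Bp' pq.
  by apply/negP => le; apply: Hp; exists p, p'.
pose B p := has (fun d => Bf d p) (iota 1 K).
have sumB : \sum_(1 <= p < Y | prime p && B p) (p%:R : R)^-1 <= C1.
  apply: (@le_trans _ _ (\sum_(d <- iota 1 K) \sum_(1 <= p < Y | prime p && Bf d p) (p%:R : R)^-1)).
    under [leRHS]eq_bigr do rewrite big_mkcond.
    rewrite exchange_big big_mkcond; apply: ler_sum => p _.
    have t0 d : 0 <= (if prime p && Bf d p then (p%:R : R)^-1 else 0).
      by case: ifP => // _; rewrite invr_ge0.
    case: ifP => [/andP[pp /hasP[d dK Bdp]]|_]; last by apply: sumr_ge0.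
    by apply: le_trans (ler_sum_term t0 dK); rewrite pp Bdp.
  rewrite /C1 -[X in _ <= X%:R * _](size_iota 1 K) mulr_natl -iter_addr_0.
  rewrite -[size _]count_predT -big_const_seq big_seq [leRHS]big_seq.
  apply: ler_sum => d; rewrite mem_iota add1n ltnS => dK.
  by have [h1 _] := BfP d dK; apply: le_trans h1 (ler_norm _).
have [i iI sparse] := exists_sparse_dyadic_window (J0%:R * eta) IP sumB.
pose J := (2 ^ i * J0)%N; pose v := J%:R * eta.
have vE : 2 ^+ i * (J0%:R * eta) = v by rewrite /v /J natrM natrX mulrA.
have JJ0 : (J0 <= J)%N by rewrite leq_pmull// expn_gt0.
have vJ0 : J0%:R * eta <= v by rewrite ler_pM2r// ler_nat.
rewrite vE in sparse.
have mass := prime_log_window (N := Y) (_ : 2 <= v).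
have {mass} mass : v - 21 <= \sum_(1 <= n < Y | prime n && (v <= ln n%:R < 2 * v)) ln n%:R / n%:R.
  apply: mass; first by lra.
  apply: le_trans YP; rewrite ler_expR -vE mulrA -exprS ler_wpM2r ?ler_weXn2l//; first by lra.
  by rewrite ler1n.
pose G : R := \sum_(1 <= p < Y | prime p && ~~ B p && (v <= ln p%:R < 2 * v)) ln p%:R / p%:R.
have Gv : v / 2 <= G.
  suff : \sum_(1 <= n < Y | prime n && (v <= ln n%:R < 2 * v)) ln n%:R / n%:R <= 2 * v * (1 / 8) + G by lra.
  apply: (@le_trans _ _ (2 * v * (\sum_(1 <= p < Y | prime p && B p && (v <= ln p%:R < 2 * v)) (p%:R : R)^-1) + G)); last first.
    by rewrite lerD2r ler_pM2l//; lra.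
  rewrite (bigID B)/=; apply: lerD; last first.
    rewrite le_eqVlt; apply/orP; left; apply/eqP; apply: eq_bigl => p.
    by case: (prime p); case: (B p); rewrite ?andbT ?andbF.
  rewrite mulr_sumr (eq_bigl (fun p => prime p && B p && (v <= ln p%:R < 2 * v))); last first.
    by move=> p; case: (prime p); case: (B p); rewrite ?andbT ?andbF.
  by apply: ler_sum => p /andP[_ /andP[_ l2]]; rewrite ler_wpM2r ?invr_ge0// ltW.
have eta_itv : 0 < eta <= 1 / 4 by rewrite eta0.
have Jeta : 100 * 100 / eta <= J%:R * eta by apply: le_trans vJ0.
have := good_window_mass B Y q0 eta_itv Jeta; rewrite -/v -/G.
set A := occupied_window q eta B Y.
have cnt b : (K.+1 * count (A b) (iota J J) <= J + K * s)%N.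
  apply: translates_count => j j' d hj hj' /hasP[p pY /and4P[pp Bp pb /andP[l1 l2]]].
  move=> /hasP[p' pY' /and4P[pp' Bp' pb' /andP[l1' l2']]] dK jE.
  have [_ /(_ p p' pp pp')] := BfP d dK.
  move: pY pY'; rewrite !mem_index_iota => /andP[_ pY] /andP[_ pY'].
  have nB r : ~~ B r -> ~~ Bf d r.
    by apply: contra => Bdr; apply/hasP; exists d; rewrite // mem_iota add1n ltnS.
  move=> /(_ pY pY' (nB _ Bp) (nB _ Bp')); rewrite (eqP pb) (eqP pb') => /(_ erefl)/negP; apply.
  have E : j'%:R * eta = j%:R * eta + d%:R * h.
    by rewrite jE natrD natrM mulrDl -mulrA; congr (_ + _ * _); rewrite /eta; field; rewrite gt_eqF.
  by rewrite ler_norml; apply/andP; split; lra.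
apply/negP; rewrite -ltNge.
have KsJ : (K * s <= J)%N.
  by apply: leq_trans JJ0; rewrite -(ler_nat R) natrM.
have cntR b : (K%:R + 1) * (count (A b) (iota J J))%:R <= 2 * J%:R :> R.
  by rewrite natr1 -!natrM ler_nat; apply: leq_trans (cnt b) _; rewrite mul2n -addnn leq_add2l.
have Sle : \sum_(0 <= b < q) (count (A b) (iota J J))%:R <= q%:R * (2 * J%:R / (K%:R + 1)) :> R.
  have -> : q%:R * (2 * J%:R / (K%:R + 1)) = \sum_(0 <= b < q) (2 * J%:R / (K%:R + 1)) :> R.
    by rewrite sumr_const_nat subn0 mulr_natl.
  by apply: ler_sum => b _; rewrite ler_pdivlMr// mulrC.
apply: le_lt_trans (_ : 6 * eta * (q%:R * (2 * J%:R / (K%:R + 1))) < _).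
  by rewrite ler_pM2l// mulr_gt0.
apply: lt_le_trans Gv.
have -> : 6 * eta * (q%:R * (2 * J%:R / (K%:R + 1))) = 12 * q%:R * v / (K%:R + 1).
  by rewrite /v; field; rewrite gt_eqF.
rewrite ltr_pdivrMr// /K natrM.
have Q0 : 0 < q%:R :> R by rewrite ltr0n.
by nra.
Qed.

End ClosePrimePairs.

(** * Slow variation of the Moebius means *)

Section SlowVariation.
Variable R : realType.
Implicit Types (w : nat -> R).

Definition periodic_mod (q : nat) w := forall m n, m = n %[mod q] -> w m = w n.

Definition moebius_mean w (x : nat) : R := moebius_sum w x / x%:R.

Lemma moebius_sum_ext w w' x : w =1 w' -> moebius_sum w x = moebius_sum w' x.
Proof. by move=> ww'; apply: eq_bigr => n _; rewrite ww'. Qed.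

(** As a function of [ln y], the quotient [moebius_sum w y / y] is Lipschitz with constant [2]; the
    last two terms pay for the integer parts. The case [p = p' = 1] concerns [moebius_mean]
    itself. *)
Lemma moebius_sum_lipschitz w x x' p p' : bounded1 w ->
  (0 < p <= x)%N -> (0 < p' <= x')%N ->
  `|p%:R * moebius_sum w (x %/ p) / x%:R - p'%:R * moebius_sum w (x' %/ p') / x'%:R|
  <= 2 * `|ln (x%:R / p%:R) - ln (x'%:R / p'%:R)| + p%:R / x%:R + p'%:R / x'%:R.
Proof.
move=> w1; wlog le : x x' p p' / x%:R / p%:R <= x'%:R / p'%:R :> R.
  move=> wl hp hp'; case: (leP (x%:R / p%:R : R) (x'%:R / p'%:R)) => [|/ltW] le.
    exact: wl.
  by rewrite distrC [X in 2 * X]distrC addrAC wl.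
move=> /andP[p0 px] /andP[p0' px'].
have P0 : (0 : R) < p%:R by rewrite ltr0n.
have P0' : (0 : R) < p'%:R by rewrite ltr0n.
have X0 : (0 : R) < x%:R by rewrite ltr0n (leq_trans p0).
have X0' : (0 : R) < x'%:R by rewrite ltr0n (leq_trans p0').
have r0 : (0 : R) < x%:R / p%:R by rewrite divr_gt0.
have r0' : (0 : R) < x'%:R / p'%:R by rewrite divr_gt0.
have y1 : (x %/ p)%:R <= x%:R / p%:R :> R.
  by rewrite ler_pdivlMr// -natrM ler_nat leq_trunc_div.
have y1' : (x' %/ p')%:R <= x'%:R / p'%:R :> R.
  by rewrite ler_pdivlMr// -natrM ler_nat leq_trunc_div.
have y2 : x%:R / p%:R <= (x %/ p)%:R + 1 :> R.
  by rewrite ler_pdivrMr// natr1 -natrM ler_nat ltnW// ltn_ceil.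
have y2' : x'%:R / p'%:R < (x' %/ p')%:R + 1 :> R.
  by rewrite ltr_pdivrMr// natr1 -natrM ltr_nat ltn_ceil.
have yy : (x %/ p <= x' %/ p')%N.
  by rewrite -ltnS -(ltr_nat R) -natr1; lra.
have hS := normr_moebius_sumB w1 yy; have hs := normr_moebius_sum_le (x %/ p) w1.
have l : 1 - (x%:R / p%:R) / (x'%:R / p'%:R) <= ln (x'%:R / p'%:R) - ln (x%:R / p%:R) :> R.
  rewrite -lerN2 !opprB; apply: le_trans (lnB_le r0 r0') _.
  by rewrite mulrBl divff ?gt_eqF.
have -> : p%:R * moebius_sum w (x %/ p) / x%:R = moebius_sum w (x %/ p) / (x%:R / p%:R).
  by field; rewrite !gt_eqF.
have -> : p'%:R * moebius_sum w (x' %/ p') / x'%:R = moebius_sum w (x' %/ p') / (x'%:R / p'%:R).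
  by field; rewrite !gt_eqF.
have <- : (x%:R / p%:R)^-1 = p%:R / x%:R :> R by rewrite invf_div.
have <- : (x'%:R / p'%:R)^-1 = p'%:R / x'%:R :> R by rewrite invf_div.
rewrite distrC [X in 2 * X]distrC [X in 2 * X]ger0_norm; last first.
  by rewrite subr_ge0 ler_ln.
move: (ln (x'%:R / p'%:R)) (ln (x%:R / p%:R)) l => L' L.
move: (x%:R / p%:R : R) (x'%:R / p'%:R : R) r0 r0' y1 y1' y2 y2' le => r r' r0 r0' y1 y1' y2 y2' le l.
move: ((x %/ p)%:R : R) ((x' %/ p')%:R : R) (moebius_sum w (x %/ p)) (moebius_sum w (x' %/ p')) y1 y1' y2 y2' hS hs.
move=> y y' S S' y1 y1' y2 y2' hS hs.
have ri : 0 < r^-1 by rewrite invr_gt0.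
have ri' : 0 < r'^-1 by rewrite invr_gt0.
have E : S' / r' - S / r = (S' - S) / r' - S * (r^-1 - r'^-1) by ring.
have rr' : r'^-1 <= r^-1 by rewrite lef_pV2.
apply: (@le_trans _ _ ((y' - y) / r' + y * (r^-1 - r'^-1))).
  rewrite E; apply: le_trans (ler_normB _ _) _; apply: lerD; rewrite normrM.
    by rewrite (gtr0_norm ri') ler_wpM2r// ltW.
  by rewrite [X in _ * X]ger0_norm ?subr_ge0// ler_wpM2r// subr_ge0.
have u1 : r * r^-1 = 1 by rewrite divff ?gt_eqF.
have u2 : r' * r'^-1 = 1 by rewrite divff ?gt_eqF.
have k1 : y * (r^-1 - r'^-1) <= r * (r^-1 - r'^-1) by rewrite ler_wpM2r// subr_ge0.
have k2 : (y' - y) / r' <= (r' - r + 1) / r' by rewrite ler_wpM2r ?(ltW ri')//; lra.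
have := k1; have := k2; have := l; have := ltW ri.
move: (r^-1) (r'^-1) u1 u2 {k1 k2 l ri ri' rr' E} => u u' u1 u2; lra.
Qed.

(** Take primes [p = p' %[mod q]] with [ln (p' / p)] close to [d * h], for which the Turan-Kubilius
    relation holds at [x] and at [x'] respectively. The two dilates of [w] coincide by periodicity,
    and [x / p], [x' / p'] are close on the logarithmic scale, so the Lipschitz bound compares the
    two means. *)
Lemma moebius_quasi_period (q : nat) (h e : R) : (0 < q)%N -> 0 < h -> 0 < e ->
  exists d x0 : nat, (1 <= d <= 100 * q)%N /\
  forall x x', (x0 <= x)%N -> (x0 <= x')%N ->
    `|ln x'%:R - ln x%:R - d%:R * h| <= e / 16 ->
  forall w, bounded1 w -> periodic_mod q w ->
    `|moebius_mean w x - moebius_mean w x'| <= e.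
Proof.
move=> q0 h0 e0.
pose s := (Num.truncn (4 * h + 16 * h / e)).+1.
have sP : 4 * h + 16 * h / e < s%:R by exact: truncnS_gt.
have he0 : 0 < 16 * h / e by rewrite divr_gt0// mulr_gt0.
have hs1 : h / s%:R <= 1 / 4 by rewrite ler_pdivrMr//; lra.
have hs2 : h / s%:R <= e / 16.
  have : 16 * h / e < s%:R by lra.
  by rewrite ltr_pdivrMr// ler_pdivrMr//; lra.
pose C := 10 / (e / 4) ^+ 2.
have [Y [d [dK pairs]]] := close_prime_pairs C q0 (ltn0Sn _) h0 hs1.
pose x0 := (16 * Y ^ 2 + (Num.truncn (16 * Y%:R / e)).+1)%N.
exists d, x0; split=> // x x' xx0 xx0' lnxx' w w1 wq.
have x0P y : (x0 <= y)%N -> [/\ (0 < y)%N, (16 * Y ^ 2 <= y)%N & Y%:R / y%:R <= e / 16].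
  rewrite /x0 => hy; have y0 : (0 < y)%N by apply: leq_trans hy; rewrite addnS.
  split=> //; first by apply: leq_trans hy; exact: leq_addr.
  have : 16 * Y%:R / e < y%:R.
    by apply: lt_le_trans (truncnS_gt _) _; rewrite ler_nat (leq_trans _ hy)// leq_addl.
  rewrite ltr_pdivrMr// ler_pdivrMr ?ltr0n//; lra.
have [y0 yY Ye] := x0P _ xx0; have [y0' yY' Ye'] := x0P _ xx0'.
pose E z p := (moebius_sum w z + p%:R * moebius_sum (fun n => w (p * n)%N) (z %/ p)) / z%:R.
pose P := [seq p <- index_iota 1 Y | prime p].
have uP : uniq P by rewrite filter_uniq// iota_uniq.
have aP : all prime P by apply/allP => p; rewrite mem_filter => /andP[].
have sizeP : (size P <= Y)%N.
  by rewrite size_filter (leq_trans (count_size _ _))// size_iota leq_subr.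
have TK z : (0 < z)%N -> (16 * Y ^ 2 <= z)%N -> \sum_(p <- P) E z p ^+ 2 / p%:R <= 5.
  move=> z0 Yz; apply: turan_kubilius_dual => //.
  by apply: leq_trans Yz; rewrite leq_mul2l leq_exp2r.
have sparse z : (0 < z)%N -> (16 * Y ^ 2 <= z)%N ->
    (e / 4) ^+ 2 * (\sum_(1 <= p < Y | prime p && (e / 4 < `|E z p|)) (p%:R : R)^-1) <= 5.
  move=> z0 Yz; apply: le_trans (TK z z0 Yz).
  rewrite /P big_filter mulr_sumr big_mkcondr; apply: ler_sum => p _.
  case: ifP => [h1|_]; last by rewrite divr_ge0 ?sqr_ge0.
  rewrite ler_wpM2r ?invr_ge0// -[leRHS]real_normK ?num_real//.
  by apply: lerXn2r; rewrite ?nnegrE ?divr_ge0 ?(ltW e0) ?(ltW h1).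
pose B p := (e / 4 < `|E x p|) || (e / 4 < `|E x' p|).
have sumB : \sum_(1 <= p < Y | prime p && B p) (p%:R : R)^-1 <= C.
  rewrite /C ler_pdivlMr ?exprn_gt0 ?divr_gt0//.
  have := sparse x y0 yY; have := sparse x' y0' yY'.
  set Sx' := \sum_(_ <= _ < _ | _) _; set Sx := \sum_(_ <= _ < _ | _ && (_ < `|E x _|)) _.
  move=> h1 h2; have : \sum_(1 <= p < Y | prime p && B p) (p%:R : R)^-1 <= Sx + Sx'.
    rewrite /Sx /Sx' [leLHS]big_mkcond [X in _ <= X + _]big_mkcond [X in _ <= _ + X]big_mkcond.
    rewrite -big_split/=; apply: ler_sum => p _; rewrite /B.
    have : 0 <= (p%:R : R)^-1 by rewrite invr_ge0.
    case: (prime p) => /=; last by rewrite addr0.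
    by case: (_ < `|E x p|); case: (_ < `|E x' p|) => /=; inv_lra.
  have : 0 < (e / 4) ^+ 2 by rewrite exprn_gt0 ?divr_gt0.
  by move: ((e / 4) ^+ 2) h1 h2 => c h1 h2 c0; nra.
have [p [p' [[pp pp' pY pY'] [Bp Bp' pq lnpp']]]] := pairs B sumB.
have p0 := prime_gt0 pp; have p0' := prime_gt0 pp'.
have px z r : (0 < z)%N -> (16 * Y ^ 2 <= z)%N -> (r < Y)%N -> (r <= z)%N.
  move=> _ Yz rY; apply: leq_trans Yz; apply: leq_trans (ltnW rY) _.
  by rewrite -mulnn mulnA leq_pmull// muln_gt0 (leq_trans _ rY).
move: Bp Bp'; rewrite /B !negb_or -!leNgt => /andP[Ep _] /andP[_ Ep'].
pose w' n := w (p * n)%N.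
have w'1 : bounded1 w' by move=> n; exact: w1.
have pxx : (0 < p <= x)%N by rewrite p0 (px _ _ y0 yY pY).
have pxx' : (0 < p' <= x')%N by rewrite p0' (px _ _ y0' yY' pY').
have L := moebius_sum_lipschitz w'1 pxx pxx'.
have ew : moebius_sum (fun n => w (p' * n)%N) (x' %/ p') = moebius_sum w' (x' %/ p').
  by apply: moebius_sum_ext => n; apply: wq; rewrite -modnMml -pq modnMml.
have E1 : moebius_mean w x = E x p - p%:R * moebius_sum w' (x %/ p) / x%:R.
  by rewrite /moebius_mean /E mulrDl addrK.
have E2 : moebius_mean w x' = E x' p' - p'%:R * moebius_sum w' (x' %/ p') / x'%:R.
  by rewrite /moebius_mean /E ew mulrDl addrK.
have hp z r : (0 < z)%N -> (r < Y)%N -> Y%:R / z%:R <= e / 16 -> r%:R / z%:R <= e / 16 :> R.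
  move=> z0 rY; apply: le_trans; rewrite ler_wpM2r ?invr_ge0//.
  by rewrite ler_nat ltnW.
have := hp x p y0 pY Ye; have := hp x' p' y0' pY' Ye'.
have : `|ln (x%:R / p%:R) - ln (x'%:R / p'%:R)| <= e / 8 :> R.
  rewrite !ln_div ?posrE ?ltr0n//.
  move: lnxx' (le_trans lnpp' hs2); rewrite !ler_norml => /andP[a1 a2] /andP[b1 b2].
  by apply/andP; split; lra.
move: Ep Ep' L; rewrite E1 E2.
move: (E x p) (E x' p') (p%:R * _ / _) (p'%:R * _ / _) (p%:R / x%:R) (p'%:R / x'%:R).
move=> a b c c' u u'; rewrite !ler_norml.
move=> /andP[a1 a2] /andP[b1 b2] L k1 k2 k3.
have : `|c - c'| <= 2 * (e / 8) + e / 16 + e / 16.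
  apply: le_trans; first by rewrite ler_norml; exact: L.
  by move: k1; rewrite -ler_norml; lra.
by rewrite ler_norml => /andP[c1 c2]; apply/andP; split; lra.
Qed.

(** The integer [d] of the quasi-period is known only to be at most [100 * q]. With [h = t / D] and
    [D = (100 * q)!], the shift [t] is a multiple of [d * h] for every such [d]. It is reached in
    [D / d] steps, whose errors [e1] add up to at most [D * e1 = e / 2]. *)
Lemma moebius_mean_slow (q : nat) (t e : R) : (0 < q)%N -> 0 < t -> 0 < e ->
  exists x0 : nat, exists2 dl : R, 0 < dl &
  forall x x', (x0 <= x)%N -> (x0 <= x')%N -> `|ln x'%:R - ln x%:R - t| <= dl ->
  forall w, bounded1 w -> periodic_mod q w ->
    `|moebius_mean w x - moebius_mean w x'| <= e.
Proof.
move=> q0 t0 e0.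
have [D D0 dD] : exists2 D, (0 < D)%N & forall d, (1 <= d <= 100 * q)%N -> (d %| D)%N.
  by exists (100 * q)`! => [|d]; [exact: fact_gt0|exact: dvdn_fact].
have D0' : (0 : R) < D%:R by rewrite ltr0n.
pose h := t / D%:R; pose e1 := e / (2 * D%:R).
have h0 : 0 < h by rewrite divr_gt0.
have e10 : 0 < e1 by rewrite divr_gt0 ?mulr_gt0.
have [d [x0 [dK per]]] := moebius_quasi_period q0 h0 e10.
have /dvdnP[n nd] := dD d dK.
pose x1 := (x0 + (Num.truncn (16 / e1 + 100 / e)).+1)%N.
exists x1, (e / 16); first by rewrite divr_gt0.
move=> x x' xx1 xx1' lnx w w1 wq.
have x1P : 16 / e1 + 100 / e < x1%:R.
  by apply: lt_le_trans (truncnS_gt _) _; rewrite ler_nat leq_addl.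
have [u1 u2] : 0 < 16 / e1 /\ 0 < 100 / e by split; rewrite divr_gt0.
have small y : (x1 <= y)%N -> [/\ (0 < y)%N, y%:R^-1 <= e1 / 16 & y%:R^-1 <= e / 100 :> R].
  move=> xy; have Y : (x1%:R : R) <= y%:R by rewrite ler_nat.
  have y0 : (0 : R) < y%:R by lra.
  split; first by rewrite -(ltr0n R).
    by rewrite -[e1 / 16]invf_div lef_pV2 ?posrE//; lra.
  by rewrite -[e / 100]invf_div lef_pV2 ?posrE//; lra.
pose z i := Num.truncn (x%:R * expR (i%:R * (d%:R * h))).
have dh0 : 0 <= d%:R * h by rewrite mulr_ge0// ltW.
have xe i : x%:R <= x%:R * expR (i%:R * (d%:R * h)).
  by rewrite ler_peMr// -[leLHS]expR0 ler_expR mulr_ge0.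
have X0 : (0 : R) < x%:R by rewrite ltr0n; case: (small x xx1).
have ze i : (x1 <= z i)%N.
  rewrite truncn_ge_nat; last exact: le_trans (ltW X0) (xe i).
  by apply: le_trans (xe i); rewrite ler_nat.
have zl i : 0 <= ln x%:R + i%:R * (d%:R * h) - ln (z i)%:R <= (z i)%:R^-1.
  have [z0 _ _] := small _ (ze i).
  have Z0 : (0 : R) < (z i)%:R by rewrite ltr0n.
  have /andP[a1 a2] := truncn_itv (le_trans (ltW X0) (xe i)); rewrite -/(z i) -natr1 in a1 a2.
  have xe0 : 0 < x%:R * expR (i%:R * (d%:R * h)) by rewrite mulr_gt0// expR_gt0.
  rewrite -[X in ln x%:R + X]expRK -lnM ?posrE ?expR_gt0//.
  rewrite subr_ge0 ler_ln ?posrE// a1/=.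
  apply: le_trans (lnB_le xe0 Z0) _; rewrite -[leRHS]mul1r ler_wpM2r ?invr_ge0//; lra.
have chain i : `|moebius_mean w x - moebius_mean w (z i)| <= i%:R * e1.
  elim: i => [|i IH].
    have -> : z 0%N = x by rewrite /z mul0r expR0 mulr1 natrK.
    by rewrite subrr normr0 mul0r.
  have : `|moebius_mean w (z i) - moebius_mean w (z i.+1)| <= e1.
    apply: per => //; try exact: leq_trans (leq_addr _ _) (ze _).
    have /andP[a1 a2] := zl i; have /andP[b1 b2] := zl i.+1.
    have [_ c1 _] := small _ (ze i); have [_ c2 _] := small _ (ze i.+1).
    rewrite -natr1 mulrDl mul1r in b1 b2.
    rewrite ler_norml; apply/andP; split; lra.
  move=> h1; rewrite -natr1 mulrDl mul1r.
  apply: le_trans (lerD IH h1); rewrite -[X in `|X|](subrKA (moebius_mean w (z i))).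
  exact: ler_normD.
have ndh : n%:R * (d%:R * h) = t.
  by rewrite mulrA -natrM -nd /h; field; rewrite gt_eqF.
have [z0 _ z2] := small _ (ze n); have [x'0 _ x'2] := small _ xx1'.
have L := @moebius_sum_lipschitz w (z n) x' 1 1 w1 z0 x'0.
rewrite !divn1 !divr1 !mul1r in L.
have /andP[a1 a2] := zl n; rewrite ndh in a1 a2.
have l2 : `|ln (z n)%:R - ln x'%:R| <= e / 16 + e / 100 :> R.
  by move: lnx; rewrite !ler_norml => /andP[b1 b2]; apply/andP; split; lra.
have c1 := chain n.
have ne : n%:R * e1 <= e / 2.
  have -> : e / 2 = D%:R * e1 by rewrite /e1; field; rewrite gt_eqF.
  rewrite ler_pM2r// ler_nat nd leq_pmulr//; by case/andP: dK.
rewrite -[X in `|X|](subrKA (moebius_mean w (z n))).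
apply: le_trans (ler_normD _ _) _.
move: L; rewrite -!/(moebius_mean _ _) => L.
have -> : e = e / 2 + e / 2 by field.
apply: lerD; first exact: le_trans c1 ne.
by apply: le_trans L _; move: z2 x'2 l2; move: ((z n)%:R^-1) (x'%:R^-1) => u v; lra.
Qed.

End SlowVariation.

(** * Real characters *)

Section PartialSummation.
Variable R : realType.
Implicit Types (f a phi u : nat -> R).

Lemma periodic_sum_mod q f x : (0 < q)%N -> periodic_mod q f ->
  \sum_(0 <= n < q) f n = 0 ->
  \sum_(0 <= n < x) f n = \sum_(0 <= n < x %% q) f n.
Proof.
move=> q0 fq f0; elim/ltn_ind: x => x IH.
have [xq|qx] := ltnP x q; first by rewrite modn_small.
rewrite (big_cat_nat (n := q))//= f0 add0r -{1}[q]add0n big_addn.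
rewrite (eq_bigr f) => [|n _]; last by apply: fq; rewrite modnDr.
by rewrite IH ?modnB_id// ?ltn_subrL ?q0 ?(leq_trans q0)// -{2}(subnK qx) modnDr.
Qed.

Lemma periodic_sum_bound q f x y : (0 < q)%N -> periodic_mod q f -> bounded1 f ->
  \sum_(0 <= n < q) f n = 0 -> `|\sum_(x <= n < y) f n| <= 2 * q%:R.
Proof.
move=> q0 fq f1 f0.
have h z : `|\sum_(0 <= n < z) f n| <= q%:R.
  rewrite (periodic_sum_mod z q0 fq f0) (le_trans (ler_norm_sum _ _ _))//.
  apply: (@le_trans _ _ (\sum_(0 <= n < z %% q) 1)); first by apply: ler_sum.
  by rewrite sumr_const_nat subn0 ler_nat ltnW// ltn_mod.
have [yx|xy] := leqP y x; first by rewrite big_geq// normr0 mulr_ge0.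
have -> : \sum_(x <= n < y) f n = \sum_(0 <= n < y) f n - \sum_(0 <= n < x) f n.
  by rewrite [X in _ = X - _](big_cat_nat (n := x) (p := y))//= ?(ltnW xy)// addrAC subrr add0r.
by apply: le_trans (ler_normB _ _) _; have := h x; have := h y; lra.
Qed.

Lemma sum_periodic_dilate q f (u : nat) : (0 < q)%N -> periodic_mod q f -> coprime u q ->
  \sum_(0 <= n < q) f (u * n)%N = \sum_(0 <= n < q) f n.
Proof.
move=> q0 fq uq; pose h (i : 'I_q) := Ordinal (ltn_pmod (u * i) q0).
have hinj : injective h.
  have inj (i j : nat) : (j <= i < q)%N -> (u * i == u * j %[mod q])%N -> i = j.
    move=> /andP[ji iq]; rewrite eqn_mod_dvd ?leq_mul// -mulnBr Gauss_dvdr 1?coprime_sym//.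
    move=> qij; apply/eqP; rewrite eqn_leq ji andbT -subn_eq0.
    apply: contraLR qij; rewrite -lt0n => ij0; rewrite gtnNdvd//.
    by apply: leq_ltn_trans iq; exact: leq_subr.
  move=> i j /(congr1 val)/= /eqP E; apply: val_inj => /=.
  have [ij|/ltnW ij] := leqP i j; last by apply: inj; rewrite ?ij/=.
  by apply/esym/inj; rewrite ?ij/= 1?eq_sym.
rewrite !big_mkord [RHS](reindex_inj hinj)/=; apply: eq_bigr => i _.
by apply: fq; rewrite modn_mod.
Qed.

Lemma abel_bound a phi (B : R) m n :
  (forall k, `|\sum_(m <= i < k) a i| <= B) ->
  (forall i, (m <= i)%N -> 0 <= phi i /\ phi i.+1 <= phi i) ->
  `|\sum_(m <= i < n) a i * phi i| <= B * phi m.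
Proof.
move=> aB dphi; have B0 : 0 <= B by apply: le_trans (aB m).
have [p0 _] := dphi m (leqnn m).
have [nm|mn] := leqP n m; first by rewrite big_geq// normr0 mulr_ge0.
suff [E h] : \sum_(m <= i < n) a i * phi i = (\sum_(m <= i < n) a i) * phi n +
    \sum_(m <= i < n) (\sum_(m <= j < i.+1) a j) * (phi i - phi i.+1) /\
    `|\sum_(m <= i < n) (\sum_(m <= j < i.+1) a j) * (phi i - phi i.+1)| <= B * (phi m - phi n).
  rewrite E; apply: le_trans (ler_normD _ _) _; rewrite normrM.
  have [pn _] := dphi n (ltnW mn); rewrite (ger0_norm pn).
  by have := ler_wpM2r pn (aB n); lra.
elim: n mn => // n IH; rewrite ltnS leq_eqVlt => /orP[/eqP <-|mn].
  rewrite !big_nat1; split; first by ring.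
  have [_ d] := dphi m (leqnn m); rewrite normrM ler_pM//.
    by have := aB m.+1; rewrite big_nat1.
  by rewrite ger0_norm// subr_ge0.
have {IH}[E h] := IH mn.
rewrite big_nat_recr ?(ltnW mn)//= E [X in _ = X * _ + _]big_nat_recr ?(ltnW mn)//=.
rewrite [X in _ = _ + X]big_nat_recr ?(ltnW mn)//=.
rewrite [X in `|X|]big_nat_recr ?(ltnW mn)//=.
rewrite [X in _ = _ + (_ + X * _)]big_nat_recr ?(ltnW mn)//=; split; first by ring.
apply: le_trans (ler_normD _ _) _; rewrite normrM.
have [_ d] := dphi n (ltnW mn); have d0 : 0 <= phi n - phi n.+1 by rewrite subr_ge0.
by rewrite (ger0_norm d0); have := ler_wpM2r d0 (aB n.+1); lra.
Qed.

(** The limit is the supremum of the lower bounds [u x - c x], each of which lies below every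
    [u y + c y]. *)
Lemma limit_with_rate u (c : nat -> R) :
  (forall x y, `|u y - u x| <= c (minn x y)) ->
  exists l, forall x, `|u x - l| <= c x.
Proof.
move=> uc; pose A := [set u x - c x | x in [set: nat]]%classic.
have ub x y : u x - c x <= u y + c y.
  have := uc x y; rewrite ler_norml => /andP[h1 h2].
  have c0 z : 0 <= c z by have := uc z z; rewrite subrr normr0 minnn.
  have := c0 x; have := c0 y.
  by case: (leqP x y) h1 h2 => _ h1 h2; lra.
have hA : has_sup A.
  by split; [exists (u 0%N - c 0%N), 0%N|exists (u 0%N + c 0%N) => _ [x _ <-]].
exists (sup A) => x.
have h1 : u x - c x <= sup A by apply: sup_upper_bound => //; exists x.
have h2 : sup A <= u x + c x by apply: ge_sup => [|_ [y _ <-]//]; exists (u 0%N - c 0%N), 0%N.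
by rewrite ler_norml; apply/andP; split; lra.
Qed.

Lemma bounded_sum_tail (P : pred nat) f (T : R) : (forall n, 0 <= f n) ->
  (forall Y, \sum_(1 <= n < Y | P n) f n <= T) ->
  forall e, 0 < e -> exists2 Y0, (0 < Y0)%N &
    forall Y, \sum_(Y0 <= n < Y | P n) f n <= e.
Proof.
move=> f0 fT e e0; pose A := [set \sum_(1 <= n < Y | P n) f n | Y in [set: nat]]%classic.
have hA : has_sup A.
  by split; [exists (\sum_(1 <= n < 0 | P n) f n), 0%N|exists T => _ [Y _ <-]].
have [_ [Y0 _ <-] hY0] := sup_adherent e0 hA.
exists Y0.+1 => // Y; have [YY0|Y0Y] := leqP Y Y0.+1; first by rewrite big_geq// ltW.
have : \sum_(1 <= n < Y | P n) f n <= sup A by apply: sup_upper_bound => //; exists Y.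
rewrite (big_cat_nat (n := Y0.+1))//= ?(ltnW Y0Y)//.
have : \sum_(1 <= n < Y0 | P n) f n <= \sum_(1 <= n < Y0.+1 | P n) f n.
  by apply: ler_sum_subrange => // n /andP[-> nY] ->; rewrite ltnS ltnW.
by move: hY0; rewrite -/A; lra.
Qed.

End PartialSummation.

(** * Nonvanishing of [L(1, chi)] and primes with [chi p = 1] *)

Section RealCharacter.
Variables (R : realType) (q : nat) (chi : nat -> R) (n0 : nat).
Hypotheses (q0 : (0 < q)%N) (chiP : periodic_mod q chi)
  (chiM : forall m n, chi (m * n)%N = chi m * chi n)
  (chi_cop : forall n, coprime n q -> chi n = 1 \/ chi n = -1)
  (chi_ncop : forall n, ~~ coprime n q -> chi n = 0)
  (chi_n0 : chi n0 = -1).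
Local Notation vM := (@mangoldt R).

Let chi1 : chi 1 = 1.
Proof.
have := chiM 1 n0; rewrite mul1n chi_n0 mulrN1 => /oppr_inj <-//.
Qed.

Let chi_val n : [\/ chi n = 0, chi n = 1 | chi n = -1].
Proof.
case: (boolP (coprime n q)) => [/chi_cop[]|/chi_ncop]; by [left|right;left|constructor 2|constructor 3|constructor 1].
Qed.

Let chi_le1 : bounded1 chi.
Proof. by move=> n; case: (chi_val n) => ->; rewrite ?normrN ?normr1 ?normr0. Qed.

Let sum_chi : \sum_(0 <= n < q) chi n = 0.
Proof.
have n0q : coprime n0 q.
  apply: contraT => /chi_ncop; rewrite chi_n0 => /eqP; rewrite oppr_eq0 oner_eq0//.
have := sum_periodic_dilate q0 chiP n0q.
under eq_bigr do rewrite chiM chi_n0 mulN1r.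
by rewrite sumrN; lra.
Qed.

Let sum_chi_bound x y : `|\sum_(x <= n < y) chi n| <= 2 * q%:R.
Proof. exact: periodic_sum_bound. Qed.

(** These are the coefficients of the Dirichlet series [zeta(s) L(s, chi)]. *)
Definition divisor_chi n := \sum_(1 <= d < n.+1 | (d %| n)%N) chi d.

Lemma divisor_chi_pfactor p k m : prime p -> ~~ (p %| m)%N -> (0 < m)%N ->
  divisor_chi (p ^ k * m) = divisor_chi m * \sum_(0 <= j < k.+1) chi p ^+ j.
Proof.
move=> pp pm m0; have p0 := prime_gt0 pp.
elim: k => [|k IH]; first by rewrite mul1n big_nat1 expr0 mulr1.
set n := (p ^ k * m)%N in IH;
have -> : (p ^ k.+1 * m = p * n)%N by rewrite expnS mulnA.
have E : divisor_chi (p * n) = chi p * divisor_chi n + divisor_chi m.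
  rewrite {1}/divisor_chi (bigID (fun d => (p %| d)%N))/=; congr (_ + _).
    under eq_bigl do rewrite andbC.
    rewrite big_mkcondr/= sum_multiples// mulKn// mulr_sumr [RHS]big_mkcond.
    by apply: eq_bigr => d _; rewrite dvdn_pmul2l// chiM.
  rewrite /divisor_chi (big_nat_widen _ m.+1 (p * n).+1); last first.
    by rewrite ltnS /n mulnA leq_pmull// muln_gt0 p0 expn_gt0 p0.
  apply: eq_bigl => d; case: (boolP (d %| m)%N) => [dm|dm] /=.
    have dpn : (d %| p * n)%N by rewrite /n mulnA dvdn_mull.
    have pd : ~~ (p %| d)%N by apply: contra pm => pd; exact: dvdn_trans dm.
    by rewrite dpn pd ltnS dvdn_leq.
  case: (boolP (p %| d)%N) => pd; rewrite ?andbF// andbT.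
  apply/negbTE; apply: contra dm; rewrite /n mulnA -expnS Gauss_dvdr//.
  by rewrite coprime_sym coprimeXl// prime_coprime.
rewrite E IH [in RHS]big_nat_recl//= expr0 mulrDr mulr1 addrC; congr (_ + _).
rewrite mulrCA; congr (_ * _); rewrite mulr_sumr; apply: eq_bigr => j _.
by rewrite exprS.
Qed.

Let sum_chi_powers p k : 0 <= \sum_(0 <= j < k.+1) chi p ^+ j /\
  (~~ odd k -> 1 <= \sum_(0 <= j < k.+1) chi p ^+ j).
Proof.
have [c0|c1|c1] := chi_val p; rewrite ?c0 ?c1.
- have -> : \sum_(0 <= j < k.+1) (0 : R) ^+ j = 1.
    rewrite big_nat_recl// expr0 big1 ?addr0// => j _; exact: expr0n.
  by [].
- under eq_bigr do rewrite expr1n.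
  by rewrite sumr_const_nat subn0; split; rewrite ?ler0n ?ler1n.
- have -> : \sum_(0 <= j < k.+1) (-1 : R) ^+ j = (~~ odd k)%:R.
    elim: k => [|k IH]; first by rewrite big_nat1 expr0.
    by rewrite big_nat_recr//= IH -signr_odd/=; case: (odd k); rewrite /= ?add0r ?expr0 ?expr1 ?subrr.
  by case: (odd k).
Qed.

Let divisor_chi1 : divisor_chi 1 = 1.
Proof. by rewrite /divisor_chi big_mkcond big_nat1. Qed.

Lemma divisor_chi_ge0 n : (0 < n)%N -> 0 <= divisor_chi n.
Proof.
elim/ltn_ind: n => n IH n_gt0; have [->|n1] := eqVneq n 1%N; first by rewrite divisor_chi1.
have n1' : (1 < n)%N by rewrite ltn_neqAle eq_sym n1.
have pp := pdiv_prime n1'; set p := pdiv n in pp.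
have [m pm nE] := pfactor_coprime pp n_gt0.
rewrite prime_coprime// in pm.
have m0 : (0 < m)%N by move: n_gt0; rewrite nE muln_gt0 => /andP[].
rewrite nE mulnC divisor_chi_pfactor// mulr_ge0//; last by case: (sum_chi_powers p (logn p n)).
apply: IH => //; rewrite [ltnRHS]nE ltn_Pmulr// -(expn0 p) ltn_exp2l ?prime_gt1//.
by rewrite logn_gt0 mem_primes pp n_gt0 pdiv_dvd.
Qed.

Lemma divisor_chi_square n : (0 < n)%N -> 1 <= divisor_chi (n ^ 2).
Proof.
elim/ltn_ind: n => n IH n_gt0; have [->|n1] := eqVneq n 1%N; first by rewrite divisor_chi1.
have n1' : (1 < n)%N by rewrite ltn_neqAle eq_sym n1.
have pp := pdiv_prime n1'; set p := pdiv n in pp.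
have [m pm nE] := pfactor_coprime pp n_gt0.
have m0 : (0 < m)%N by move: n_gt0; rewrite nE muln_gt0 => /andP[].
have -> : (n ^ 2 = p ^ (logn p n * 2) * m ^ 2)%N by rewrite {1}nE expnMn mulnC expnM.
rewrite divisor_chi_pfactor ?expn_gt0 ?m0//; last first.
  by rewrite -prime_coprime// coprimeXr.
have [_ h] := sum_chi_powers p (logn p n * 2).
apply: mulr_ege1; last by apply: h; rewrite oddM andbF.
apply: IH => //; rewrite [ltnRHS]nE ltn_Pmulr// -(expn0 p) ltn_exp2l ?prime_gt1//.
by rewrite logn_gt0 mem_primes pp n_gt0 pdiv_dvd.
Qed.

Let geom (t : R) n : R := \sum_(0 <= i < n) t ^+ i.

Let geomS t n : geom t n.+1 = 1 + t * geom t n.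
Proof.
rewrite /geom big_nat_recl// expr0 mulr_sumr; congr (_ + _).
by apply: eq_bigr => i _; rewrite exprS.
Qed.

Let geomE t n : (1 - t) * geom t n = 1 - t ^+ n.
Proof.
elim: n => [|n IH]; first by rewrite /geom big_geq// mulr0 expr0 subrr.
by rewrite geomS mulrDr mulrCA IH exprS; ring.
Qed.

(** This is the inequality between the arithmetic and the geometric mean for [1], [s ^ 2], ...,
    [s ^ (2 * (n - 1))]; the parameter [t = s ^+ 2] avoids square roots. *)
Let geom_ge (s : R) n : 0 <= s -> n%:R * s ^+ n.-1 <= geom (s ^+ 2) n.
Proof.
move=> s0; suff : n%:R * s ^+ n.-1 <= geom (s ^+ 2) n /\ n.+1%:R * s ^+ n <= geom (s ^+ 2) n.+1 by case.
elim: n => [|n [IH1 IH2]].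
  by rewrite mul0r /geom big_geq// big_nat1 !expr0 mulr1.
split=> //; rewrite geomS.
have E : geom (s ^+ 2) n.+1 = geom (s ^+ 2) n + (s ^+ 2) ^+ n by rewrite /geom big_nat_recr.
rewrite E mulrDr -exprS -exprM.
have h : s ^+ 2 * (n%:R * s ^+ n.-1) = n%:R * s ^+ n.+1.
  by case: n {IH1 IH2 E} => [|n]; [rewrite !mul0r mulr0|rewrite /= mulrCA -exprD].
have := ler_wpM2l (sqr_ge0 s) IH1; rewrite h.
have := sqr_ge0 (1 - s ^+ n.+1); rewrite sqrrB expr1n mul1r -exprM [(n.+1 * 2)%N]mulnC.
by rewrite -[n.+2%:R]natr1 -[n.+1%:R]natr1 !mulrDl !mul1r; lra.
Qed.

(* Monsky's argument for the nonvanishing of [L(1, chi)]: the numbers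
   [1 / n - t ^ n / (1 + ... + t ^ (n - 1))] decrease in [n], so their
   [chi]-weighted sums are at most [2 q (1 - t)]. *)
Let lambert (t : R) n : R := n%:R^-1 - t ^+ n / geom t n.

(** With [g = geom t], consecutive values differ by [1 / (i * (i + 1)) - t ^ i / (g i * g (i + 1))].
    Two instances of [geom_ge] make this nonnegative, since their powers of [s] multiply to
    [s ^ (2 * i - 1) >= t ^ i]. *)
Let lambert_mono (s : R) i : 0 < s < 1 -> (1 <= i)%N ->
  0 <= lambert (s ^+ 2) i /\ lambert (s ^+ 2) i.+1 <= lambert (s ^+ 2) i.
Proof.
move=> /andP[s0 s1] i0.
have I0 : (0 : R) < i%:R by rewrite ltr0n.
have I1 : (0 : R) < i.+1%:R by rewrite ltr0n.
have g n : (0 < n)%N -> 0 < geom (s ^+ 2) n.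
  move=> n0'; apply: lt_le_trans (geom_ge n (ltW s0)).
  by rewrite mulr_gt0 ?ltr0n ?exprn_gt0.
have gi := g i i0; have gi1 := g i.+1 (ltn0Sn i).
have h1 := geom_ge i (ltW s0); have h2 := geom_ge i.+1 (ltW s0).
have sle k l : (k <= l)%N -> s ^+ l <= s ^+ k by move=> kl; rewrite ler_wiXn2l// ltW.
split.
  rewrite subr_ge0 ler_pdivrMr// ler_pdivlMl//; apply: le_trans h1.
  by rewrite ler_pM2l// -exprM sle//; lia.
rewrite -subr_ge0 /lambert.
have E : i%:R^-1 - (s ^+ 2) ^+ i / geom (s ^+ 2) i -
   (i.+1%:R^-1 - (s ^+ 2) ^+ i.+1 / geom (s ^+ 2) i.+1) =
   (i%:R * i.+1%:R)^-1 - (s ^+ 2) ^+ i / (geom (s ^+ 2) i * geom (s ^+ 2) i.+1).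
  rewrite geomS in gi1 *; rewrite -natr1 in I1 *; rewrite [(s ^+ 2) ^+ i.+1]exprS.
  move: (s ^+ 2) ((s ^+ 2) ^+ i) (geom (s ^+ 2) i) (i%:R : R) gi gi1 I0 I1 => t a b z *.
  by field; rewrite !gt_eqF.
rewrite E subr_ge0 ler_pdivrMr ?mulr_gt0// ler_pdivlMl ?mulr_gt0//.
have s0' := ltW s0.
apply: le_trans (ler_pM _ _ h1 h2); rewrite ?mulr_ge0 ?exprn_ge0//.
rewrite mulrACA ler_pM2l ?mulr_gt0// -exprD -exprM sle//=; lia.
Qed.

Let sum_chi_lambert (s : R) N : 0 < s < 1 ->
  `|\sum_(1 <= n < N) chi n * lambert (s ^+ 2) n| <= 2 * q%:R * (1 - s ^+ 2).
Proof.
move=> s01; apply: le_trans (abel_bound _ (fun k => sum_chi_bound 1 k) _) _.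
  by move=> i i1; exact: lambert_mono.
by rewrite /lambert /geom big_nat1 expr0 expr1 divr1 invr1.
Qed.

Let sum_chi_inv_bound x y : `|\sum_(x.+1 <= n < y) chi n / n%:R| <= 2 * q%:R / x.+1%:R.
Proof.
apply: (abel_bound (a := chi) (phi := fun n => n%:R^-1)) => [k|i xi]; first exact: sum_chi_bound.
split; first by rewrite invr_ge0.
by rewrite lef_pV2 ?posrE ?ltr0n ?ler_nat// (leq_trans _ xi).
Qed.

Lemma L1_exists : exists l : R, forall x,
  `|\sum_(1 <= n < x.+1) chi n / n%:R - l| <= 2 * q%:R / x.+1%:R.
Proof.
apply: (limit_with_rate (u := fun x => \sum_(1 <= n < x.+1) chi n / n%:R)
  (c := fun x => 2 * q%:R / x.+1%:R)).
suff h x y : (x <= y)%N -> `|\sum_(1 <= n < y.+1) chi n / n%:R -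
    \sum_(1 <= n < x.+1) chi n / n%:R| <= 2 * q%:R / x.+1%:R.
  move=> x y; case: (leqP x y) => [|/ltnW] /h //.
  by rewrite distrC.
move=> xy; rewrite [X in X - _](big_cat_nat (n := x.+1))//= addrAC subrr add0r.
exact: sum_chi_inv_bound.
Qed.

Let bernoulli (a : R) k : 0 <= a <= 1 -> 1 - k%:R * a <= (1 - a) ^+ k.
Proof.
move=> /andP[a0 a1]; elim: k => [|k IH]; first by rewrite mul0r subr0 expr0.
rewrite exprS -natr1; have h : 0 <= k%:R * a * a by rewrite !mulr_ge0.
have := ler_wpM2l (_ : 0 <= 1 - a) IH; rewrite subr_ge0 => /(_ a1); lra.
Qed.

Let nat_expr_le (s : R) x : 0 < s < 1 -> x%:R * s ^+ x * (1 - s) <= 1.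
Proof.
move=> /andP[s0 s1]; apply: (@le_trans _ _ ((1 - s) * geom s x)).
  rewrite mulrC; apply: ler_wpM2l; first by rewrite subr_ge0 ltW.
  have -> : x%:R * s ^+ x = \sum_(0 <= i < x) s ^+ x by rewrite sumr_const_nat subn0 mulr_natl.
  rewrite /geom; apply: ler_sum_nat => i /andP[_ ix].
  by rewrite ler_wiXn2l ?(ltW s0) ?(ltW s1)// ltnW.
by rewrite geomE gerBl exprn_ge0// ltW.
Qed.

(** As [t ^ n / geom t n = (1 - t) * t ^ n / (1 - t ^ n)] is a geometric series in [t ^ n], the
    bound concerns its tail beyond [n * k <= x]. *)
Let lambert_expand (t : R) n x : 0 < t < 1 -> (0 < n)%N ->
  `|t ^+ n / geom t n - (1 - t) * \sum_(1 <= k < (x %/ n).+1) t ^+ (n * k)| <= t ^+ x.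
Proof.
move=> /andP[t0 t1] n_gt0; set K := (x %/ n)%N.
have g1 : 1 <= geom t n.
  rewrite -(prednK n_gt0) geomS lerDl mulr_ge0 ?(ltW t0)//.
  by apply: sumr_ge0 => i _; rewrite exprn_ge0// ltW.
have g0 : 0 < geom t n by apply: lt_le_trans g1.
have -> : t ^+ n / geom t n - (1 - t) * \sum_(1 <= k < K.+1) t ^+ (n * k) =
    t ^+ (n * K.+1) / geom t n.
  have E k : (1 - t ^+ n) * \sum_(1 <= i < k.+1) t ^+ (n * i) = t ^+ n - t ^+ (n * k.+1).
    elim: k => [|k IH]; first by rewrite big_geq// mulr0 muln1 subrr.
    rewrite big_nat_recr//= mulrDr IH mulrBl mul1r -exprD -mulnS.
    by rewrite addrA subrK.
  have gn0 : geom t n != 0 by rewrite gt_eqF.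
  apply: (mulIf gn0); rewrite mulrBl !divfK// mulrAC geomE E.
  by rewrite opprB addrC subrK.
rewrite ger0_norm ?divr_ge0 ?exprn_ge0 ?(ltW t0) ?(ltW g0)//.
rewrite ler_pdivrMr//; apply: (@le_trans _ _ (t ^+ x)); last by rewrite ler_peMr// exprn_ge0// ltW.
rewrite ler_wiXn2l ?(ltW t0) ?(ltW t1)//.
by rewrite ltnW// mulnC ltn_ceil.
Qed.

(** Expanding the Lambert sums turns them into [1 - t] times the power series of [divisor_chi]. If
    [l] were [0], this series would stay bounded as [t] tends to [1], whereas its coefficients at
    squares are at least [1] and the others are nonnegative. *)
Lemma L1_neq0 (l : R) : (forall x,
  `|\sum_(1 <= n < x.+1) chi n / n%:R - l| <= 2 * q%:R / x.+1%:R) -> l != 0.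
Proof.
move=> lP; apply/eqP => l0.
(* The squares up to [D ^ 2] contribute at least [D / 2 = 2 * q + 4], more than the [2 * q + 2] left
   by the upper bounds. The choice of [a] below gives [t ^ (D ^ 2) >= 1 / 2] by Bernoulli's
   inequality. *)
pose D := (4 * q + 8)%N; have D0 : (0 : R) < D%:R by rewrite ltr0n /D addnS.
pose a : R := (4 * D%:R ^+ 2)^-1; pose s := 1 - a; pose t := s ^+ 2.
have a0 : 0 < a by rewrite invr_gt0 mulr_gt0// exprn_gt0.
have D1 : (1 : R) <= D%:R by rewrite ler1n /D addnS.
have Da : 4 * D%:R ^+ 2 * a = 1 by rewrite /a divff// mulf_neq0// ?expf_neq0// gt_eqF.
have DQ : D%:R = 4 * q%:R + 8 :> R by rewrite /D natrD natrM.
have a4 : a <= 1 / 4.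
  have D2 : 1 <= D%:R ^+ 2 :> R by rewrite exprn_ege1.
  have h (z b : R) : 1 <= z -> 0 < b -> 4 * z * b = 1 -> b <= 1 / 4 by move=> *; nra.
  exact: h D2 a0 Da.
clearbody D.
have s01 : 0 < s < 1 by rewrite /s; apply/andP; split; lra.
have /andP[s0 s1] := s01.
have t01 : 0 < t < 1 by rewrite exprn_gt0//= expr_lt1// ltW.
have /andP[t0 t1] := t01.
have tD : 1 / 2 <= t ^+ (D ^ 2).
  rewrite /t -exprM; apply: le_trans (bernoulli _ _); last by apply/andP; split; lra.
  by rewrite natrM natrX; lra.
(* The cutoff is so large that both the tail of [L(1, chi)] and the truncation error [x * t ^ x] are
   at most [1 - t]. *)
pose x := (D ^ 2 + (Num.truncn (2 * q%:R / (1 - t) + ((1 - s) ^+ 2 * (1 - t))^-1)).+1)%N.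
have t1' : 0 < 1 - t by rewrite subr_gt0.
have s1' : 0 < 1 - s by rewrite subr_gt0.
have xP : 2 * q%:R / (1 - t) + ((1 - s) ^+ 2 * (1 - t))^-1 < x%:R.
  by apply: lt_le_trans (truncnS_gt _) _; rewrite ler_nat leq_addl.
have x0 : (0 : R) < x%:R by rewrite ltr0n /x addnS.
have [u1 u2] : 0 <= 2 * q%:R / (1 - t) /\ 0 <= ((1 - s) ^+ 2 * (1 - t))^-1.
  by rewrite !(mulr_ge0, invr_ge0, exprn_ge0) ?(ltW t1') ?(ltW s1').
have x1 : 2 * q%:R / x.+1%:R <= 1 - t.
  have h : 2 * q%:R / (1 - t) <= x.+1%:R.
    rewrite -natr1; move: xP u1 u2.
    by move: (((1 - s) ^+ 2 * (1 - t))^-1) (2 * q%:R / (1 - t)) => ? ? *; lra.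
  by move: h; rewrite ler_pdivrMr// ler_pdivrMr ?ltr0n// [x.+1%:R * _]mulrC.
have x2 : x%:R * t ^+ x <= 1 - t.
  have h := nat_expr_le x s01.
  have sx : 0 <= s ^+ x by rewrite exprn_ge0// ltW.
  have h2 : 1 <= x%:R * ((1 - s) ^+ 2 * (1 - t)).
    rewrite -ler_pdivrMr ?mulr_gt0 ?exprn_gt0// mul1r.
    move: xP u1 u2.
    by move: (((1 - s) ^+ 2 * (1 - t))^-1) (2 * q%:R / (1 - t)) => ? ? *; lra.
  have E : t ^+ x = s ^+ x * s ^+ x by rewrite /t -exprM mulnC exprM expr2.
  have k : (x%:R * s ^+ x * (1 - s)) * (x%:R * s ^+ x * (1 - s)) <= 1.
    by rewrite mulr_ile1 ?mulr_ge0 ?(ltW s1').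
  rewrite E.
  have P : 0 < x%:R * (1 - s) ^+ 2 by rewrite mulr_gt0// exprn_gt0.
  rewrite -(ler_pM2l P); apply: (@le_trans _ _ 1); last by lra.
  by move: k; rewrite expr2; lra.
have low : D%:R / 2 <= \sum_(1 <= m < x.+1) divisor_chi m * t ^+ m.
  apply: (@le_trans _ _ (\sum_(m <- [seq (d ^ 2)%N | d <- iota 1 D]) `|divisor_chi m| * t ^+ m)); last first.
    apply: (@le_trans _ _ (\sum_(1 <= m < x.+1) `|divisor_chi m| * t ^+ m)); last first.
      by apply: ler_sum_nat => m /andP[m0 _]; rewrite ger0_norm// divisor_chi_ge0.
    apply: ler_sum_sub_seq => [m|||m /mapP[d]].
    - by rewrite mulr_ge0// exprn_ge0// ltW.
    - by rewrite map_inj_in_uniq ?iota_uniq// => d e _ _ /eqP; rewrite eqn_exp2r// => /eqP.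
    - exact: iota_uniq.
    rewrite mem_iota mem_index_iota add1n ltnS => /andP[d0 dD] ->.
    by rewrite expn_gt0 d0/= ltnS (@leq_trans (D ^ 2)) ?leq_exp2r// leq_addr.
  rewrite big_map; apply: (@le_trans _ _ (\sum_(d <- iota 1 D) (1 / 2 : R))).
    by rewrite big_const_seq count_predT size_iota iter_addr_0 -[leRHS]mulr_natl mul1r.
  rewrite big_seq [leRHS]big_seq; apply: ler_sum => d.
  rewrite mem_iota add1n ltnS => /andP[d0 dD].
  have g1 := divisor_chi_square d0; rewrite ger0_norm; last exact: le_trans ler01 g1.
  apply: (@le_trans _ _ (1 * t ^+ (d ^ 2))).
    rewrite [leRHS]mul1r; apply: le_trans tD _.
    by rewrite ler_wiXn2l ?(ltW t0) ?(ltW t1)// leq_exp2r.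
  by rewrite ler_wpM2r// exprn_ge0// ltW.
have A := sum_chi_lambert x.+1 s01; have B := lP x; rewrite l0 subr0 in B.
have E : \sum_(1 <= n < x.+1) chi n * lambert t n = \sum_(1 <= n < x.+1) chi n / n%:R -
    (1 - t) * (\sum_(1 <= m < x.+1) divisor_chi m * t ^+ m) -
    \sum_(1 <= n < x.+1) chi n * (t ^+ n / geom t n -
       (1 - t) * \sum_(1 <= k < (x %/ n).+1) t ^+ (n * k)).
  have -> : \sum_(1 <= m < x.+1) divisor_chi m * t ^+ m =
      \sum_(1 <= n < x.+1) \sum_(1 <= k < (x %/ n).+1) chi n * t ^+ (n * k).
    rewrite (sum_divisors_exchange (fun n m => chi n * t ^+ m)).
    by apply: eq_bigr => m _; rewrite mulr_suml.
  rewrite [X in _ - X - _]mulr_sumr -!sumrB; apply: eq_bigr => n _.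
  by rewrite -mulr_sumr /lambert; ring.
have rem : `|\sum_(1 <= n < x.+1) chi n * (t ^+ n / geom t n -
       (1 - t) * \sum_(1 <= k < (x %/ n).+1) t ^+ (n * k))| <= x%:R * t ^+ x.
  apply: le_trans (ler_norm_sum _ _ _) _.
  apply: (@le_trans _ _ (\sum_(1 <= n < x.+1) t ^+ x)); last by rewrite sumr_const_nat subn1/= mulr_natl.
  apply: ler_sum_nat => n /andP[n1 _]; rewrite normrM -[leRHS]mul1r.
  by rewrite ler_pM// lambert_expand.
move: A B rem; rewrite -/t E.
move: (\sum_(1 <= m < x.+1) divisor_chi m * t ^+ m) low => G low.
have := ler_wpM2l (ltW t1') low; rewrite DQ.
rewrite !ler_norml => h /andP[A1 A2] /andP[B1 B2] /andP[C1 C2].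
move: x1 x2 A1 A2 B1 B2 C1 C2 h.
move: (\sum_(_ <= _ < _) chi _ * _) (\sum_(_ <= _ < _) chi _ / _) (2 * q%:R / _) (x%:R * _).
by move=> S1 S2 z1 z2 x1 x2 A1 A2 B1 B2 C1 C2 h; lra.
Qed.

Let sum_chi_ln : exists C : R, forall x, `|\sum_(1 <= n < x.+1) chi n * (ln n%:R / n%:R)| <= C.
Proof.
(* The weight [ln n / n] decreases once [ln n >= 1], hence from [4] on; each of the three earlier
   terms is at most [1]. *)
have e4 : 1 <= ln (4 : R).
  rewrite -[leLHS]expRK ler_ln ?posrE ?expR_gt0//.
  have h : expR (1 / 2 : R) <= 2 by apply: le_trans (expR_le1D2x _) _; [apply/andP; split|]; lra.
  have -> : expR 1 = expR (1 / 2) * expR (1 / 2) :> R by rewrite -expRD; congr expR; lra.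
  by have := expR_gt0 (1 / 2 : R); move: (expR (1 / 2)) h => u; nra.
exists (3 + 2 * q%:R * (ln 4 / 4)) => x.
have tail : `|\sum_(4 <= n < x.+1) chi n * (ln n%:R / n%:R)| <= 2 * q%:R * (ln 4 / 4).
  apply: (abel_bound (phi := fun n => ln n%:R / n%:R)) => [k|i i4]; first exact: sum_chi_bound.
  have i0 : (0 < i)%N by apply: leq_trans i4.
  have I0 : (0 : R) < i%:R by rewrite ltr0n.
  split; first by rewrite divr_ge0// ln_nat_ge0.
  rewrite ler_pdivrMr ?ltr0n// mulrAC ler_pdivlMr//.
  have /andP[_] := ln_natS_bounds R i0; rewrite -(ler_pM2l I0) divff ?gt_eqF//.
  have : ln (4 : R) <= ln i%:R by rewrite ler_ln ?posrE// ler_nat.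
  by move: (ln (i.+1%:R : R)) (ln (i%:R : R)) => u v; lra.
have small n : (1 <= n)%N -> `|chi n * (ln n%:R / n%:R)| <= 1.
  move=> n1; have N1 : (0 : R) < n%:R by rewrite ltr0n.
  rewrite normrM mulr_ile1// ger0_norm ?divr_ge0 ?ln_nat_ge0//.
  by rewrite ler_pdivrMr// mul1r ltW// ln_sublinear.
have [x4|x4] := ltnP 3 x.+1.
  rewrite (big_cat_nat (n := 4))//=; apply: le_trans (ler_normD _ _) _.
  apply: lerD tail; apply: le_trans (ler_norm_sum _ _ _) _.
  have -> : (3 : R) = \sum_(1 <= n < 4) 1 by rewrite sumr_const_nat.
  by apply: ler_sum_nat => n /andP[n1 _]; exact: small.
apply: le_trans (ler_norm_sum _ _ _) _.
apply: (@le_trans _ _ (\sum_(1 <= n < x.+1) 1)).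
  by apply: ler_sum_nat => n /andP[n1 _]; exact: small.
have h : (3 : R) <= 3 + 2 * q%:R * (ln 4 / 4) by rewrite lerDl !mulr_ge0 ?invr_ge0//; lra.
by apply: le_trans h; rewrite sumr_const_nat ler_nat subn1/= -ltnS (leq_trans x4).
Qed.

(** Mertens' argument: convolving [mangoldt] with [1], the bounded sum of [chi n * ln n / n] is that
    of [chi a * mangoldt a / a] times partial sums of [L(1, chi)] up to [x / a]. Replacing these by
    [l] costs a multiple of [psi x / x], and [l <> 0] can be divided out. *)
Lemma sum_chi_mangoldt_bounded :
  exists C : R, forall x, `|\sum_(1 <= n < x.+1) chi n * (vM n / n%:R)| <= C.
Proof.
have [l lP] := L1_exists; have l0 := L1_neq0 lP.
have [C CP] := sum_chi_ln.
exists ((C + 20 * q%:R) / `|l|) => x; rewrite ler_pdivlMr ?normr_gt0// -normrM mulr_suml.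
have E : \sum_(1 <= n < x.+1) chi n * (ln n%:R / n%:R) =
    \sum_(1 <= a < x.+1) chi a * (vM a / a%:R) * \sum_(1 <= b < (x %/ a).+1) chi b / b%:R.
  under [RHS]eq_bigr do rewrite mulr_sumr.
  transitivity (\sum_(1 <= a < x.+1) \sum_(1 <= b < (x %/ a).+1)
      vM a * (chi (a * b) / (a * b)%:R)); last first.
    apply: eq_bigr => a _; apply: eq_bigr => b _; rewrite chiM natrM invfM; ring.
  rewrite (sum_divisors_exchange (fun a n => vM a * (chi n / n%:R))).
  apply: eq_big_nat => n /andP[n1 _]; rewrite -mulr_suml sum_mangoldt//.
  by rewrite mulrCA mulrA.
have D : `|\sum_(1 <= a < x.+1) chi a * (vM a / a%:R) * l - \sum_(1 <= n < x.+1) chi n * (ln n%:R / n%:R)| <= 20 * q%:R.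
  rewrite E -sumrB; apply: le_trans (ler_norm_sum _ _ _) _.
  have [->|x_neq0] := eqVneq x 0%N; first by rewrite big_geq// mulr_ge0.
  have X0 : (0 : R) < x%:R by rewrite ltr0n lt0n.
  apply: (@le_trans _ _ (\sum_(1 <= a < x.+1) 2 * q%:R / x%:R * vM a)); last first.
    rewrite -mulr_sumr mulrAC ler_pdivrMr//.
    by have := ler_wpM2l (_ : 0 <= 2 * q%:R) (psi_le R x); rewrite mulr_ge0// => /(_ isT); rewrite /psi; lra.
  apply: ler_sum_nat => a /andP[a1 _];
  have N0 : (0 < (x %/ a).+1%:R :> R) by rewrite ltr0n.
  rewrite -mulrBr normrM normrM distrC.
  apply: (@le_trans _ _ (vM a / a%:R * (2 * q%:R / (x %/ a).+1%:R))).
    apply: ler_pM => //.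
    by rewrite [X in _ * X]ger0_norm ?divr_ge0 ?mangoldt_ge0// ler_piMl ?divr_ge0 ?mangoldt_ge0.
  have -> : vM a / a%:R * (2 * q%:R / (x %/ a).+1%:R) = 2 * q%:R / (a * (x %/ a).+1)%:R * vM a.
    by rewrite natrM invfM; ring.
  rewrite ler_wpM2r ?mangoldt_ge0// ler_wpM2l ?mulr_ge0// lef_pV2 ?posrE ?ltr0n ?muln_gt0 ?a1 ?lt0n//.
  by rewrite ler_nat ltnW// mulnC ltn_ceil.
have := CP x; move: D; move: (\sum_(_ <= _ < _) _ * l) (\sum_(_ <= _ < _) _ * (ln _ / _)) => a b.
rewrite !ler_norml => /andP[d1 d2] /andP[c1 c2].
by apply/andP; split; lra.
Qed.

(** With the weight [1 + chi n], the sum of [mangoldt n / n] is still [ln x + O(1)], although primes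
    with [chi p = -1] drop out. If the primes with [chi p = 1] had a convergent sum of inverses,
    those beyond some [Y0] would contribute at most [2 * ln x / 8], and all other terms are
    bounded. *)
Lemma sum_inv_primes_chi1_unbounded (T : R) : exists Y,
  T < \sum_(1 <= p < Y | prime p && (chi p == 1)) (p%:R : R)^-1.
Proof.
apply: contrapT => H.
have HT Y : \sum_(1 <= p < Y | prime p && (chi p == 1)) (p%:R : R)^-1 <= T.
  by rewrite leNgt; apply/negP => lt; apply: H; exists Y.
have inv0 (p : nat) : 0 <= (p%:R : R)^-1 by rewrite invr_ge0.
have e8 : (0 : R) < 1 / 8 by lra.
have [Y0 Y00 tail] := bounded_sum_tail inv0 HT e8.
have [C CP] := sum_chi_mangoldt_bounded.
pose f n : R := vM n / n%:R * (1 + chi n).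
have f0 n : 0 <= f n.
  rewrite mulr_ge0 ?divr_ge0 ?mangoldt_ge0//.
  by have := chi_le1 n; rewrite ler_norml; lra.
have v0 n : 0 <= vM n / n%:R by rewrite divr_ge0 ?mangoldt_ge0.
have f2 n : f n <= 2 * (vM n / n%:R).
  by rewrite /f mulrC ler_wpM2r//; have := chi_le1 n; rewrite ler_norml; lra.
have up x : (0 < x)%N -> \sum_(1 <= n < x.+1) f n <=
    16 + (2 * q%:R + (2 * (ln Y0%:R + 11) + ln x%:R / 4)).
  move=> x0; rewrite (bigID prime)/= addrC; apply: lerD.
    apply: (@le_trans _ _ (\sum_(1 <= n < x.+1 | ~~ prime n) 2 * (vM n / n%:R))).
      by apply: ler_sum => n _; exact: f2.
    rewrite -mulr_sumr; apply: le_trans (ler_wpM2l _ (sum_mangoldt_nonprime R x)) _ => //; lra.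
  rewrite (bigID (fun p => p %| q)%N)/=; apply: lerD.
    apply: (@le_trans _ _ (\sum_(1 <= n < x.+1 | prime n && (n %| q)%N) 2)).
      apply: ler_sum => p /andP[pp _]; apply: le_trans (f2 p) _.
      have P0 : (0 : R) < p%:R by rewrite ltr0n prime_gt0.
      rewrite -[leRHS]mulr1 ler_pM2l// ler_pdivrMr// mul1r mangoldt_prime//.
      by rewrite ltW// ln_sublinear.
    apply: (@le_trans _ _ (\sum_(1 <= n < q.+1) 2)); last first.
      by rewrite sumr_const_nat subn1/= [leRHS]mulr_natr.
    by apply: ler_sum_subrange => // n /andP[n1 _] /andP[_ nq]; rewrite n1 ltnS dvdn_leq.
  apply: (@le_trans _ _ (\sum_(1 <= p < x.+1 | prime p && (chi p == 1)) 2 * (vM p / p%:R))).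
    rewrite [leRHS]big_mkcond [leLHS]big_mkcond; apply: ler_sum_nat => p _.
    case: (boolP (prime p)) => //= pp; case: (boolP (p %| q)%N) => /= pq.
      by case: ifP => // _; rewrite mulr_ge0.
    have /chi_cop[c1|c1] : coprime p q by rewrite prime_coprime.
      by rewrite c1 eqxx f2.
    by rewrite /f c1 addrN mulr0; case: ifP => // _; rewrite mulr_ge0.
  have [xY|Yx] := ltnP x Y0.
    rewrite -[leLHS]addr0; apply: lerD; last by rewrite divr_ge0// ln_nat_ge0.
    rewrite -mulr_sumr ler_pM2l//.
    have /andP[_ m] := mertens R x0; apply: le_trans (le_trans m _).
      by rewrite big_mkcond; apply: ler_sum => p _; case: ifP.
    by rewrite lerD2r ler_ln ?posrE ?ltr0n// ler_nat ltnW.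
  rewrite (big_cat_nat (n := Y0) (p := x.+1))//= ?(leq_trans Yx)//; apply: lerD.
    rewrite -mulr_sumr ler_pM2l//; have /andP[_ m] := mertens R Y00; apply: le_trans m.
    by apply: ler_sum_subrange => // n /andP[-> nY] _; rewrite andbT ltnS ltnW.
  apply: (@le_trans _ _ (2 * ln x%:R * (\sum_(Y0 <= p < x.+1 | prime p && (chi p == 1)) (p%:R : R)^-1))).
    rewrite mulr_sumr big_nat_cond [leRHS]big_nat_cond; apply: ler_sum => p /andP[/andP[_ px] /andP[pp _]].
    rewrite mangoldt_prime// mulrA ler_wpM2r// ler_pM2l// ler_ln ?posrE ?ltr0n// ?prime_gt0//.
    by rewrite ler_nat -ltnS.
  have l0 := ln_nat_ge0 R x.
  have /= := ler_wpM2l l0 (tail x.+1); set S := \sum_(_ <= _ < _ | _) _.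
  by move: (ln x%:R : R) S => u S; lra.
have lo x : (0 < x)%N -> ln x%:R - 1 - C <= \sum_(1 <= n < x.+1) f n.
  move=> x0; have -> : \sum_(1 <= n < x.+1) f n =
      \sum_(1 <= n < x.+1) vM n / n%:R + \sum_(1 <= n < x.+1) chi n * (vM n / n%:R).
    by rewrite -big_split/=; apply: eq_bigr => n _; rewrite /f; ring.
  have /andP[m _] := mertens R x0; have := CP x; rewrite ler_norml => /andP[c _].
  by apply: le_trans (lerD m c); lra.
pose V := 16 + 2 * q%:R + 2 * (ln (Y0%:R : R) + 11) + 1 + C.
pose x := (Num.truncn (expR (2 * V))).+1.
have := le_trans (lo x (ltn0Sn _)) (up x (ltn0Sn _)).
have : 2 * V <= ln (x%:R : R).
  by rewrite -[leLHS]expRK ler_ln ?posrE ?expR_gt0// ltW// truncnS_gt.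
have V0 : 0 < V.
  have := CP 0%N; rewrite big_geq// normr0 => C0.
  by have := ln_nat_ge0 R Y0; have := ler0n R q; rewrite /V; lra.
move: V0; rewrite /V; move: (ln (x%:R : R)) (ln (Y0%:R : R)) (q%:R : R) => a b c; lra.
Qed.

End RealCharacter.

(** * Primes in residue classes *)

Section PrimeClasses.
Variables (R : realType) (q : nat).
Hypothesis q0 : (0 < q)%N.

Definition ample_class (b : nat) := forall T : R, exists Y : nat,
  T < \sum_(1 <= p < Y | prime p && (p %% q == b %% q)%N) (p%:R : R)^-1.

Definition ample_prime p := [/\ prime p, coprime p q & ample_class p].

Let inv0 (p : nat) : 0 <= (p%:R : R)^-1.
Proof. by rewrite invr_ge0. Qed.

Lemma ample_class_mod b : ample_class (b %% q) -> ample_class b.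
Proof. by move=> h T; have [Y] := h T; rewrite modn_mod; exists Y. Qed.

Lemma sum_inv_nonample_bounded : exists T : R, forall Y,
  \sum_(1 <= p < Y | prime p && `[< ~ ample_class p >]) (p%:R : R)^-1 <= T.
Proof.
have /choice[T TP] : forall b, exists T : R, ~ ample_class b -> forall Y,
    \sum_(1 <= p < Y | prime p && (p %% q == b %% q)%N) (p%:R : R)^-1 <= T.
  move=> b; have [ab|/existsNP[T hT]] := pselect (ample_class b); first by exists 0.
  by exists T => _ Y; rewrite leNgt; apply/negP => lt; apply: hT; exists Y.
exists (\sum_(0 <= b < q) `|T b|) => Y.
apply: (@le_trans _ _ (\sum_(0 <= b < q) \sum_(1 <= p < Y |
    prime p && (`[< ~ ample_class b >] && (p %% q == b %% q)%N)) (p%:R : R)^-1)).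
  under [leRHS]eq_bigr do rewrite big_mkcond.
  rewrite exchange_big big_mkcond; apply: ler_sum => p _.
  have t0 b : 0 <= (if prime p && (`[< ~ ample_class b >] && (p %% q == b %% q)%N)
      then (p%:R : R)^-1 else 0) by case: ifP.
  case: ifP => [/andP[pp /asboolP nap]|_]; last exact: sumr_ge0.
  have pq : (p %% q)%N \in index_iota 0 q by rewrite mem_index_iota ltn_mod.
  apply: le_trans (ler_sum_term t0 pq).
  have -> : `[< ~ ample_class (p %% q) >].
    by apply/asboolP => /ample_class_mod.
  by rewrite pp modn_mod eqxx.
apply: ler_sum => b _; have [nab|ab] := pselect (~ ample_class b); last first.
  rewrite big1// => p /andP[_ /andP[/asboolP]].
  by move=> nab; case: ab.
apply: le_trans (ler_norm _); apply: le_trans (TP b nab Y).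
by apply: ler_sum_subrange => // p /andP[-> ->] /andP[-> /andP[_ ->]].
Qed.

Lemma count_divisible_ap (r Q p J : nat) : coprime p Q -> (0 < p)%N ->
  (count (fun j => p %| r + Q * j.+1)%N (iota 0 J) <= (J %/ p).+1)%N.
Proof.
move=> pQ p0; rewrite -size_filter; set s := [seq j <- _ | _].
have sP j : j \in s -> (j < J)%N /\ (p %| r + Q * j.+1)%N.
  by rewrite mem_filter mem_iota => /andP[-> /andP[_ ->]].
have inj (i j : nat) : (i <= j)%N -> i \in s -> j \in s -> (i %/ p = j %/ p)%N -> i = j.
  move=> ij /sP[_ pi] /sP[_ pj] eq.
  have : (p %| j - i)%N.
    rewrite -(Gauss_dvdr _ pQ) mulnBr.
    have -> : (Q * j - Q * i = (r + Q * j.+1) - (r + Q * i.+1))%N by rewrite !mulnS; lia.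
    by rewrite dvdn_sub.
  have jp := divn_eq j p; have ip := divn_eq i p.
  have mj := ltn_pmod j p0; have mi := ltn_pmod i p0.
  case: (posnP (j - i)) => [|ji0 pji]; first by lia.
  have := dvdn_leq ji0 pji; rewrite eq in ip; lia.
have um : uniq [seq (j %/ p)%N | j <- s].
  rewrite map_inj_in_uniq ?filter_uniq ?iota_uniq// => i j hi hj e.
  by have [ij|/ltnW ij] := leqP i j; [apply: inj|apply/esym/inj].
have sub : {subset [seq (j %/ p)%N | j <- s] <= iota 0 (J %/ p).+1}.
  move=> k /mapP[j /sP[jJ _] ->]; rewrite mem_iota/= add0n ltnS.
  by apply: leq_div2r; exact: ltnW.
by have := uniq_leq_size um sub; rewrite size_map size_iota.
Qed.

(* A class prime to [q] contains integers all of whose prime factors are ample: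
   the other primes have a convergent sum of inverses, hence cannot sieve out
   a whole progression. *)
Lemma ample_integer_in_class b : coprime b q -> exists n : nat,
  [/\ (1 < n)%N, n = b %[mod q] & forall p, prime p -> (p %| n)%N -> ample_prime p].
Proof.
move=> bq; have [T TP] := sum_inv_nonample_bounded.
pose bad p := prime p && `[< ~ ample_class p >].
have e4 : (0 : R) < 1 / 4 by lra.
have [Y0 Y00 tail0] := bounded_sum_tail inv0 TP e4.
(* Being [1] modulo [W] rules out the bad primes below [Y0]; those dividing [q] are ruled out by the
   class of [b]. *)
pose W := (\prod_(1 <= p < Y0 | bad p && coprime p q) p)%N.
have Wq : coprime q W.
  rewrite /W; elim/big_ind: _ => [|m n|p /andP[_]]; rewrite ?coprimen1//.
    by rewrite coprimeMr => -> ->.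
  by rewrite coprime_sym.
have W0 : (0 < W)%N.
  rewrite /W big_seq_cond prodn_cond_gt0// => p /andP[_ /andP[/andP[pp _] _]].
  exact: prime_gt0.
pose Q := (q * W)%N; have Q0 : (0 < Q)%N by rewrite muln_gt0 q0.
have Q0R : (0 : R) < Q%:R by rewrite ltr0n.
(* Counting multiples of a bad prime in the progression involves a rounding error of [1] per prime.
   Beyond [Y1] the bad primes are so sparse that at most [X / (8 * Q)] of them lie below [X]. *)
have e8 : (0 : R) < 1 / (8 * Q%:R) by rewrite divr_gt0// mulr_gt0.
have [Y1 Y10 tail1] := bounded_sum_tail inv0 TP e8.
pose r := (chinese q W b 1 %% Q + Q)%N.
have rQ : (r < 2 * Q)%N by rewrite mul2n -addnn ltn_add2r ltn_mod.
have Qr : (Q <= r)%N by exact: leq_addl.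
have r1 : r = b %[mod q].
  by rewrite /r addnC {1}/Q mulnC modnMDl modn_dvdm ?dvdn_mulr// chinese_modl.
have r2 : r = 1 %[mod W].
  by rewrite /r addnC {1}/Q modnMDl modn_dvdm ?dvdn_mull// chinese_modr.
pose J := (8 * (Y1 + 2))%N.
pose X := (r + Q * J).+1.
pose hit j := has (fun p => bad p && (Y0 <= p)%N && coprime p Q && (p %| r + Q * j.+1)%N) (index_iota 1 X).
have [j jJ nhit] : exists2 j, (j < J)%N & ~~ hit j.
  apply: contrapT => H.
  have allhit j : (j < J)%N -> hit j.
    by move=> jJ; apply: contrapT => /negP nh; apply: H; exists j.
  have h1 : (J%:R : R) <= \sum_(1 <= p < X | bad p && (Y0 <= p)%N && coprime p Q)
      (count (fun j => p %| r + Q * j.+1)%N (iota 0 J))%:R.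
    have -> : (J%:R : R) = \sum_(j <- iota 0 J) 1.
      by rewrite big_const_seq count_predT size_iota iter_addr_0.
    under [leRHS]eq_bigr do rewrite -sum1_count natr_sum.
    under [leRHS]eq_bigr do rewrite big_mkcond/=.
    rewrite exchange_big/= big_seq [leRHS]big_seq; apply: ler_sum => j.
    rewrite mem_iota => /andP[_ jJ]; have /hasP[p pX /andP[pb pd]] := allhit j jJ.
    rewrite big_mkcond.
    have t0 i : 0 <= (if bad i && (Y0 <= i)%N && coprime i Q then
       (if (i %| r + Q * j.+1)%N then 1 else 0) else 0 : R) by do 2 case: ifP => //.
    apply: le_trans (ler_sum_term t0 pX); by rewrite pb pd.
  have h2 : \sum_(1 <= p < X | bad p && (Y0 <= p)%N && coprime p Q)
      (count (fun j => p %| r + Q * j.+1)%N (iota 0 J))%:R <=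
      \sum_(Y0 <= p < X | bad p) (J%:R * (p%:R : R)^-1 + 1).
    apply: (@le_trans _ _ (\sum_(1 <= p < X | bad p && (Y0 <= p)%N && coprime p Q) (J%:R * (p%:R : R)^-1 + 1))).
      apply: ler_sum => p /andP[/andP[/andP[pp _] _] pQ].
      have p0 := prime_gt0 pp.
      apply: (@le_trans _ _ (J %/ p).+1%:R); first by rewrite ler_nat count_divisible_ap.
      by rewrite -natr1 lerD2r ler_pdivlMr ?ltr0n// -natrM ler_nat leq_trunc_div.
    apply: ler_sum_subrange => [p|p /andP[_ pX] /andP[/andP[-> ->] _]]; last by rewrite pX.
    by rewrite addr_ge0// mulr_ge0.
  have h3 : \sum_(Y0 <= p < X | bad p) (1 : R) <= Y1%:R + X%:R / (8 * Q%:R).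
    apply: (@le_trans _ _ (\sum_(0 <= p < Y1) (1 : R) + \sum_(Y1 <= p < X | bad p) (1 : R))).
      rewrite (bigID (fun p => p < Y1)%N)/=; apply: lerD; apply: ler_sum_subrange => // p.
        by move=> _ /andP[_ ->].
      by move=> /andP[_ ->] /andP[->]; rewrite -leqNgt => ->.
    rewrite sumr_const_nat subn0 lerD2l.
    apply: (@le_trans _ _ (X%:R * \sum_(Y1 <= p < X | bad p) (p%:R : R)^-1)).
      rewrite mulr_sumr big_nat_cond [leRHS]big_nat_cond; apply: ler_sum => p /andP[/andP[_ pX] /andP[pp _]].
      by rewrite ler_pdivlMr ?ltr0n ?prime_gt0// mul1r ler_nat ltnW.
    by rewrite -[leRHS]/(X%:R * _) -[_^-1]mul1r ler_wpM2l//; exact: tail1.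
  have h4 := tail0 X.
  move: (le_trans h1 h2); rewrite big_split/= -mulr_sumr.
  have h5 := ler_wpM2l (ler0n R J) h4.
  have h6 : X%:R / (8 * Q%:R) <= (J%:R + 2) / 8 :> R.
    rewrite ler_pdivrMr ?mulr_gt0//.
    have -> : (J%:R + 2) / 8 * (8 * Q%:R) = ((J + 2) * Q)%:R :> R.
      by rewrite natrM natrD; field.
    by rewrite ler_nat /X mulnDl [(J * Q)%N]mulnC addnC -addnS leq_add2l.
  have JE : J%:R = 8 * (Y1%:R + 2) :> R by rewrite /J natrM natrD.
  rewrite leNgt => /negP; apply.
  have Y1_ge0 := ler0n R Y1.
  have fin (S1 S2 c d y : R) : S1 <= y + c -> d * S2 <= d * (1 / 4) -> c <= (d + 2) / 8 ->
      d = 8 * (y + 2) -> 0 <= y -> d * S2 + S1 < d by move=> *; lra.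
  exact: fin h3 h5 h6 JE Y1_ge0.
exists (r + Q * j.+1)%N; set n := (r + Q * j.+1)%N.
have nq : n = b %[mod q] by rewrite -r1 /n /Q addnC -mulnA mulnC modnMDl.
have nW : n = 1 %[mod W] by rewrite -r2 /n /Q addnC mulnAC modnMDl.
have coq : coprime n q by rewrite -coprime_modl nq coprime_modl.
have coW : coprime n W by rewrite -coprime_modl nW coprime_modl coprime1n.
split=> //.
  rewrite /n mulnS; apply: (@leq_trans (Q + (Q + Q * j))); last by rewrite leq_add2r.
  by rewrite addnA (leq_trans _ (leq_addr _ _))// -addn1 leq_add.
move=> p pp pn; have p0 := prime_gt0 pp.
have pq : coprime p q by apply: coprime_dvdl coq.
have pW : coprime p W by apply: coprime_dvdl coW.
split=> //; apply: contrapT => nap.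
have bp : bad p by rewrite /bad pp; apply/asboolP.
have [pY|Yp] := ltnP p Y0.
  have pdW : (p %| W)%N.
    by rewrite /W big_mkcond (bigD1_seq p)/= ?iota_uniq ?mem_index_iota ?p0 ?pY// bp pq dvdn_mulr.
  by move: pW; rewrite prime_coprime// pdW.
move: nhit => /negP; apply; apply/hasP; exists p.
  rewrite mem_index_iota p0/= ltnS; apply: leq_trans (dvdn_leq _ pn) _.
    exact: leq_trans Q0 (leq_trans Qr (leq_addr _ _)).
  by rewrite leq_add2l leq_mul2l jJ orbT.
by rewrite bp Yp pn andbT/= /Q coprimeMr pq pW.
Qed.

End PrimeClasses.

(** * Relations among ample primes *)

Section OddRelation.
Variables (R : realType) (q : nat).
Hypothesis q0 : (0 < q)%N.

Definition ample_seq (ps : seq nat) := forall p, p \in ps -> ample_prime R q p.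

Let prods (ps : seq nat) := (\prod_(p <- ps) p)%N.

Let ample_seq_cat ps ps' : ample_seq ps -> ample_seq ps' -> ample_seq (ps ++ ps').
Proof. by move=> h h' p; rewrite mem_cat => /orP[/h|/h']. Qed.

Let coprime_prods ps : ample_seq ps -> coprime (prods ps) q.
Proof.
rewrite /prods; elim: ps => [|p ps IH] h; first by rewrite big_nil coprime1n.
rewrite big_cons coprimeMl IH ?andbT => [|r rps]; last by apply: h; rewrite inE rps orbT.
by have [] := h p (mem_head _ _).
Qed.

Lemma ample_seq_factorization n : (0 < n)%N ->
  (forall p, prime p -> (p %| n)%N -> ample_prime R q p) ->
  exists2 ps, ample_seq ps & (\prod_(p <- ps) p)%N = n.
Proof.
elim/ltn_ind: n => n IH n0 hn; have [->|n1] := eqVneq n 1%N.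
  by exists [::] => //; rewrite big_nil.
have n1' : (1 < n)%N by rewrite ltn_neqAle eq_sym n1.
have pp := pdiv_prime n1'; have pn := pdiv_dvd n; set p := pdiv n in pp pn.
have [||r pr rn|ps hps E] := IH (n %/ p)%N.
- by rewrite ltn_Pdiv// prime_gt1.
- by rewrite divn_gt0 ?prime_gt0// dvdn_leq.
- by apply: hn => //; apply: dvdn_trans rn _; apply: dvdn_div.
exists (p :: ps) => [r|]; last by rewrite big_cons E mulnC divnK.
by rewrite inE => /orP[/eqP ->|/hps]//; exact: hn.
Qed.

Let ample_seq_in_class b : coprime b q -> exists2 ps, ample_seq ps & prods ps = b %[mod q].
Proof.
move=> /(ample_integer_in_class R q0)[n [n1 nb hn]].
by have [ps hps E] := ample_seq_factorization (ltnW n1) hn; exists ps; rewrite // /prods E.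
Qed.

(* Otherwise the parity of the length of an ample factorization of [m] is a real
   character modulo [q] equal to [-1] at all ample primes, so that the primes
   where it equals [1] have a convergent sum of inverses. *)
Lemma odd_ample_relation : exists ps,
  [/\ ample_seq ps, odd (size ps) & (\prod_(p <- ps) p)%N = 1 %[mod q]].
Proof.
apply: contrapT => noodd.
have even1 ps : ample_seq ps -> prods ps = 1 %[mod q] -> odd (size ps) = false.
  by move=> hps e; apply/negP => o; apply: noodd; exists ps.
have prods_cat ps ps' : prods (ps ++ ps') = (prods ps * prods ps')%N by rewrite /prods big_cat.
have par ps ps' : ample_seq ps -> ample_seq ps' -> prods ps = prods ps' %[mod q] ->
    odd (size ps) = odd (size ps').
  move=> h h' e; set a := prods ps in e.
  have aq : coprime a q by exact: coprime_prods.
  (* By Euler's theorem [ps''] represents the inverse of [a] modulo [q]; appended to [ps] and to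
     [ps'] it gives two relations, both of even length. *)
  have [ps'' h'' e''] := ample_seq_in_class (coprimeXl (totient q).-1 aq).
  have inv : a * prods ps'' = 1 %[mod q].
    rewrite -modnMmr e'' modnMmr -expnS prednK ?totient_gt0//.
    exact: cyclic.Euler_exp_totient.
  have := even1 _ (ample_seq_cat h h''); rewrite prods_cat => /(_ inv).
  have := even1 _ (ample_seq_cat h' h''); rewrite prods_cat -modnMml -e modnMml => /(_ inv).
  by rewrite !size_cat !oddD; case: (odd (size ps)); case: (odd (size ps')); case: (odd (size ps'')).
pose chi (m : nat) : R := if coprime m q then
  (-1) ^+ `[< exists ps, [/\ ample_seq ps, prods ps = m %[mod q] & odd (size ps)] >] else 0.
have chiE ps m : ample_seq ps -> prods ps = m %[mod q] -> chi m = (-1) ^+ odd (size ps).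
  move=> h e; rewrite /chi -coprime_modl -e coprime_modl coprime_prods//.
  congr (_ ^+ nat_of_bool _); apply/asboolP/idP => [[ps' [h' e' o]]|o]; last by exists ps.
  by rewrite (par _ ps')// e e'.
have chiP : periodic_mod q chi.
  by move=> m n mn; rewrite /chi -coprime_modl mn coprime_modl.
have chiM m n : chi (m * n)%N = chi m * chi n.
  case: (boolP (coprime (m * n) q)) => [mnq|mnq].
    move: mnq; rewrite coprimeMl => /andP[mq nq].
    have [ps h e] := ample_seq_in_class mq; have [ps' h' e'] := ample_seq_in_class nq.
    rewrite (chiE _ _ h e) (chiE _ _ h' e') (chiE (ps ++ ps')); last 2 first.
    - exact: ample_seq_cat.
    - by rewrite prods_cat -modnMml e modnMml -modnMmr e' modnMmr.
    by rewrite size_cat oddD signr_addb.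
  rewrite /chi (negbTE mnq); move: mnq; rewrite coprimeMl negb_and => /orP[] /negbTE ->.
    by rewrite mul0r.
  by rewrite mulr0.
have chi_cop n : coprime n q -> chi n = 1 \/ chi n = -1.
  by rewrite /chi => ->; case: `[< _ >]; [right|left].
have chi_ncop n : ~~ coprime n q -> chi n = 0 by rewrite /chi => /negbTE ->.
have chi_ample p : ample_prime R q p -> chi p = -1.
  move=> hp; rewrite (chiE [:: p]) => [//|r|]; first by rewrite inE => /eqP ->.
  by rewrite /prods big_seq1.
have [n [n1 _ hn]] := ample_integer_in_class R q0 (coprime1n q).
have chi_n0 : chi (pdiv n) = -1.
  by apply: chi_ample; apply: hn; [exact: pdiv_prime|exact: pdiv_dvd].
have [T TP] := sum_inv_nonample_bounded R q0.
have [Y] := sum_inv_primes_chi1_unbounded q0 chiP chiM chi_cop chi_ncop chi_n0 T.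
apply/negP; rewrite -leNgt; apply: le_trans (TP Y).
apply: ler_sum_subrange => [p|p pY /andP[pp /eqP chip]]; first by rewrite invr_ge0.
rewrite pY pp/=; apply/asboolP => ap.
have pq : coprime p q.
  by apply/negPn/negP => /chi_ncop; rewrite chip => /eqP; rewrite oner_eq0.
have := chi_ample p (And3 pp pq ap); rewrite chip => /eqP.
by rewrite -subr_eq0 opprK -(natrD R 1 1) pnatr_eq0.
Qed.

End OddRelation.

(** * Vanishing of the Moebius means of periodic functions *)

Section MoebiusMeanVanishes.
Variables (R : realType) (q : nat).
Hypothesis q0 : (0 < q)%N.
Implicit Types (w : nat -> R).

(** Slow variation with [t = ln r] compares the means at [x / r] and at [x], which removes the
    dilation of the argument from the Turan-Kubilius relation. *)
Lemma moebius_sum_dilate (r : nat) (e : R) : (1 < r)%N -> 0 < e -> exists x0 : nat,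
  forall x, (x0 <= x)%N -> forall w, bounded1 w -> periodic_mod q w ->
    `|r%:R * moebius_sum w (x %/ r) / x%:R - moebius_mean w x| <= e.
Proof.
move=> r1 e0; have r0 := ltnW r1.
have R0 : (0 : R) < r%:R by rewrite ltr0n.
have lr : 0 < ln (r%:R : R) by rewrite ln_gt0// ltr1n.
have e2 : 0 < e / 2 by rewrite divr_gt0.
have [x0 [dl dl0 slow]] := moebius_mean_slow q0 lr e2.
pose N := (Num.truncn (dl^-1 + 8 / e)).+1.
have NP : dl^-1 + 8 / e < N%:R by exact: truncnS_gt.
exists (r * (x0 + N))%N => x xP w w1 wq; set y := (x %/ r)%N.
have yP : (x0 + N <= y)%N by rewrite leq_divRL// mulnC.
have yx0 : (x0 <= y)%N by apply: leq_trans yP; exact: leq_addr.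
have yN : (N <= y)%N by apply: leq_trans yP; exact: leq_addl.
have y0 : (0 < y)%N by apply: leq_trans yN.
have Y0 : (0 : R) < y%:R by rewrite ltr0n.
have yx : (y <= x)%N by exact: leq_div.
have X0 : (0 : R) < x%:R by rewrite ltr0n (leq_trans y0).
have [d0 d1] : 0 < dl^-1 /\ 0 < 8 / e by rewrite invr_gt0 divr_gt0.
have NY : (N%:R : R) <= y%:R by rewrite ler_nat.
have iy1 : y%:R^-1 <= dl by rewrite -[leRHS]invrK lef_pV2 ?posrE//; move: d1 NP NY d0; move: (dl^-1) (8 / e) => a b; lra.
have iy2 : y%:R^-1 <= e / 8 by rewrite -[e / 8]invf_div lef_pV2 ?posrE//; move: d1 NP NY d0; move: (dl^-1) (8 / e) => a b; lra.
have yr : y%:R * r%:R <= x%:R :> R by rewrite -natrM ler_nat leq_trunc_div.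
have yr' : x%:R <= (y%:R + 1) * r%:R :> R by rewrite natr1 -natrM ler_nat ltnW// ltn_ceil.
have xr : (0 : R) < x%:R / r%:R by rewrite divr_gt0.
have l1 : 0 <= (ln (x%:R / r%:R) - ln y%:R : R) <= y%:R^-1.
  rewrite subr_ge0 ler_ln ?posrE// ler_pdivlMr// yr/=.
  apply: le_trans (lnB_le xr Y0) _; rewrite -[leRHS]mul1r ler_wpM2r ?invr_ge0 ?(ltW Y0)//.
  by rewrite lerBlDl ler_pdivrMr.
have rx : (0 < r <= x)%N.
  by rewrite r0 -(ler_nat R) (le_trans _ yr)// ler_peMl// ler1n.
have L := @moebius_sum_lipschitz R w x y r 1 w1 rx y0; rewrite divn1 mul1r divr1 -/y in L.
have S : `|moebius_mean w y - moebius_mean w x| <= e / 2.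
  apply: slow => //; first exact: leq_trans yx0 yx.
  have -> : ln x%:R - ln y%:R - ln r%:R = ln (x%:R / r%:R) - ln y%:R :> R.
    by rewrite ln_div ?posrE// addrAC.
  have /andP[a b] := l1; rewrite ger0_norm//.
  exact: le_trans b iy1.
have rxy : r%:R / x%:R <= y%:R^-1 :> R.
  by rewrite ler_pdivrMr// mulrC ler_pdivlMr// mulrC.
rewrite -[X in `|X|](subrKA (moebius_mean w y)).
apply: le_trans (ler_normD _ _) _.
have -> : e = e / 2 + e / 2 by field.
apply: lerD S; apply: le_trans L _; have /andP[a b] := l1.
rewrite ger0_norm// div1r; move: b iy2 rxy; move: (y%:R^-1) (r%:R / x%:R) => u v; lra.
Qed.

(** If the relation failed at [x], each prime [r = p %[mod q]] below [Y] would violate the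
    Turan-Kubilius relation by at least [e / 2], and [Y] is chosen so that the inverses of these
    primes sum to more than the permitted [5 / (e / 2) ^ 2]. *)
Lemma moebius_mean_ample (p : nat) (e : R) : ample_class R q p -> 0 < e -> exists x0 : nat,
  forall x, (x0 <= x)%N -> forall w, bounded1 w -> periodic_mod q w ->
    `|moebius_mean w x + moebius_mean (fun n => w (p * n)%N) x| <= e.
Proof.
move=> ap e0; have e2 : 0 < e / 2 by rewrite divr_gt0.
have [Y hY] := ap (5 / (e / 2) ^+ 2).
have /choice[xr xrP] : forall r : nat, exists x0 : nat, (1 < r)%N -> forall x, (x0 <= x)%N ->
    forall w, bounded1 w -> periodic_mod q w ->
    `|r%:R * moebius_sum w (x %/ r) / x%:R - moebius_mean w x| <= e / 2.
  move=> r; have [r1|r1] := boolP (1 < r)%N; last by exists 0%N.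
  by have [x0 h] := moebius_sum_dilate r1 e2; exists x0.
exists (16 * Y ^ 2 + (\sum_(r < Y) xr r).+1)%N => x xP w w1 wq.
have x0 : (0 < x)%N by apply: leq_trans xP; rewrite addnS.
have xY : (16 * Y ^ 2 <= x)%N by apply: leq_trans xP; exact: leq_addr.
pose P := [seq r <- index_iota 1 Y | prime r && (r %% q == p %% q)%N].
have uP : uniq P by rewrite filter_uniq// iota_uniq.
have aP : all prime P by apply/allP => r; rewrite mem_filter => /andP[/andP[]].
have sizeP : (size P <= Y)%N.
  by rewrite size_filter (leq_trans (count_size _ _))// size_iota leq_subr.
have xP2 : (16 * size P ^ 2 <= x)%N.
  by apply: leq_trans xY; rewrite leq_mul2l leq_exp2r.
have := turan_kubilius_dual uP aP w1 x0 xP2.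
apply: contraTT; rewrite -!ltNge => big.
rewrite ltr_pdivrMr ?exprn_gt0// mulrC in hY; apply: lt_le_trans hY _.
rewrite mulr_sumr -big_filter -/P big_seq [leRHS]big_seq; apply: ler_sum => r.
rewrite mem_filter mem_index_iota => /andP[/andP[pr /eqP rp] /andP[_ rY]].
rewrite ler_wpM2r ?invr_ge0//.
have pw : periodic_mod q (fun n => w (p * n)%N).
  by move=> m n mn; apply: wq; rewrite -modnMmr mn modnMmr.
have xrx : (xr r <= x)%N.
  apply: leq_trans xP; rewrite addnS leqW// (leq_trans _ (leq_addl _ _))//.
  by rewrite (bigD1 (Ordinal rY))//= leq_addr.
have := xrP r (prime_gt1 pr) x xrx (fun n => w (p * n)%N) (fun n => w1 _) pw.
have -> : moebius_sum (fun n => w (p * n)%N) (x %/ r) = moebius_sum (fun n => w (r * n)%N) (x %/ r).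
  by apply: moebius_sum_ext => n; apply: wq; rewrite -modnMml -rp modnMml.
rewrite [X in _ -> _ <= X ^+ 2]mulrDl -/(moebius_mean w x).
move: (r%:R * _ / _) (moebius_mean w x) (moebius_mean (fun n => w (p * n)%N) x) big => a b c big hac.
have h : e / 2 <= `|b + a|.
  have : `|b + c| <= `|b + a| + `|a - c|.
    have -> : b + c = (b + a) - (a - c) by ring.
    exact: ler_normB.
  by lra.
rewrite -[leRHS]real_normK ?num_real//.
by apply: lerXn2r; rewrite ?nnegrE ?(ltW e2).
Qed.

Lemma moebius_mean_ample_seq (ps : seq nat) : ample_seq R q ps ->
  forall e : R, 0 < e -> exists x0 : nat,
  forall x, (x0 <= x)%N -> forall w, bounded1 w -> periodic_mod q w ->
    `|moebius_mean w x - (-1) ^+ size ps *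
       moebius_mean (fun n => w ((\prod_(p <- ps) p) * n)%N) x| <= e.
Proof.
elim: ps => [|p ps IH] hps e e0.
  exists 0%N => x _ w _ _; rewrite expr0 mul1r.
  rewrite (_ : moebius_mean _ x = moebius_mean w x) ?subrr ?normr0 ?ltW//.
  by congr (_ / _); apply: moebius_sum_ext => n; rewrite big_nil mul1n.
have e2 : 0 < e / 2 by rewrite divr_gt0.
have [_ _ ap] := hps p (mem_head _ _).
have [x1 h1] := moebius_mean_ample ap e2.
have [|x2 h2] := IH _ _ e2; first by move=> r rps; apply: hps; rewrite inE rps orbT.
exists (x1 + x2)%N => x xP w w1 wq.
have pw : periodic_mod q (fun n => w (p * n)%N).
  by move=> m n mn; apply: wq; rewrite -modnMmr mn modnMmr.
have := h1 x (leq_trans (leq_addr _ _) xP) w w1 wq.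
have := h2 x (leq_trans (leq_addl _ _) xP) _ (fun n => w1 _) pw.
have -> : moebius_mean (fun n => w (\prod_(r <- p :: ps) r * n)%N) x =
    moebius_mean (fun n => w (p * (\prod_(r <- ps) r * n))%N) x.
  by congr (_ / _); apply: moebius_sum_ext => n; rewrite big_cons mulnA.
have key (s a b c : R) : `|b - s * c| <= e / 2 -> `|a + b| <= e / 2 -> `|a - -1 * s * c| <= e.
  move=> hb ha; have -> : a - -1 * s * c = (a + b) - (b - s * c) by ring.
  by apply: le_trans (ler_normB _ _) _; lra.
by move=> hb ha; rewrite exprS; exact: key hb ha.
Qed.

(** An odd relation of product [1] modulo [q] returns to [w] itself with the sign [-1], so that
    twice the mean is small. *)
Theorem moebius_mean_cvg0 (e : R) : 0 < e -> exists x0 : nat,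
  forall x, (x0 <= x)%N -> forall w, bounded1 w -> periodic_mod q w ->
    `|moebius_mean w x| <= e.
Proof.
move=> e0; have [ps [hps ops prod1]] := odd_ample_relation R q0.
have [x0 h] := moebius_mean_ample_seq hps e0.
exists x0 => x xP w w1 wq; have := h x xP w w1 wq.
have -> : moebius_mean (fun n => w ((\prod_(p <- ps) p) * n)%N) x = moebius_mean w x.
  by congr (_ / _); apply: moebius_sum_ext => n; apply: wq; rewrite -modnMml prod1 modnMml mul1n.
rewrite -signr_odd ops expr1 mulN1r opprK -mulr2n normrMn -mulr_natl => h2.
by have := normr_ge0 (moebius_mean w x); lra.
Qed.

End MoebiusMeanVanishes.

(** * From Moebius means to sums over primes *)

Section PrimesInClasses.
Variables (R : realType) (q : nat).
Hypothesis q0 : (0 < q)%N.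
Implicit Types (w : nat -> R).
Local Notation vM := (@mangoldt R).
Local Notation mu := (@moebius R).

(** The condition is imposed for every [u], prime to [q] or not, because the hyperbola method meets
    the sums of [w (u * v)] over [v] for all [u]. *)
Definition zero_mean_dilates w := forall u, \sum_(0 <= v < q) w (u * v)%N = 0.

Let sum_dilate_bound w u x y : bounded1 w -> periodic_mod q w -> zero_mean_dilates w ->
  `|\sum_(x <= v < y) w (u * v)%N| <= 2 * q%:R.
Proof.
move=> w1 wq w0; apply: periodic_sum_bound => // m n mn.
by apply: wq; rewrite -modnMmr mn modnMmr.
Qed.

Let sum_dilate_ln_bound w u y : bounded1 w -> periodic_mod q w -> zero_mean_dilates w ->
  `|\sum_(1 <= v < y.+1) w (u * v)%N * ln v%:R| <= 4 * q%:R * ln y%:R.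
Proof.
move=> w1 wq w0; have [->|y_neq0] := eqVneq y 0%N.
  by rewrite big_geq// ln0// mulr0 normr0.
have y0 : (0 < y)%N by rewrite lt0n.
have ly := ln_nat_ge0 R y.
(* Abel summation takes a nonnegative nonincreasing weight on all indices; hence [ln y - ln v],
   frozen at [0] beyond [y]. *)
pose phi v : R := ln y%:R - ln (minn v y)%:R.
have A := abel_bound (phi := phi) y.+1 (fun k => sum_dilate_bound u 1 k w1 wq w0).
have {}A : `|\sum_(1 <= v < y.+1) w (u * v)%N * phi v| <= 2 * q%:R * ln y%:R.
  have -> : ln (y%:R : R) = phi 1%N by rewrite /phi (minn_idPl y0) ln1 subr0.
  apply: A => i i1; have m0 j : (0 < j)%N -> (0 < minn j y)%N by rewrite leq_min => ->.
  rewrite /phi subr_ge0 lerD2l lerN2 !ler_ln ?posrE ?ltr0n ?m0// !ler_nat geq_minr; split=> //.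
  by rewrite leq_min geq_minr andbT (leq_trans (geq_minl _ _)).
have E : \sum_(1 <= v < y.+1) w (u * v)%N * ln v%:R =
    (\sum_(1 <= v < y.+1) w (u * v)%N) * ln y%:R - \sum_(1 <= v < y.+1) w (u * v)%N * phi v.
  rewrite mulr_suml -sumrB; apply: eq_big_nat => v /andP[_ vy].
  by rewrite /phi (minn_idPl _) -1?ltnS//; ring.
rewrite E; apply: le_trans (ler_normB _ _) _; rewrite normrM [X in _ * X]ger0_norm//.
by have := ler_wpM2r ly (sum_dilate_bound u 1 y.+1 w1 wq w0); lra.
Qed.

(* Dirichlet's hyperbola method for [mangoldt * w], cutting at [u <= x / m ^ 2]. *)
Lemma sum_mangoldt_periodic (e : R) : 0 < e -> exists x0 : nat, forall x, (x0 <= x)%N ->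
  forall w, bounded1 w -> periodic_mod q w -> zero_mean_dilates w ->
  `|\sum_(1 <= n < x.+1) vM n * w n| <= e * x%:R.
Proof.
(* The part [u <= x / m ^ 2] is at most [16 * q * x / m], at most half of [e * x] by the choice of
   [m]. In the other part [K] values of [v] contribute [2 * K * e' * x] each, and [e'] makes this
   the other half. *)
move=> e0; pose m := (Num.truncn (32 * q%:R / e)).+1.
have mP : 32 * q%:R / e < m%:R by exact: truncnS_gt.
pose K := (m ^ 2)%N;
pose e' := e / (4 * K%:R ^+ 2).
have e'0 : 0 < e' by rewrite divr_gt0// mulr_gt0// exprn_gt0.
have [x0 mean] := moebius_mean_cvg0 q0 e'0.
exists (K * x0.+1)%N => x xK w w1 wq w0; set A := (x %/ K)%N.
have Ax0 : (x0.+1 <= A)%N by rewrite leq_divRL// mulnC.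
have A0 : (0 < A)%N by apply: leq_trans Ax0.
have Ax : (A <= x)%N by exact: leq_div.
have x_gt0 := leq_trans A0 Ax.
have X0 : (0 : R) < x%:R by rewrite ltr0n.
have -> : \sum_(1 <= n < x.+1) vM n * w n =
    \sum_(1 <= u < x.+1) \sum_(1 <= v < (x %/ u).+1) mu u * ln v%:R * w (u * v)%N.
  transitivity (\sum_(1 <= u < x.+1) \sum_(1 <= v < (x %/ u).+1)
      mu u * ln ((u * v) %/ u)%:R * w (u * v)%N); last first.
    by apply: eq_big_nat => u /andP[u0 _]; apply: eq_bigr => v _; rewrite mulKn.
  rewrite (sum_divisors_exchange (fun u n => mu u * ln (n %/ u)%:R * w n)).
  by apply: eq_big_nat => n /andP[n0 _]; rewrite -mulr_suml moebius_inversion_ln.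
rewrite (big_cat_nat (n := A.+1))//=; apply: le_trans (ler_normD _ _) _.
have -> : e * x%:R = e / 2 * x%:R + e / 2 * x%:R by field.
apply: lerD.
  apply: le_trans (ler_norm_sum _ _ _) _.
  apply: (@le_trans _ _ (\sum_(1 <= u < A.+1) 8 * q%:R * Num.sqrt x%:R * (Num.sqrt u%:R)^-1)).
    apply: ler_sum_nat => u /andP[u0 uA].
    have xu : (0 < x %/ u)%N by rewrite divn_gt0// (leq_trans _ Ax).
    have -> : \sum_(1 <= v < (x %/ u).+1) mu u * ln v%:R * w (u * v)%N =
        mu u * \sum_(1 <= v < (x %/ u).+1) w (u * v)%N * ln v%:R.
      by rewrite mulr_sumr; apply: eq_bigr => v _; ring.
    rewrite normrM; apply: le_trans (ler_piMl _ (normr_moebius_le1 R u)) _ => //.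
    apply: le_trans (sum_dilate_ln_bound u (x %/ u) w1 wq w0) _.
    have U0 : (0 : R) < u%:R by rewrite ltr0n.
    have XU : (0 : R) < (x %/ u)%:R by rewrite ltr0n.
    have h1 := ln_le_sqrt XU.
    have h2 : Num.sqrt ((x %/ u)%:R : R) <= Num.sqrt x%:R / Num.sqrt u%:R.
      rewrite -sqrtrV -?sqrtrM ?ler_wsqrtr// ?ler0n// ler_pdivlMr// -natrM ler_nat.
      exact: leq_trunc_div.
    have -> : 8 * q%:R * Num.sqrt x%:R / Num.sqrt u%:R = 4 * q%:R * (2 * (Num.sqrt x%:R / Num.sqrt u%:R)) :> R.
      by ring.
    rewrite ler_wpM2l ?mulr_ge0//; lra.
  rewrite -mulr_sumr.
  have h3 := sum_inv_sqrt R A.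
  have h4 : Num.sqrt x%:R * Num.sqrt A%:R <= x%:R / m%:R :> R.
    rewrite -sqrtrM// -[leRHS]ger0_norm ?divr_ge0// -sqrtr_sqr ler_wsqrtr//.
    rewrite exprMn expr2 -mulrA ler_wpM2l// exprVn ler_pdivlMr ?exprn_gt0//.
    by rewrite -natrX -natrM ler_nat leq_trunc_div.
  apply: (@le_trans _ _ (16 * q%:R * (x%:R / m%:R))).
    have := sqrtr_ge0 (x%:R : R); move: (Num.sqrt x%:R) (Num.sqrt A%:R) (x%:R / m%:R) h3 h4.
    move=> s t z h3 h4 s0.
    have h5 := ler_wpM2l (_ : 0 <= 8 * q%:R * s) h3; rewrite !mulr_ge0// in h5.
    have {}h5 := h5 isT; have := ler_wpM2l (_ : 0 <= 16 * q%:R) h4; rewrite mulr_ge0// => /(_ isT).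
    by move: h5; lra.
  rewrite mulrA ler_pdivrMr//; move: mP; rewrite ltr_pdivrMr// => mP.
  by have := ler_wpM2r (ltW X0) (ltW mP); lra.
have -> : \sum_(A.+1 <= u < x.+1) \sum_(1 <= v < (x %/ u).+1) mu u * ln v%:R * w (u * v)%N =
    \sum_(1 <= v < x.+1) ln v%:R * \sum_(A.+1 <= u < (x %/ v).+1) mu u * w (v * u)%N.
  transitivity (\sum_(1 <= u < x.+1) \sum_(1 <= v < (x %/ u).+1)
      (if (A < u)%N then mu u * ln v%:R * w (u * v)%N else 0)).
    rewrite [RHS](big_cat_nat (n := A.+1))//= [X in _ = X + _]big_nat_cond [X in _ = X + _]big1 ?add0r.
      by apply: eq_big_nat => u /andP[Au _]; apply: eq_bigr => v _; rewrite Au.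
    move=> u /andP[/andP[_ uA] _]; rewrite big1// => v _.
    by rewrite ltnNge -ltnS uA.
  rewrite (sum_hyperbola_exchange (fun u v => if (A < u)%N then mu u * ln v%:R * w (u * v)%N else 0)).
  apply: eq_bigr => v _; rewrite -big_mkcond mulr_sumr.
  rewrite [RHS](big_nat_widenl A.+1 1)//=; apply: eq_big => [//|u _].
  by rewrite [(v * u)%N]mulnC; ring.
have tail v : (K < v)%N -> \sum_(A.+1 <= u < (x %/ v).+1) mu u * w (v * u)%N = 0.
  by move=> Kv; rewrite big_geq// ltnS leq_div2l// ltnW.
have Kx : (K <= x)%N by apply: leq_trans xK; rewrite leq_pmulr.
rewrite (big_cat_nat (n := K.+1))//= [X in _ + X]big_nat_cond [X in _ + X]big1 ?addr0; last first.
  by move=> v /andP[/andP[Kv _] _]; rewrite tail// mulr0.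
apply: le_trans (ler_norm_sum _ _ _) _.
apply: (@le_trans _ _ (\sum_(1 <= v < K.+1) 2 * K%:R * e' * x%:R)); last first.
  rewrite sumr_const_nat subn1/= -mulr_natr /e'.
  by rewrite le_eqVlt; apply/orP; left; apply/eqP; field; rewrite gt_eqF.
apply: ler_sum_nat => v /andP[v0 vK]; have V0 : (0 : R) < v%:R by rewrite ltr0n.
have Av : (A <= x %/ v)%N by apply: leq_div2l; rewrite // -ltnS.
have pw : periodic_mod q (fun n => w (v * n)%N).
  by move=> i j ij; apply: wq; rewrite -modnMmr ij modnMmr.
have S y : (A <= y)%N -> (y <= x)%N -> `|moebius_sum (fun n => w (v * n)%N) y| <= e' * x%:R.
  move=> Ay yx; have y0 : (0 : R) < y%:R by rewrite ltr0n (leq_trans A0).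
  have := mean y (leq_trans (ltnW Ax0) Ay) (fun n => w (v * n)%N) (fun n => w1 _) pw.
  rewrite /moebius_mean normrM normfV [X in _ / X]ger0_norm ?ler0n// ler_pdivrMr// => h.
  by apply: le_trans h _; rewrite ler_wpM2l ?(ltW e'0)// ler_nat.
have -> : \sum_(A.+1 <= u < (x %/ v).+1) mu u * w (v * u)%N =
    moebius_sum (fun n => w (v * n)%N) (x %/ v) - moebius_sum (fun n => w (v * n)%N) A.
  by rewrite /moebius_sum [X in _ = X - _](big_cat_nat (n := A.+1))//= addrAC subrr add0r.
have lv : ln (v%:R : R) <= K%:R.
  by apply: ltW; apply: lt_le_trans (ln_sublinear V0) _; rewrite ler_nat -ltnS.
rewrite normrM ger0_norm ?ln_nat_ge0//.
have -> : 2 * K%:R * e' * x%:R = K%:R * (e' * x%:R + e' * x%:R) by ring.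
apply: ler_pM => //; first exact: ln_nat_ge0.
by apply: le_trans (ler_normB _ _) _; rewrite lerD ?S ?leq_div.
Qed.

Let pi_le : forall e : R, 0 < e -> exists x0 : nat, forall x, (x0 <= x)%N ->
  \sum_(1 <= p < x.+1 | prime p) 1 <= e * x%:R.
Proof.
move=> e e0; pose y := (Num.truncn (expR (20 / e))).+1.
have yP : 20 / e <= ln (y%:R : R).
  by rewrite -[leLHS]expRK ler_ln ?posrE ?expR_gt0// ltW// truncnS_gt.
exists (y + (Num.truncn (2 * y%:R / e)).+1)%N => x xP.
have yx : (y <= x)%N by apply: leq_trans xP; exact: leq_addr.
have xe : 2 * y%:R / e <= x%:R.
  by apply/ltW; apply: lt_le_trans (truncnS_gt _) _; rewrite ler_nat (leq_trans _ xP)// leq_addl.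
rewrite (big_cat_nat (n := y.+1))//=.
have -> : e * x%:R = e / 2 * x%:R + e / 2 * x%:R by field.
apply: lerD.
  apply: (@le_trans _ _ (\sum_(1 <= p < y.+1) 1)).
    by rewrite big_mkcond; apply: ler_sum => p _; case: ifP.
  by rewrite sumr_const_nat subn1/=; move: xe; rewrite ler_pdivrMr//; lra.
have h : ln (y%:R : R) * \sum_(y.+1 <= p < x.+1 | prime p) 1 <= psi R x.
  rewrite mulr_sumr; apply: (@le_trans _ _ (\sum_(y.+1 <= p < x.+1 | prime p) vM p)).
    rewrite big_nat_cond [leRHS]big_nat_cond; apply: ler_sum => p /andP[/andP[yp _] pp].
    by rewrite mulr1 mangoldt_prime// ler_ln ?posrE ?ltr0n// ?prime_gt0// ler_nat ltnW.
  apply: ler_sum_subrange => [n|n /andP[yn ->] _]; first exact: mangoldt_ge0.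
  by rewrite (leq_trans _ yn).
have h2 : 20 / e * \sum_(y.+1 <= p < x.+1 | prime p) 1 <= 10 * x%:R.
  by apply: le_trans (ler_wpM2r _ yP) (le_trans h (psi_le R x)); apply: sumr_ge0.
move: h2; rewrite mulrAC ler_pdivrMr//; lra.
Qed.

Let nonprime_le : forall e : R, 0 < e -> exists x0 : nat, forall x, (x0 <= x)%N ->
  \sum_(1 <= n < x.+1 | ~~ prime n) vM n <= e * x%:R.
Proof.
move=> e e0; have e2 : 0 < e / 2 by rewrite divr_gt0.
have f0 n : 0 <= vM n / n%:R by rewrite divr_ge0 ?mangoldt_ge0.
have B Y : \sum_(1 <= n < Y | ~~ prime n) vM n / n%:R <= 8.
  case: Y => [|Y]; first by rewrite big_geq.
  exact: sum_mangoldt_nonprime.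
have [Y0 Y00 tail] := bounded_sum_tail f0 B e2.
exists (Y0 + (Num.truncn (20 * Y0%:R / e)).+1)%N => x xP.
have yx : (Y0 <= x)%N by apply: leq_trans xP; exact: leq_addr.
have xe : 20 * Y0%:R / e <= x%:R.
  by apply/ltW; apply: lt_le_trans (truncnS_gt _) _; rewrite ler_nat (leq_trans _ xP)// leq_addl.
rewrite (big_cat_nat (n := Y0))//= ?(leqW yx)//.
have -> : e * x%:R = e / 2 * x%:R + e / 2 * x%:R by field.
apply: lerD.
  apply: (@le_trans _ _ (psi R Y0)).
    apply: ler_sum_subrange => [n|n /andP[-> nY] _]; first exact: mangoldt_ge0.
    by rewrite andbT ltnS ltnW.
  apply: le_trans (psi_le R Y0) _; move: xe; rewrite ler_pdivrMr//; lra.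
apply: (@le_trans _ _ (x%:R * \sum_(Y0 <= n < x.+1 | ~~ prime n) vM n / n%:R)); last first.
  by rewrite mulrC ler_wpM2r//; exact: tail.
rewrite mulr_sumr big_nat_cond [leRHS]big_nat_cond; apply: ler_sum => n /andP[/andP[Yn nx] _].
have N0 : (0 : R) < n%:R by rewrite ltr0n (leq_trans Y00).
by rewrite mulrCA ler_peMr ?mangoldt_ge0// ler_pdivlMr// mul1r ler_nat.
Qed.

(** Mertens' bounds lose [12]; with [ln M >= 13] there remains a mass of at least [1] for
    [mangoldt d / d] on the integers of [(x / M, x]], where [1 / d] is of order [M / x]. *)
Let psi_lower : exists2 c : R, 0 < c & exists x0 : nat, forall x, (x0 <= x)%N -> c * x%:R <= psi R x.
Proof.
pose M := (Num.truncn (expR (13 : R))).+1.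
have lM : 13 <= ln (M%:R : R).
  by rewrite -[leLHS]expRK ler_ln ?posrE ?expR_gt0// ltW// truncnS_gt.
exists (M%:R^-1); first by rewrite invr_gt0.
exists M => x Mx; set y := (x %/ M)%N.
have y0 : (0 < y)%N by rewrite divn_gt0.
have yx : (y <= x)%N by exact: leq_div.
have Y0 : (0 : R) < y%:R by rewrite ltr0n.
have X0 : (0 : R) < x%:R by rewrite ltr0n (leq_trans y0).
have w := mangoldt_window R y0 yx.
have l : ln (M%:R : R) <= ln x%:R - ln y%:R.
  rewrite -ln_div ?posrE// ler_ln ?posrE ?divr_gt0// ler_pdivlMr// mulrC -natrM ler_nat.
  exact: leq_trunc_div.
have h : \sum_(y.+1 <= d < x.+1) vM d / d%:R <= psi R x / y.+1%:R.
  apply: (@le_trans _ _ (\sum_(y.+1 <= d < x.+1) vM d / y.+1%:R)).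
    apply: ler_sum_nat => d /andP[yd _]; rewrite ler_wpM2l ?mangoldt_ge0//.
    by rewrite lef_pV2 ?posrE ?ltr0n ?ler_nat// (leq_trans _ yd).
  rewrite -mulr_suml ler_wpM2r ?invr_ge0//.
  apply: ler_sum_subrange => [n|n /andP[yn ->] _]; first exact: mangoldt_ge0.
  by rewrite (leq_trans _ yn).
have : 1 <= psi R x / y.+1%:R by apply: le_trans h; lra.
rewrite ler_pdivlMr ?ltr0n// mul1r; apply: le_trans.
rewrite mulrC ler_pdivrMr// -natrM ler_nat ltnW//.
by rewrite ltn_ceil.
Qed.

Let prime_piE x : (prime_pi x)%:R = \sum_(1 <= p < x.+1 | prime p) 1 :> R.
Proof.
rewrite /prime_pi -sum1_count natr_sum.
by rewrite -[iota 0 x.+1]/(index_iota 0 x.+1) [LHS]big_mkcond/= big_nat_recl//= add0r big_add1 -big_mkcond.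
Qed.

(** This lets the weight [ln p] be replaced by the constant [ln x]. Since [ln x - ln p] is at most
    the sum of [1 / n] over [p <= n < x], the left side is bounded by the sum of [pi(n) / n], and
    [pi(n) = o(n)]. *)
Let sum_ln_ratio_le : forall e : R, 0 < e -> exists x0 : nat, forall x, (x0 <= x)%N ->
  \sum_(1 <= p < x.+1 | prime p) (ln x%:R - ln p%:R) <= e * x%:R.
Proof.
move=> e e0; have e2 : 0 < e / 2 by rewrite divr_gt0.
have [n0 piP] := pi_le e2.
exists (n0.+1 + (Num.truncn (2 * n0.+1%:R / e)).+1)%N => x xP.
have n0x : (n0.+1 <= x)%N by apply: leq_trans xP; exact: leq_addr.
have xe : 2 * n0.+1%:R / e <= x%:R.
  by apply/ltW; apply: lt_le_trans (truncnS_gt _) _; rewrite ler_nat (leq_trans _ xP)// leq_addl.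
have tele p : (0 < p)%N -> (p <= x)%N -> ln x%:R - ln p%:R <= \sum_(p <= n < x) n%:R^-1 :> R.
  move=> p0; elim: x {xP n0x xe} => [|x IH]; first by rewrite leqn0 => /eqP p_eq0; rewrite p_eq0 in p0.
  rewrite leq_eqVlt => /orP[/eqP <-|px]; first by rewrite subrr big_geq.
  rewrite ltnS in px; rewrite big_nat_recr//=.
  have /andP[_ h] := ln_natS_bounds R (leq_trans p0 px).
  have := IH px; move: h; move: (\sum_(_ <= _ < _) _) (x%:R^-1) => a b; lra.
apply: (@le_trans _ _ (\sum_(1 <= n < x) n%:R^-1 * \sum_(1 <= p < n.+1 | prime p) 1)).
  apply: (@le_trans _ _ (\sum_(1 <= p < x.+1 | prime p) \sum_(1 <= n < x) (if (p <= n)%N then n%:R^-1 else 0))).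
    rewrite big_nat_cond [leRHS]big_nat_cond; apply: ler_sum => p /andP[/andP[p0 px] _].
    apply: le_trans (tele p p0 px) _; rewrite -big_mkcond.
    apply: ler_sum_subrange => [n|n /andP[pn ->] _]; first by rewrite invr_ge0.
    by rewrite pn (leq_trans p0 pn).
  rewrite exchange_big/=; apply: ler_sum_nat => n /andP[n1 nx].
  rewrite mulr_sumr -big_mkcondr/=.
  rewrite (eq_bigr (fun=> n%:R^-1 * 1)) => [|p _]; last by rewrite mulr1.
  apply: ler_sum_subrange => [p|p /andP[-> _] /andP[-> pn]]; first by rewrite mulr1 invr_ge0.
  by rewrite ltnS pn.
rewrite (big_cat_nat (n := n0.+1))//=.
have -> : e * x%:R = e / 2 * x%:R + e / 2 * x%:R by field.
have triv n : \sum_(1 <= p < n.+1 | prime p) 1 <= n%:R :> R.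
  apply: (@le_trans _ _ (\sum_(1 <= p < n.+1) 1)); last by rewrite sumr_const_nat subn1.
  by rewrite big_mkcond; apply: ler_sum => p _; case: ifP.
apply: lerD.
  apply: (@le_trans _ _ (\sum_(1 <= n < n0.+1) 1)).
    apply: ler_sum_nat => n /andP[n1 _]; have N0 : (0 : R) < n%:R by rewrite ltr0n.
    by rewrite mulrC ler_pdivrMr// mul1r.
  rewrite sumr_const_nat subn1/=; move: xe; rewrite ler_pdivrMr//.
  have : (n0%:R : R) <= n0.+1%:R by rewrite ler_nat.
  by move: (n0.+1%:R : R) (n0%:R : R) => a b; lra.
apply: (@le_trans _ _ (\sum_(n0.+1 <= n < x) e / 2)).
  apply: ler_sum_nat => n /andP[n1 _]; have N0 : (0 : R) < n%:R by rewrite ltr0n (leq_trans _ n1).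
  by rewrite mulrC ler_pdivrMr// piP// ltnW.
rewrite sumr_const_nat -[leLHS]mulr_natr.
by apply: ler_wpM2l; [exact: ltW|rewrite ler_nat leq_subr].
Qed.

(** Passing from [mangoldt] to [ln x] times the indicator of primes costs [o(x)]; the lower bound
    [c / 2 * x <= ln x * pi(x)] turns an error [o(x) / ln x] into [o(pi(x))]. *)
Lemma sum_primes_zero_mean (e : R) : 0 < e -> exists x0 : nat, forall x, (x0 <= x)%N ->
  (0 < prime_pi x)%N /\
  forall w, bounded1 w -> periodic_mod q w -> zero_mean_dilates w ->
  `|\sum_(1 <= p < x.+1 | prime p) w p| <= e * (prime_pi x)%:R.
Proof.
move=> e0; have [c c0 [x1 low]] := psi_lower.
have c2 : 0 < c / 2 by rewrite divr_gt0.
pose d := e * c / 8; have d0 : 0 < d by rewrite divr_gt0// mulr_gt0.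
have [x2 P2] := nonprime_le c2; have [x3 P3] := sum_mangoldt_periodic d0.
have [x4 P4] := nonprime_le d0; have [x5 P5] := sum_ln_ratio_le d0.
exists (x1 + x2 + x3 + x4 + x5 + 2)%N => x xP.
have x_gt0 : (0 < x)%N by lia.
have X0 : (1 : R) < x%:R by rewrite ltr1n; lia.
have lx : 0 < ln (x%:R : R) by rewrite ln_gt0.
have vMp : \sum_(1 <= p < x.+1 | prime p) vM p = \sum_(1 <= p < x.+1 | prime p) ln p%:R.
  by apply: eq_bigr => p pp; rewrite mangoldt_prime.
have pil : c / 2 * x%:R <= ln x%:R * (prime_pi x)%:R.
  have h1 := low x (ltac:(lia)); have h2 := P2 x (ltac:(lia)).
  apply: (@le_trans _ _ (\sum_(1 <= p < x.+1 | prime p) vM p)).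
    by move: h1; rewrite /psi (bigID prime)/=; lra.
  rewrite vMp prime_piE mulr_sumr big_nat_cond [leRHS]big_nat_cond.
  apply: ler_sum => p /andP[/andP[p0 px] pp].
  by rewrite mulr1 ler_ln ?posrE ?ltr0n// ler_nat -ltnS.
split=> [|w w1 wq w0].
  rewrite -(ltr0n R) -(pmulr_rgt0 _ lx); apply: lt_le_trans pil.
  by rewrite mulr_gt0//; lra.
have h3 := P3 x (ltac:(lia)) w w1 wq w0.
have h4 := P4 x (ltac:(lia)); have h5 := P5 x (ltac:(lia)).
have S : `|ln x%:R * \sum_(1 <= p < x.+1 | prime p) w p| <= 3 * d * x%:R.
  have E : ln x%:R * \sum_(1 <= p < x.+1 | prime p) w p =
     \sum_(1 <= n < x.+1) vM n * w n - \sum_(1 <= n < x.+1 | ~~ prime n) vM n * w n +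
     \sum_(1 <= p < x.+1 | prime p) w p * (ln x%:R - ln p%:R).
    rewrite [X in X - _ + _](bigID prime)/= addrK mulr_sumr -big_split/=.
    by apply: eq_bigr => p pp; rewrite mangoldt_prime//; ring.
  have b1 : `|\sum_(1 <= n < x.+1 | ~~ prime n) vM n * w n| <= d * x%:R.
    apply: le_trans h4; apply: le_trans (ler_norm_sum _ _ _) _; apply: ler_sum => n _.
    by rewrite normrM (ger0_norm (mangoldt_ge0 _ _)) ler_piMr ?mangoldt_ge0.
  have b2 : `|\sum_(1 <= p < x.+1 | prime p) w p * (ln x%:R - ln p%:R)| <= d * x%:R.
    apply: le_trans h5; apply: le_trans (ler_norm_sum _ _ _) _.
    rewrite big_nat_cond [leRHS]big_nat_cond; apply: ler_sum => p /andP[/andP[p0 px] _].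
    have : 0 <= ln x%:R - ln p%:R :> R.
      by rewrite subr_ge0 ler_ln ?posrE ?ltr0n// ler_nat -ltnS.
    by move=> l0; rewrite normrM (ger0_norm l0) ler_piMl.
  rewrite E; apply: le_trans (ler_normD _ _) _.
  by apply: le_trans (lerD (ler_normB _ _) (lexx _)) _; lra.
rewrite -(ler_pM2l lx); move: S; rewrite normrM (gtr0_norm lx) => /le_trans; apply.
rewrite mulrCA; have := ler_wpM2l (ltW e0) pil; rewrite /d.
have : 0 <= e * c * x%:R by rewrite !mulr_ge0// ltW.
by lra.
Qed.

End PrimesInClasses.

Lemma prime_pi_mono m n : (m <= n)%N -> (prime_pi m <= prime_pi n)%N.
Proof.
by move=> mn; rewrite /prime_pi -(subnKC (_ : m.+1 <= n.+1)%N)// iotaD count_cat leq_addr.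
Qed.

Lemma prime_pi_unbounded M : exists N0, forall N, (N0 <= N)%N -> (M <= prime_pi N)%N.
Proof.
suff [N0 h] : exists N0, (M <= prime_pi N0)%N.
  by exists N0 => N NN; apply: leq_trans h (prime_pi_mono NN).
elim: M => [|M [N0 h]]; first by exists 0%N.
have [p pN pp] := prime_above N0; exists p.
apply: leq_trans (_ : (prime_pi p.-1).+1 <= _)%N.
  by rewrite ltnS; apply: leq_trans h (prime_pi_mono _); rewrite -ltnS prednK// prime_gt0.
rewrite /prime_pi prednK ?prime_gt0// -[in leqRHS]addn1 iotaD count_cat /= add0n pp addn0.
by rewrite addn1.
Qed.

(** * Averages of periodic functions over primes *)

Section PrimeAverage.
Variables (R : realType) (q : nat) (c : nat -> R).
Hypotheses (q0 : (0 < q)%N) (cq : periodic_mod q c).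

Let avg : R := (totient q)%:R^-1 * \sum_(0 <= r < q | coprime r q) c r.

Let totient_gt0R : 0 < (totient q)%:R :> R.
Proof. by rewrite ltr0n totient_gt0. Qed.

Let B : R := \sum_(0 <= r < q) `|c r| + `|avg| + 1.

Let B0 : 0 < B.
Proof. by rewrite ltr_wpDl// addr_ge0// sumr_ge0. Qed.

Let cB n : `|c n - avg| <= B.
Proof.
apply: le_trans (ler_normB _ _) _; rewrite /B -addrA lerD ?lerDl//.
rewrite -(cq (modn_mod n q)); have nq : (n %% q)%N \in index_iota 0 q.
  by rewrite mem_index_iota ltn_mod.
exact: (ler_sum_term (F := fun r => `|c r|)).
Qed.

(** Setting [w] to [0] off the reduced classes makes its dilates by [u] not prime to [q] vanish; the
    other dilates only permute the residues. The finitely many primes dividing [q] are treated as an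
    error. *)
Let w n : R := if coprime n q then (c n - avg) / B else 0.

Let w1 : bounded1 w.
Proof.
move=> n; rewrite /w; case: ifP => _; last by rewrite normr0.
by rewrite normrM normfV (gtr0_norm B0) ler_pdivrMr// mul1r.
Qed.

Let wq : periodic_mod q w.
Proof. by move=> m n mn; rewrite /w -coprime_modl mn coprime_modl (cq mn). Qed.

Let w0 : zero_mean_dilates q w.
Proof.
move=> u; have [uq|uq] := boolP (coprime u q); last first.
  by rewrite big1// => v _; rewrite /w coprimeMl (negbTE uq).
rewrite sum_periodic_dilate// /w -big_mkcond/= -mulr_suml sumrB.
rewrite [X in _ - X](_ : _ = (totient q)%:R * avg).
  by rewrite /avg mulrA divff ?gt_eqF// mul1r subrr mul0r.
rewrite totient_count_coprime natr_sum mulr_suml big_mkcond.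
by apply: eq_bigr => r _; rewrite coprime_sym; case: ifP => _; rewrite ?mul1r ?mul0r.
Qed.

Lemma prime_average_periodic :
  (prime_pi N)%:R^-1 * \sum_(0 <= p < N | prime p) c p @[N --> \oo] --> avg.
Proof.
apply/cvgrPdist_le => e e0.
have e3 : 0 < e / (2 * B) by rewrite divr_gt0// mulr_gt0.
have [x0 main] := sum_primes_zero_mean q0 e3.
have [N0 big] := prime_pi_unbounded (Num.truncn (2 * (q%:R + 1) * B / e)).+1.
near=> N.
have Nx0 : (x0.+1 <= N)%N by near: N; exact: nbhs_infty_ge.
have NN0 : (N0 <= N)%N by near: N; exact: nbhs_infty_ge.
have {NN0}bigN := big N NN0.
have [x xE] : exists x, N = x.+1 by exists N.-1; rewrite prednK// (leq_trans _ Nx0).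
have x0x : (x0 <= x)%N by rewrite -ltnS -xE.
have [pix0 h] := main x x0x; have {}h := h w w1 wq w0.
have P0 : (0 : R) < (prime_pi N)%:R by rewrite ltr0n (leq_trans _ bigN).
have pile : (prime_pi x)%:R <= (prime_pi N)%:R :> R by rewrite ler_nat prime_pi_mono// xE.
have shift (f : nat -> R) : \sum_(0 <= p < N | prime p) f p = \sum_(1 <= p < x.+1 | prime p) f p.
  by rewrite xE big_ltn_cond.
(* [prime_pi N] counts the primes [p <= N] while the averages run over [p < N], hence the correction
   at [N]. *)
have piE : (prime_pi N)%:R = \sum_(0 <= p < N | prime p) 1 + (prime N)%:R :> R.
  rewrite /prime_pi -[N.+1]addn1 iotaD count_cat/= add0n addn0 natrD; congr (_ + _).
  by rewrite -sum1_count natr_sum /index_iota subn0.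
have E : \sum_(0 <= p < N | prime p) c p - avg * (prime_pi N)%:R =
    B * (\sum_(1 <= p < x.+1 | prime p) w p) +
    \sum_(0 <= p < N | prime p && ~~ coprime p q) (c p - avg) - avg * (prime N)%:R.
  rewrite piE mulrDr opprD addrA; congr (_ - _).
  rewrite -shift mulr_sumr mulr_sumr -sumrB; under eq_bigr do rewrite mulr1.
  rewrite (bigID (fun p => coprime p q))/=; congr (_ + _).
  rewrite big_mkcondr/=; apply: eq_bigr => p _; rewrite /w; case: ifP => _; rewrite ?mulr0//.
  by rewrite mulrCA divff ?mulr1// gt_eqF.
have b2 : `|\sum_(0 <= p < N | prime p && ~~ coprime p q) (c p - avg)| <= q%:R * B.
  apply: le_trans (ler_norm_sum _ _ _) _.
  apply: (@le_trans _ _ (\sum_(1 <= p < q.+1) B)).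
    apply: (@le_trans _ _ (\sum_(0 <= p < N | prime p && ~~ coprime p q) B)).
      by apply: ler_sum.
    apply: ler_sum_subrange => [n|p /andP[_ pN] /andP[pp]]; first exact: ltW.
    rewrite prime_coprime// negbK andbT => pq.
    by rewrite prime_gt0//= ltnS dvdn_leq.
  by rewrite sumr_const_nat subn1/= mulr_natl.
have b3 : `|avg * (prime N)%:R| <= B.
  rewrite normrM; apply: (@le_trans _ _ `|avg|).
    by rewrite ler_piMr//; case: (prime N); rewrite ?normr1 ?normr0.
  have : 0 <= \sum_(0 <= r < q) `|c r| by apply: sumr_ge0.
  by rewrite /B; move: (\sum_(_ <= _ < _) _) => s; lra.
have -> : avg - (prime_pi N)%:R^-1 * \sum_(0 <= p < N | prime p) c p =
    - ((prime_pi N)%:R^-1 * (\sum_(0 <= p < N | prime p) c p - avg * (prime_pi N)%:R)).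
  by field; rewrite gt_eqF.
rewrite normrN normrM normfV (gtr0_norm P0) mulrC ler_pdivrMr// E.
apply: le_trans (ler_normB _ _) _; apply: le_trans (lerD (ler_normD _ _) (lexx _)) _.
rewrite normrM (gtr0_norm B0).
have k1 : B * `|\sum_(1 <= p < x.+1 | prime p) w p| <= e / 2 * (prime_pi N)%:R.
  apply: le_trans (ler_wpM2l (ltW B0) h) _.
  have -> : B * (e / (2 * B) * (prime_pi x)%:R) = e / 2 * (prime_pi x)%:R.
    by field; rewrite gt_eqF.
  by rewrite ler_wpM2l// divr_ge0// ltW.
have k2 : (q%:R + 1) * B <= e / 2 * (prime_pi N)%:R.
  have : 2 * (q%:R + 1) * B / e <= (prime_pi N)%:R.
    by apply/ltW; apply: lt_le_trans (truncnS_gt _) _; rewrite ler_nat.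
  by rewrite ler_pdivrMr//; lra.
by lra.
Unshelve. all: by end_near.
Qed.

End PrimeAverage.

(** * Subshifts with periodic skeletons *)

Section Cylinders.

Definition agree (L : nat) (y z : bisequence) : Prop :=
  forall i : int, (`|i| <= L)%N -> y i = z i.

Lemma agree_le L L' y z : (L <= L')%N -> agree L' y z -> agree L y z.
Proof. by move=> LL' h i iL; apply: h; exact: leq_trans LL'. Qed.

Lemma agree_trans L x y z : agree L x y -> agree L y z -> agree L x z.
Proof. by move=> h h' i iL; rewrite h// h'. Qed.

Lemma near_coordinate (y : bisequence) (i : int) : \forall z \near y, z i = y i.
Proof.
have := @proj_continuous int (fun=> bool) i y.
move=> /(_ [set b | b = y i]); apply.
by rewrite nbhs_principalE; apply/principal_filterP.
Qed.

Lemma nbhs_agree L (y : bisequence) : nbhs y (agree L y).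
Proof.
elim: L => [|L IH].
  near=> z => i; rewrite leqn0 absz_eq0 => /eqP ->.
  by apply/esym; near: z; exact: near_coordinate.
near=> z => i; rewrite leq_eqVlt => /orP[/eqP iL|]; last first.
  by move: i; near: z; apply: filterS IH => z h i iL; apply: h.
have [->|->] : i = L.+1%:Z \/ i = - L.+1%:Z by lia.
  by apply/esym; near: z; exact: near_coordinate.
by apply/esym; near: z; exact: near_coordinate.
Unshelve. all: by end_near. Qed.

Lemma compact_bisequence : compact [set: bisequence].
Proof.
have := @tychonoff int (fun=> bool) (fun=> setT) (fun=> bool_compact).
by congr (compact _); apply/seteqP; split.
Qed.

(** The reason is compactness: each [z] other than [y] differs from it at some coordinate, so that
    near [z] and for large [L] nothing agrees with [y] up to [L]. *)
Lemma nbhs_agreeP (y : bisequence) (U : set bisequence) :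
  nbhs y U -> exists L, agree L y `<=` U.
Proof.
move=> yU.
have /compact_near_coveringP nc := compact_bisequence.
have cov : forall x : bisequence, [set: bisequence] x ->
    \forall x' \near x & i \near \oo, agree i y x' -> U x'.
  move=> z _; have [->|zy] := pselect (z = y).
    by exists (U, setT) => [|[z' L] []//]; split=> //; exact: filterT.
  have [i yzi] : exists i, z i <> y i.
    by apply: contrapT => h; apply: zy; apply/funext => i; apply: contrapT => zyi; apply: h; exists i.
  exists ([set z' | z' i = z i], [set L | `|i|%N <= L]%N) => /=.
    by split; [exact: near_coordinate|exact: nbhs_infty_ge].
  by move=> [z' L] /= [z'i iL] h; case: yzi; rewrite -z'i -h.
have [L _ h] := nc nat \oo (fun L z => agree L y z -> U z) _ cov.
by exists L => z; apply: (h L) => /=.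
Qed.

End Cylinders.

Section UniformContinuity.
Variables (R : realType) (A : set bisequence) (f : bisequence -> R).
Hypotheses (Acl : closed A) (fc : {within A, continuous f}).

Let cont_at y e : A y -> 0 < e ->
  exists L, forall z, A z -> agree L y z -> `|f y - f z| <= e.
Proof.
move=> Ay e0; have /subspace_continuousP/(_ y Ay)/cvgrPdist_le/(_ e e0) := fc.
by rewrite /= near_withinE => /nbhs_agreeP[L h]; exists L => z Az yz; exact: h.
Qed.

Let near_out y : ~ A y -> \forall z \near y, ~ A z.
Proof. by move=> nAy; apply: (@open_nbhs_nbhs _ y (~` A)); split=> //; exact: closed_openC. Qed.

Lemma uniformly_continuous_bisequence e : 0 < e ->
  exists L, forall y z, A y -> A z -> agree L y z -> `|f y - f z| <= e.
Proof.
move=> e0; have /compact_near_coveringP nc := compact_bisequence.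
pose P L y := A y -> forall z, A z -> agree L y z -> `|f y - f z| <= e.
have cov : forall y : bisequence, [set: bisequence] y ->
    \forall y' \near y & L \near \oo, P L y'.
  move=> y _; have [Ay|nAy] := pselect (A y); last first.
    exists (~` A, setT) => [|[z L] /= [nAz _]//].
    by split; [exact: near_out|exact: filterT].
  have [|L h] := @cont_at y (e / 2) Ay; first by rewrite divr_gt0.
  exists (agree L y, [set L' | L <= L']%N) => /=.
    by split; [exact: nbhs_agree|exact: nbhs_infty_ge].
  move=> [y' L'] /= [yy' LL'] Ay' z Az y'z.
  have h1 := h y' Ay' yy'.
  have h2 := h z Az (agree_trans yy' (agree_le LL' y'z)).
  have -> : f y' - f z = (f y - f z) - (f y - f y') by lra.
  by apply: le_trans (ler_normB _ _) _; move: h1 h2; lra.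
have [L _ h] := nc nat \oo P _ cov.
by exists L => y z Ay Az; apply: (h L) => //=.
Qed.

Lemma bounded_bisequence : exists2 M : R, 0 < M & forall y, A y -> `|f y| <= M.
Proof.
have /compact_near_coveringP nc := compact_bisequence.
pose P (M : nat) y := A y -> `|f y| <= M%:R.
have cov : forall y : bisequence, [set: bisequence] y ->
    \forall y' \near y & L \near \oo, P L y'.
  move=> y _; have [Ay|nAy] := pselect (A y); last first.
    exists (~` A, setT) => [|[z L] /= [nAz _]//].
    by split; [exact: near_out|exact: filterT].
  have [|L h] := @cont_at y 1 Ay => //.
  exists (agree L y, [set M' | (Num.truncn (`|f y| + 1)).+1 <= M']%N) => /=.
    by split; [exact: nbhs_agree|exact: nbhs_infty_ge].
  move=> [y' M] /= [yy' LM] Ay'.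
  have h1 := h y' Ay' yy'.
  have -> : f y' = f y - (f y - f y') by lra.
  apply: le_trans (ler_normB _ _) _; apply: le_trans (lerD (lexx _) h1) _.
  by apply/ltW; apply: lt_le_trans (truncnS_gt _) _; rewrite ler_nat.
have [M _ h] := nc nat \oo P _ cov.
exists M.+1%:R => // y Ay; apply: (h M.+1) => //=.
Qed.

End UniformContinuity.

Section OrbitClosure.
Variable x : bisequence.
Implicit Types (y z : bisequence) (i a : int).

Lemma iter_left_shift m y i : iter m left_shift y i = y (i + m%:Z).
Proof.
elim: m i => [|m IH] i; first by rewrite addr0.
by rewrite iterS /left_shift IH -addrA -[in RHS]addn1 PoszD [m%:Z + 1]addrC.
Qed.

Lemma orbit_closureP y : orbit_closure x y <->
  forall L, exists a : int, forall i, (`|i| <= L)%N -> y i = x (i + a).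
Proof.
split=> [cy L|h].
  have [z [[m [zE|xE]] /= yz]] := cy _ (nbhs_agree L y).
    by exists m%:Z => i iL; rewrite yz// zE iter_left_shift.
  by exists (- m%:Z) => i iL; rewrite yz// xE iter_left_shift subrK.
move=> U /nbhs_agreeP[L yU]; have [a ya] := h L.
pose z : bisequence := fun i => x (i + a).
exists z; split; last by apply: yU => i iL; exact: ya.
have [a0|a0] := leP 0 a.
  exists `|a|%N; left; apply/funext => i; rewrite iter_left_shift /z.
  by congr (x _); lia.
exists `|a|%N; right; apply/funext => i; rewrite iter_left_shift /z.
by congr (x _); lia.
Qed.

Lemma orbit_closure_iter m y :
  orbit_closure x y -> orbit_closure x (iter m left_shift y).
Proof.
move=> /orbit_closureP h; apply/orbit_closureP => L.
have [a ya] := h (L + m)%N; exists (m%:Z + a) => i iL.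
by rewrite iter_left_shift ya ?addrA//; lia.
Qed.

End OrbitClosure.

Section Skeleton.
Variables (x : bisequence) (q : nat) (bad : int -> bool).
Hypotheses (q0 : (0 < q)%N) (badP : forall a, bad (a + q%:Z) = bad a).
Hypothesis bad_Per : forall a, ~~ bad a -> Per x q a.

Lemma periodic_int_mul (a j : int) : bad (a + j * q%:Z) = bad a.
Proof.
suff natP (m : nat) b : bad (b + m%:Z * q%:Z) = bad b.
  have [j0|j0] := leP 0 j; first by rewrite -(gez0_abs j0) natP.
  by rewrite -(natP `|j|%N (a + _)) ltz0_abs// mulNr addrK.
elim: m b => [|m IH] b; first by rewrite mul0r addr0.
by rewrite -addn1 PoszD mulrDl mul1r addrA badP.
Qed.

Lemma periodic_int_eqmod (a b : int) : (a = b %[mod q])%Z -> bad a = bad b.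
Proof.
move=> ab; rewrite (divz_eq a q) (divz_eq b q) ab.
by rewrite ![_ * q%:Z + _]addrC !periodic_int_mul.
Qed.

Lemma Per_eqmod a b : (a = b %[mod q])%Z -> ~~ bad a -> x a = x b.
Proof.
move=> ab /bad_Per h; rewrite (h ((b %/ q)%Z - (a %/ q)%Z)); congr (x _).
by rewrite [in RHS](divz_eq b q) {1}(divz_eq a q) ab; ring.
Qed.

(* Among the [q] residues one is a valid phase: otherwise finitely many
   coordinates of [y] would contradict every translate of [x]. *)
Lemma skeleton_phase y : orbit_closure x y ->
  exists a : int, forall i, ~~ bad (i + a) -> y i = x (i + a).
Proof.
move=> /orbit_closureP yx; apply: contrapT => nex.
have ex (r : nat) : exists i : int, ~~ bad (i + r%:Z) /\ y i <> x (i + r%:Z).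
  apply: contrapT => h; apply: nex; exists r%:Z => i nb.
  by apply: contrapT => yi; apply: h; exists i.
have [g gP] := choice ex.
have [a ya] := yx (\max_(r < q) `|g r|)%N.
have qz : q%:Z != 0 by rewrite eqz_nat -lt0n.
have [r0 rq] : 0 <= (a %% q)%Z /\ (a %% q)%Z < q%:Z.
  by rewrite modz_ge0// ltz_pmod.
pose r := `|(a %% q)%Z|%N.
have rE : r%:Z = (a %% q)%Z by rewrite /r gez0_abs.
have rltq : (r < q)%N by rewrite -ltz_nat rE.
have [nb] := gP r; apply; rewrite ya.
  apply/esym/Per_eqmod => //.
  by rewrite rE modzDmr.
by rewrite (leq_bigmax (Ordinal rltq)).
Qed.

End Skeleton.

Section PNT.
Variables (R : realType) (x : bisequence).

Lemma sum_periodic_shift q (b : int -> R) (u : int) : (0 < q)%N ->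
  (forall a c, (a = c %[mod q])%Z -> b a = b c) ->
  \sum_(0 <= r < q) b (u + r%:Z) = \sum_(0 <= r < q) b r%:Z.
Proof.
move=> q0 bP; have qz : q%:Z != 0 by rewrite eqz_nat -lt0n.
have step v : \sum_(0 <= r < q) b (v + 1 + r%:Z) = \sum_(0 <= r < q) b (v + r%:Z).
  case: q q0 bP qz => // q _ bP _.
  rewrite big_nat_recr//= [RHS]big_nat_recl//= addrC; congr (_ + _).
    by apply: bP; rewrite addr0 -addrA -PoszD add1n modzDr.
  by apply: eq_bigr => i _; congr b; lia.
have -> : \sum_(0 <= r < q) b (u + r%:Z) = \sum_(0 <= r < q) b (`|(u %% q)%Z|%:Z + r%:Z).
  by apply: eq_bigr => i _; apply: bP; rewrite gez0_abs ?modz_ge0// modzDml.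
elim: `|_|%N => [|m IH]; first by under eq_bigr do rewrite add0r.
by rewrite -addn1 PoszD step.
Qed.

Lemma cvg_approx (u : nat -> R) :
  (forall e, 0 < e -> exists l, \forall N \near \oo, `|l - u N| <= e) ->
  cvg (u N @[N --> \oo]).
Proof.
move=> h; apply/cauchy_cvgP/cauchy_exP => e e0.
have [|l hl] := h (e / 2); first by rewrite divr_gt0.
exists l; apply: filterS hl => N; rewrite /ball/= => lu.
by apply: le_lt_trans lu _; lra.
Qed.

Lemma prime_average_le (u v : nat -> R) N : (forall p, u p <= v p) ->
  (prime_pi N)%:R^-1 * \sum_(0 <= p < N | prime p) u p <=
  (prime_pi N)%:R^-1 * \sum_(0 <= p < N | prime p) v p.
Proof.
by move=> uv; apply: ler_wpM2l; [rewrite invr_ge0|apply: ler_sum].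
Qed.

Lemma prime_average_cst N (C : R) : 0 <= C ->
  (prime_pi N)%:R^-1 * \sum_(0 <= p < N | prime p) C <= C.
Proof.
move=> C0; rewrite mulrC; have [->|] := eqVneq (prime_pi N) 0%N; first by rewrite invr0 mulr0.
rewrite -lt0n => pi0; rewrite ler_pdivrMr ?ltr0n// big_const_seq iter_addr addr0 -[leLHS]mulr_natr.
by apply: ler_wpM2l => //; rewrite ler_nat /prime_pi /index_iota subn0 -addn1 iotaD count_cat leq_addr.
Qed.

(** The orbit [f (T^m y)] is compared with its [q]-periodic version [c m]. Where no bad coordinate
    lies in the window of radius [L], uniform continuity makes them close; elsewhere they differ by
    at most [2 * M], which is charged to the number [b m] of bad coordinates. Both [c] and [b] have
    limiting prime averages, and that of [b] is at most [K] times the number of bad residues over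
    [totient q]. *)
Theorem satisfies_PNT_of_skeletons (n : nat -> nat) (bad : nat -> int -> bool) :
  (forall t, (0 < n t)%N) ->
  (forall t a, bad t (a + (n t)%:Z) = bad t a) ->
  (forall t a, ~~ bad t a -> Per x (n t) a) ->
  (forall e : R, 0 < e -> exists t,
     \sum_(0 <= r < n t) (bad t r%:Z)%:R <= e * (totient (n t))%:R) ->
  satisfies_PNT R (orbit_closure x) left_shift.
Proof.
move=> n0 badP bad_Per small y xy f fc.
have Acl : closed (orbit_closure x) by exact: closed_closure.
have [M M0 fM] := bounded_bisequence Acl fc.
apply: cvg_approx => e e0.
have [|L fL] := uniformly_continuous_bisequence Acl fc (e := e / 4); first by rewrite divr_gt0.
pose K := (2 * L).+1.
(* In the final estimate, [e / 4] comes from the convergence for [c], another [e / 4] from uniform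
   continuity, and [2 * M * (2 * (e / (8 * M))) = e / 2] from the bad coordinates. *)
have d0 : 0 < e / (4 * (2 * M) * K%:R) by rewrite divr_gt0// !mulr_gt0.
have [t tsmall] := small _ d0.
move: (n t) (bad t) (n0 t) (badP t) (bad_Per t) tsmall => {n0 badP bad_Per small}q {}bad q0 badP bad_Per small.
have [a ya] := skeleton_phase q0 bad_Per xy.
pose c m := f (iter (m %% q) left_shift y).
pose b m : R := \sum_(0 <= j < K) (bad (j%:Z - L%:Z + a + m%:Z))%:R.
have cP : periodic_mod q c by move=> m m' mm'; rewrite /c mm'.
have badM (u v : int) : (u = v %[mod q])%Z -> bad u = bad v by exact: periodic_int_eqmod.
have bP : periodic_mod q b.
  move=> m m' mm'; apply: eq_bigr => j _; congr (_%:R); congr (nat_of_bool _); apply: badM.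
  by rewrite -modzDmr modz_nat mm' -modz_nat modzDmr.
have bge0 m : 0 <= b m by apply: sumr_ge0.
have fc_close m : `|f (iter m left_shift y) - c m| <= e / 4 + 2 * M * b m.
  have e4 : 0 <= e / 4 by rewrite divr_ge0// ltW.
  have [/existsP[j bj]|nex] := boolP [exists j : 'I_K, bad (j%:Z - L%:Z + a + m%:Z)].
    have b1 : 1 <= b m.
      rewrite /b big_mkord (bigD1 j)//= bj lerDl; exact: sumr_ge0.
    have h1 := fM _ (orbit_closure_iter (m := m) xy).
    have h2 := fM _ (orbit_closure_iter (m := m %% q) xy).
    apply: le_trans (ler_normB _ _) _; apply: le_trans (lerD h1 h2) _.
    by move: b1 M0 e4; nra.
  apply: (@le_trans _ _ (e / 4)); last by rewrite lerDl !mulr_ge0// ltW.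
  apply: fL; [exact: orbit_closure_iter|exact: orbit_closure_iter|].
  move=> i iL; rewrite !iter_left_shift.
  have nb : ~~ bad (i + a + m%:Z).
    have jK : (absz (i + L%:Z)%R < K)%N by rewrite /K; lia.
    move: nex; rewrite negb_exists => /forallP /(_ (Ordinal jK)) /=.
    by congr (~~ bad _); lia.
  have mq : ((i + a + m%:Z) = (i + a + (m %% q)%:Z) %[mod q])%Z.
    by rewrite -modzDmr modz_nat.
  rewrite ya; last by rewrite addrAC.
  rewrite ya; last by rewrite addrAC -(badM _ _ mq).
  by rewrite ![_ + _ + a]addrAC; apply: (Per_eqmod bad_Per mq).
have := prime_average_periodic q0 cP.
set l := _ * _ => cl; exists l.
have bl := prime_average_periodic q0 bP.
have bsmall : (totient q)%:R^-1 * \sum_(0 <= r < q | coprime r q) b r <= e / (4 * (2 * M)).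
  have t0 : (0 : R) < (totient q)%:R by rewrite ltr0n totient_gt0.
  rewrite mulrC ler_pdivrMr//.
  apply: (@le_trans _ _ (\sum_(0 <= r < q) b r)).
    by rewrite [leLHS]big_mkcond; apply: ler_sum => r _; case: ifP.
  rewrite exchange_big/=.
  have -> : \sum_(0 <= j < K) \sum_(0 <= i < q) (bad (j%:Z - L%:Z + a + i%:Z))%:R =
      \sum_(0 <= j < K) \sum_(0 <= i < q) (bad i%:Z)%:R :> R.
    apply: eq_bigr => j _.
    rewrite (@sum_periodic_shift q (fun z => (bad z)%:R))// => u v uv.
    by rewrite (badM _ _ uv).
  rewrite sumr_const_nat subn0 -[leLHS]mulr_natl.
  apply: le_trans (ler_wpM2l _ small) _ => //.
  rewrite le_eqVlt; apply/orP; left; apply/eqP; field.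
  by rewrite !gt_eqF.
near=> N.
have h1 : `|l - (prime_pi N)%:R^-1 * \sum_(0 <= p < N | prime p) c p| <= e / 4.
  near: N; move/cvgrPdist_le : cl; apply; exact: divr_gt0.
have h2 : (prime_pi N)%:R^-1 * \sum_(0 <= p < N | prime p) b p <= e / (4 * (2 * M)) + e / (4 * (2 * M)).
  rewrite -lerBlDl; apply: le_trans (lerB (lexx _) bsmall) _.
  apply: le_trans (ler_norm _) _; rewrite distrC.
  by near: N; move/cvgrPdist_le : bl; apply; rewrite divr_gt0// !mulr_gt0.
have h3 : `|(prime_pi N)%:R^-1 * \sum_(0 <= p < N | prime p) c p -
    (prime_pi N)%:R^-1 * \sum_(0 <= p < N | prime p) f (iter p left_shift y)| <=
    e / 4 + 2 * M * ((prime_pi N)%:R^-1 * \sum_(0 <= p < N | prime p) b p).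
  rewrite -mulrBr -sumrB normrM ger0_norm ?invr_ge0//.
  apply: le_trans (ler_wpM2l _ (ler_norm_sum _ _ _)) _; first by rewrite invr_ge0.
  apply: le_trans (prime_average_le (v := fun p => e / 4 + 2 * M * b p) _ _) _ => [p|].
    by rewrite distrC.
  rewrite big_split/= mulrDr -[X in _ + _ * X]mulr_sumr [X in _ + X]mulrCA; apply: lerD => //.
  by apply: prime_average_cst; rewrite divr_ge0// ltW.
rewrite -(subrKA ((prime_pi N)%:R^-1 * \sum_(0 <= p < N | prime p) c p)).
apply: le_trans (ler_normD _ _) _; apply: le_trans (lerD h1 h3) _.
apply: le_trans (lerD (lexx _) (lerD (lexx _) (ler_wpM2l _ h2))) _; first by rewrite mulr_ge0// ltW.
rewrite le_eqVlt; apply/orP; left; apply/eqP; field; rewrite gt_eqF//.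
Unshelve. all: by end_near. Qed.

End PNT.

(** * The Toeplitz sequence *)

Section CountSquares.

Definition is_square (k r : nat) : bool := [exists b : 'I_k, b ^ 2 == r %[mod k]].

Lemma is_squareE k r : is_square k (r %% k) = is_square k r.
Proof. by apply: eq_existsb => b; rewrite modn_mod. Qed.

Lemma is_square_sqr k m : (0 < k)%N -> is_square k (m ^ 2).
Proof.
by move=> k0; apply/existsP; exists (Ordinal (ltn_pmod m k0)); rewrite /= modnXm.
Qed.

Lemma sqr_eq_mod_prime k a b : prime k -> (a < k)%N -> (b < k)%N ->
  a ^ 2 = b ^ 2 %[mod k] -> b = a \/ b = (k - a)%N.
Proof.
move=> kp; wlog ab : a b / (a <= b)%N.
  move=> h ak bk E; have [ab|/ltnW ba] := leqP a b; first exact: h.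
  by have [|/esym h'] := h b a ba bk ak (esym E); [left|right; lia].
move=> ak bk /eqP; rewrite eq_sym eqn_mod_dvd ?leq_exp2r// subn_sqr Euclid_dvdM//.
have [->|ba] := eqVneq b a; first by left.
have {ba}ab : (a < b)%N by rewrite ltn_neqAle eq_sym ba.
rewrite gtnNdvd ?subn_gt0//=; last by lia.
move=> /dvdnP[c bac]; right.
have c1 : c = 1%N by nia.
by move: bac; rewrite c1; lia.
Qed.

Lemma sum_nat_of_bool_le (s : seq nat) (P : pred nat) m n :
  (forall i, (m <= i < n)%N -> P i -> i \in s) ->
  (\sum_(m <= i < n) P i <= size s)%N.
Proof.
move=> h; rewrite -big_mkcond/= sum1_count -size_filter.
apply: uniq_leq_size; first by rewrite filter_uniq// iota_uniq.
by move=> i; rewrite mem_filter mem_index_iota => /andP[Pi imn]; apply: h.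
Qed.

Lemma big_blocks (T : Type) (idx : T) (op : Monoid.law idx) (f : nat -> T) k n :
  \big[op/idx]_(0 <= r < k * n) f r =
  \big[op/idx]_(0 <= j < k) \big[op/idx]_(0 <= i < n) f (j * n + i)%N.
Proof.
elim: k => [|k IH]; first by rewrite mul0n !big_geq.
rewrite big_nat_recr//= -IH mulSn addnC (big_cat_nat (n := (k * n)%N))//= ?leq_addr//.
congr (op _ _); rewrite -{1}[(k * n)%N]add0n big_addn addKn.
by apply: eq_bigr => i _; rewrite addnC.
Qed.

Lemma count_square_roots k M r : prime k ->
  (\sum_(0 <= m < M) (m ^ 2 == r %[mod k]) <= 2 * (M %/ k).+1)%N.
Proof.
move=> kp; have k0 := prime_gt0 kp.
have MK : (M <= (M %/ k).+1 * k)%N by rewrite ltnW// ltn_ceil.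
apply: (@leq_trans (\sum_(0 <= m < (M %/ k).+1 * k) (m ^ 2 == r %[mod k]))).
  by rewrite [leqRHS](big_cat_nat (n := M))//= leq_addr.
rewrite big_blocks; apply: (@leq_trans (\sum_(0 <= j < (M %/ k).+1) 2)); last first.
  by rewrite sum_nat_const_nat subn0 mulnC.
apply: leq_sum => j _.
have [/hasP[a]|/hasPn nex] := boolP (has (fun a => a ^ 2 == r %[mod k]) (iota 0 k)).
  rewrite mem_iota add0n/= => ak /eqP ar.
  apply: (@sum_nat_of_bool_le [:: a; k - a]%N) => i /= ik /eqP.
  rewrite -modnXm modnMDl modnXm -ar => /esym /(sqr_eq_mod_prime kp ak ik).
  by rewrite !inE => -[->|->]; rewrite eqxx ?orbT.
rewrite big_nat big1// => i /= ik; apply/eqP; rewrite eqb0.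
by rewrite -modnXm modnMDl modnXm nex// mem_iota.
Qed.

(** Since [b] and [k - b] have the same square, roots up to [k./2] suffice. *)
Lemma count_squares k : (1 < k)%N -> (\sum_(0 <= r < k) is_square k r <= k./2.+1)%N.
Proof.
move=> k1; have k0 := ltnW k1.
have := size_map (fun b => (b ^ 2) %% k)%N (iota 0 k./2.+1); rewrite size_iota => <-.
apply: sum_nat_of_bool_le => r /andP[_ rk] /existsP[b /eqP].
rewrite (modn_small rk) => <-. apply/mapP.
have [bk|kb] := leqP b k./2; first by exists (b : nat) => //; rewrite mem_iota.
have bk := ltn_ord b; exists (k - b)%N.
  rewrite mem_iota/= add0n ltnS; have := odd_double_half k; lia.
apply/eqP; have [c1|c1] := leqP b (k - b).
  rewrite eq_sym eqn_mod_dvd ?leq_exp2r// subn_sqr subnK ?dvdn_mull//.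
  exact: ltnW.
by rewrite eqn_mod_dvd ?leq_exp2r ?(ltnW c1)// subn_sqr subnKC ?dvdn_mull// ltnW.
Qed.

End CountSquares.

Section CRT.
Variable R : realType.

Lemma sum_crt (F G : nat -> R) n k : (0 < n)%N -> (0 < k)%N -> coprime n k ->
  \sum_(0 <= r < k * n) F (r %% n)%N * G (r %% k)%N =
  (\sum_(0 <= i < n) F i) * \sum_(0 <= j < k) G j.
Proof.
move=> n0 k0 nk.
have -> : \sum_(0 <= r < k * n) F (r %% n)%N * G (r %% k)%N =
    \sum_(0 <= j < k) \sum_(0 <= i < n) F i * G ((n * j + i) %% k)%N.
  rewrite big_blocks; apply: eq_bigr => j _; apply: eq_big_nat => i /= ik.
  by rewrite modnMDl modn_small// [(j * _)%N]mulnC.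
rewrite exchange_big/= mulr_suml; apply: eq_bigr => i _; rewrite -mulr_sumr; congr (_ * _).
pose H m := G ((m + i) %% k)%N.
have HP : periodic_mod k H by move=> a b ab; rewrite /H -modnDml ab modnDml.
rewrite (sum_periodic_dilate k0 HP nk).
transitivity (\sum_(0 <= j < k) G `|(j%:Z %% k)%Z|%N); last first.
  by apply: eq_big_nat => j /= jk; rewrite modz_nat/= modn_small.
rewrite -(@sum_periodic_shift R k (fun a => G `|(a %% k)%Z|%N) i%:Z)// => [|a c ->//].
by apply: eq_bigr => j _; rewrite /H addnC -PoszD modz_nat.
Qed.

End CRT.

Section Density.
Variable R : realType.

Lemma has_density_periodic (A : set int) q : (0 < q)%N ->
  (forall a b, (a = b %[mod q])%Z -> A a -> A b) ->
  has_density A (q%:R^-1 * \sum_(0 <= r < q) (r%:Z \in A)%:R : R).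
Proof.
move=> q0 AP; set d := _ * _.
have qp : (0 : R) < q%:R by rewrite ltr0n.
have memP a b : (a = b %[mod q])%Z -> (a \in A) = (b \in A).
  move=> ab; apply/idP/idP; rewrite !inE; exact: AP.
have d01 : 0 <= d <= 1.
  rewrite mulr_ge0 ?invr_ge0//=; last by apply: sumr_ge0.
  rewrite /d mulrC ler_pdivrMr// mul1r.
  apply: le_trans (_ : \sum_(0 <= r < q) 1 <= _); first by apply: ler_sum => r _; case: (_ \in _).
  by rewrite sumr_const_nat subn0.
apply/cvgrPdist_le => e e0; near=> N.
pose h (i : nat) : R := (i%:Z - N%:Z \in A)%:R - d.
have hP : periodic_mod q h.
  move=> i j ij; rewrite /h (memP (i%:Z - N%:Z) (j%:Z - N%:Z))//.
  by rewrite -[LHS]modzDml -[RHS]modzDml !modz_nat ij.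
have h1 : bounded1 h by move=> i; rewrite /h ler_norml; case: (_ \in _) => /=; lra.
have h0 : \sum_(0 <= i < q) h i = 0.
  rewrite sumrB sumr_const_nat subn0.
  have -> : \sum_(0 <= i < q) (i%:Z - N%:Z \in A)%:R = \sum_(0 <= i < q) (i%:Z \in A)%:R :> R.
    rewrite -(@sum_periodic_shift R q (fun a => (a \in A)%:R) (- N%:Z))// => [|a c ac].
      by apply: eq_bigr => i _; rewrite addrC.
    by rewrite (memP _ _ ac).
  by rewrite /d -[X in _ - X]mulr_natl mulrA divff ?gt_eqF// mul1r subrr.
have K0 : (0 : R) < (2 * N).+1%:R by [].
have -> : d - (\sum_(0 <= i < (2 * N).+1 | i%:Z - N%:Z \in A) 1) / (2 * N).+1%:R =
    - (\sum_(0 <= i < (2 * N).+1) h i) / (2 * N).+1%:R.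
  rewrite sumrB sumr_const_nat subn0 -[X in - (_ - X)]mulr_natl.
  rewrite [X in d - X / _](_ : _ = \sum_(0 <= i < (2 * N).+1) (i%:Z - N%:Z \in A)%:R).
    by move: ((2 * N).+1%:R) K0 => K K0; field; rewrite gt_eqF.
  by rewrite big_mkcond; apply: eq_bigr => i _; case: (_ \in _).
rewrite mulNr normrN normrM normfV (gtr0_norm K0) ler_pdivrMr//.
apply: le_trans (periodic_sum_bound _ _ q0 hP h1 h0) _.
have NN : 2 * q%:R / e <= (2 * N).+1%:R.
  apply: (@le_trans _ _ N%:R); last by rewrite ler_nat; lia.
  by near: N; exact: nbhs_infty_ger.
by move: NN; rewrite ler_pdivrMr// [_ * e]mulrC.
Unshelve. all: by end_near. Qed.

Lemma esum_inv_lty (P : set nat) (g : nat -> nat) : injective g ->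
  (forall t, (2 ^ t.+1 <= g t)%N) -> P `<=` range g ->
  (\esum_(p in P) (p%:R^-1 : R)%:E < +oo)%E.
Proof.
move=> ginj gbig Pg.
apply: (@le_lt_trans _ _ (\esum_(p in range g) (p%:R^-1 : R)%:E)%E).
  apply: ge_ereal_sup => _ [X [finX XP] <-]; apply: esum_ge.
  by exists X => //; split=> // p /XP/Pg.
rewrite esum_image; last by move=> a b _ _; exact: ginj.
rewrite -nneseries_esumT => [|t]; last by rewrite lee_fin invr_ge0.
apply: (@le_lt_trans _ _ (\sum_(t <oo) (1 / (2 ^ (t + 1))%:R : R)%:E)%E).
  apply: lee_nneseries => t _; first by rewrite lee_fin invr_ge0.
  by rewrite lee_fin mul1r lef_pV2 ?posrE ?ltr0n ?expn_gt0// ?ler_nat ?addn1// (leq_trans _ (gbig t))// expn_gt0.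
have /cvg_lim := @cvg_geometric_eseries_half R 1 0.
by rewrite /eseries/= => ->//; rewrite ltry.
Qed.

End Density.

(** * The sequence, its skeleton and its values along squares *)

Section Construction.
Variables (n k : nat -> nat).
(** [kbig] makes [sqrt (n t.+1)] exceed [2 ^ (t + 6) * n t]. Among the [m] below [sqrt (n t)], those
    whose square is hit at an earlier [s] then have proportion at most [2 ^ -(s + 3)], and these
    proportions add up to less than [1 / 4]. It also makes [k t.+1] larger than [2 ^ (t + 6)],
    whence the convergent sum of [1 / p]. *)
Hypotheses (n0 : n 0%N = 1%N) (nS : forall t, n t.+1 = (k t.+1 * n t)%N)
  (kp : forall t, prime (k t.+1))
  (kbig : forall t, ((2 ^ (t + 6)) ^ 2 * n t < k t.+1)%N).

Lemma scale_gt0 t : (0 < n t)%N.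
Proof. by elim: t => [|t IH]; rewrite ?n0// nS muln_gt0 prime_gt0. Qed.

Lemma ltn_factor t : (2 ^ (t + 6) * n t < k t.+1)%N.
Proof.
apply: leq_ltn_trans (kbig t); rewrite leq_pmul2r ?scale_gt0//.
by rewrite -{1}[(2 ^ _)%N]expn1 leq_pexp2l// expn_gt0.
Qed.

Lemma scale_dvd s t : (s <= t)%N -> (n s %| n t)%N.
Proof.
move=> /subnK <-; elim: (t - s)%N => [|d IH]; first by rewrite dvdnn.
by rewrite addSn nS dvdn_mull.
Qed.

Lemma scale_le s t : (s <= t)%N -> (n s <= n t)%N.
Proof. by move=> st; rewrite dvdn_leq ?scale_gt0 ?scale_dvd. Qed.

Lemma scale_ltS t : (n t < k t.+1)%N.
Proof. by apply: leq_ltn_trans (ltn_factor t); rewrite leq_pmull// expn_gt0. Qed.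

Lemma ltn_scale t : (t < n t)%N.
Proof.
elim: t => [|t IH]; first by rewrite n0.
rewrite (leq_ltn_trans IH)// nS ltn_Pmull ?scale_gt0//; exact: prime_gt1.
Qed.

Lemma factor_lt s t : (s < t)%N -> (k s.+1 < k t.+1)%N.
Proof.
move=> st; apply: leq_ltn_trans (scale_ltS t); apply: leq_trans (scale_le st).
by rewrite nS leq_pmulr ?scale_gt0.
Qed.

Lemma factor_inj : injective (fun t => k t.+1).
Proof.
move=> s t st; by have [/factor_lt|/factor_lt|//] := ltngtP s t; rewrite st ltnn.
Qed.

Lemma coprime_factor_scale t : coprime (k t.+1) (n t).
Proof. by rewrite prime_coprime// gtnNdvd ?scale_gt0 ?scale_ltS. Qed.

Lemma prime_divisors_scale : prime_divisors n `<=` range (fun t => k t.+1).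
Proof.
move=> p [pp [t]]; elim: t => [|t IH]; first by rewrite n0 dvdn1 => /eqP p1; rewrite p1 in pp.
rewrite nS Euclid_dvdM// => /orP[|//]; rewrite dvdn_prime2// => /eqP ->.
by exists t.
Qed.

(* The last two clauses are there for every integer to be hit; squares are hit
   through them only. *)
Definition hit (s : nat) (a : int) : bool :=
  let r := `|(a %% n s.+1)%Z|%N in
  [|| ~~ is_square (k s.+1) r, (r < n s)%N | (n s.+1 <= r + n s)%N].

Lemma hit_eqmod s t a b : (s < t)%N -> (a = b %[mod n t])%Z -> hit s a = hit s b.
Proof.
move=> st /eqP; rewrite eqz_mod_dvd => ab; rewrite /hit.
suff -> : (a %% n s.+1)%Z = (b %% n s.+1)%Z by [].
apply/eqP; rewrite eqz_mod_dvd; apply: dvdz_trans ab.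
by rewrite dvdzE scale_dvd.
Qed.

Lemma hit_small s (a : int) : - (n s)%:Z <= a < (n s)%:Z -> hit s a.
Proof.
move=> /andP[la au]; have k2 := prime_gt1 (kp s); have ng := scale_gt0 s.
have nsS : (2 * n s <= n s.+1)%N by rewrite nS leq_mul2r k2 orbT.
have [a0|a0] := leP 0 a; rewrite /hit.
  by rewrite modz_small ?a0//=; [apply/or3P; constructor 2; lia|lia].
have -> : (a %% n s.+1)%Z = a + n s.+1.
  by rewrite -modzDr modz_small//; lia.
by apply/or3P; constructor 3; lia.
Qed.

Lemma hit_exists a : exists s, hit s a.
Proof. by exists `|a|%N; apply: hit_small; have := ltn_scale `|a|%N; lia. Qed.

Definition toeplitz_word : bisequence := fun a => odd (ex_minn (hit_exists a)).
Local Notation x := toeplitz_word.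

Lemma toeplitz_wordE s a : hit s a -> (forall i, (i < s)%N -> ~~ hit i a) -> x a = odd s.
Proof.
move=> hs his; rewrite /x; case: ex_minnP => m hm mmin; congr odd.
apply/eqP; rewrite eqn_leq mmin//= leqNgt; apply/negP => ms.
by have := his m ms; rewrite hm.
Qed.

Definition unhit (t : nat) (a : int) : bool := [forall s : 'I_t, ~~ hit s a].

Lemma unhitP t a : reflect (forall s, (s < t)%N -> ~~ hit s a) (unhit t a).
Proof.
by apply: (iffP forallP) => h s => [st|]; [exact: (h (Ordinal st))|exact: h].
Qed.

Lemma unhit_eqmod t a b : (a = b %[mod n t])%Z -> unhit t a = unhit t b.
Proof. by move=> ab; apply: eq_forallb => s; rewrite (hit_eqmod (ltn_ord s) ab). Qed.

Lemma first_hit t a : ~~ unhit t a ->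
  exists2 s, (s < t)%N & hit s a /\ forall i, (i < s)%N -> ~~ hit i a.
Proof.
rewrite negb_forall => /existsP[s]; rewrite negbK => hs.
have ex : exists i, hit i a by exists s.
exists (ex_minn ex); case: ex_minnP => m hm mmin.
  by apply: leq_ltn_trans (ltn_ord s); exact: mmin.
split=> // i im; apply: contraL im => hi; rewrite -leqNgt; exact: mmin.
Qed.

Lemma toeplitz_word_eqmod t a b : ~~ unhit t a -> (a = b %[mod n t])%Z -> x a = x b.
Proof.
move=> /first_hit[s st [hs his]] ab; rewrite (toeplitz_wordE hs his).
apply/esym/toeplitz_wordE => [|i si]; first by rewrite -(hit_eqmod st ab).
by rewrite -(hit_eqmod (ltn_trans si st) ab) his.
Qed.

Lemma Per_toeplitz_word t a : ~~ unhit t a -> Per x (n t) a.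
Proof. by move=> ua j; apply: toeplitz_word_eqmod ua _; rewrite addrC modzMDl. Qed.

Lemma unhit_exists a : exists t, ~~ unhit t a.
Proof.
have [s hs] := hit_exists a; exists s.+1; apply/negP => /unhitP/(_ s).
by rewrite hs ltnSn => /(_ isT).
Qed.

Lemma Toeplitz_toeplitz_word : Toeplitz x.
Proof.
move=> a; have [t ua] := unhit_exists a; exists (n t); split; first exact: scale_gt0.
exact: Per_toeplitz_word.
Qed.

Lemma periodic_structure_toeplitz_word : periodic_structure x n.
Proof.
split=> [t|t|]; [exact: scale_gt0|by rewrite nS dvdn_mull|].
apply/seteqP; split=> // a _; have [t ua] := unhit_exists a.
by exists t => //; exact: Per_toeplitz_word.
Qed.

Section RealEstimates.
Variable R : realType.

(** Surviving step [t] forces a residue to be a square modulo [k t.+1], which the Chinese remainder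
    theorem separates from surviving the earlier steps. There are at most [k / 2 + 1] squares, and
    [3 * (k / 2 + 1) <= 2 * (k - 1)] for [k >= 10], where [k - 1] is the totient of the prime
    [k]. *)
Lemma count_unhit t :
  3 ^+ t * \sum_(0 <= r < n t) (unhit t r%:Z)%:R <= 2 ^+ t * (totient (n t))%:R :> R.
Proof.
elim: t => [|t IH].
  rewrite !expr0 !mul1r n0 big_nat1.
  by case: (unhit _ _).
have k0 := prime_gt0 (kp t); have nt0 := scale_gt0 t.
have cop := coprime_factor_scale t.
pose U : R := \sum_(0 <= i < n t) (unhit t i%:Z)%:R.
pose Q : R := \sum_(0 <= j < k t.+1) (is_square (k t.+1) j)%:R.
have h1 : \sum_(0 <= r < n t.+1) (unhit t.+1 r%:Z)%:R <= U * Q.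
  rewrite /U /Q -sum_crt// 1?coprime_sym// -nS.
  rewrite big_nat [leRHS]big_nat; apply: ler_sum => r /= rn.
  rewrite -natrM ler_nat; case: (boolP (unhit t.+1 r)) => // /unhitP ur.
  have -> : unhit t (r %% n t)%N.
    apply/unhitP => s st; rewrite -(hit_eqmod (a := r) st) ?ur// 1?ltnW//.
    by rewrite -modz_nat modz_mod.
  rewrite is_squareE; have := ur t (ltnSn t).
  by rewrite /hit modz_nat/= modn_small// !negb_or negbK => /andP[-> _].
have h2 : 3 * Q <= 2 * (k t.+1 - 1)%:R.
  rewrite /Q -natr_sum -!natrM ler_nat.
  have := count_squares (prime_gt1 (kp t)); have := odd_double_half (k t.+1).
  have : (10 < k t.+1)%N.
    apply: leq_trans (ltn_factor t); rewrite ltnS (@leq_trans (2 ^ 6 * 1)%N)//.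
    by rewrite leq_mul// leq_pexp2l// leq_addl.
  by move: (\sum_(_ <= _ < _) _)%N => q; lia.
have -> : (totient (n t.+1))%:R = (k t.+1 - 1)%:R * (totient (n t))%:R :> R.
  by rewrite nS totient_coprime// totient_prime// subn1 natrM.
move: IH; rewrite -/U => IH; rewrite !exprS.
apply: (@le_trans _ _ (3 * 3 ^+ t * (U * Q))); first by rewrite ler_wpM2l// mulr_ge0.
have -> : 3 * 3 ^+ t * (U * Q) = (3 ^+ t * U) * (3 * Q) by ring.
apply: (@le_trans _ _ ((2 ^+ t * (totient (n t))%:R) * (2 * (k t.+1 - 1)%:R))).
  by apply: ler_pM => //; rewrite ?mulr_ge0// /Q sumr_ge0.
by rewrite le_eqVlt; apply/orP; left; apply/eqP; ring.
Qed.

Lemma unhit_proportion t :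
  \sum_(0 <= r < n t) (unhit t r%:Z)%:R <= (2 / 3) ^+ t * (totient (n t))%:R :> R.
Proof.
by rewrite expr_div_n mulrAC ler_pdivlMr// mulrC count_unhit.
Qed.

Lemma cvg_two_thirds : (2 / 3 : R) ^+ t @[t --> \oo] --> (0 : R).
Proof. by apply: cvg_expr; rewrite ger0_norm; lra. Qed.

Lemma satisfies_PNT_toeplitz_word : satisfies_PNT R (orbit_closure x) left_shift.
Proof.
apply: (@satisfies_PNT_of_skeletons R x n unhit).
- exact: scale_gt0.
- by move=> t a; apply: unhit_eqmod; rewrite modzDr.
- exact: Per_toeplitz_word.
move=> e e0; have /cvgrPdist_le/(_ e e0)[t _ /(_ t (leqnn t))] := cvg_two_thirds.
rewrite /= sub0r normrN => h; exists t; apply: le_trans (unhit_proportion t) _.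
by rewrite ler_wpM2r//; apply: le_trans (ler_norm _) h.
Qed.

Lemma Toeplitz_regular_toeplitz_word : Toeplitz_regular R x n.
Proof.
pose d t : R := (n t)%:R^-1 * \sum_(0 <= r < n t) (r%:Z \in Per x (n t))%:R.
exists d; split=> [t|].
  apply: has_density_periodic; first exact: scale_gt0.
  move=> a b ab Pa j.
  have h (i : int) : b + i * (n t)%:Z = a + ((b %/ n t)%Z - (a %/ n t)%Z + i) * (n t)%:Z.
    have := divz_eq a (n t); have := divz_eq b (n t); rewrite -ab.
    by move: (a %% _)%Z (b %/ _)%Z (a %/ _)%Z => r u v -> ->; ring.
  by rewrite h -Pa; have := h 0; rewrite mul0r addr0 => ->; rewrite -Pa.
have ndn t : 1 - (2 / 3) ^+ t <= d t <= 1.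
  have np : (0 : R) < (n t)%:R by rewrite ltr0n scale_gt0.
  have nE : (n t)%:R = \sum_(0 <= r < n t) 1 :> R by rewrite sumr_const_nat subn0.
  rewrite /d [(n t)%:R^-1 * _]mulrC ler_pdivlMr// ler_pdivrMr// mul1r; apply/andP; split; last first.
    by rewrite nE; apply: ler_sum => r _; case: (_ \in _).
  rewrite mulrBl mul1r lerBlDr.
  apply: (@le_trans _ _ (\sum_(0 <= r < n t) (r%:Z \in Per x (n t))%:R +
      \sum_(0 <= r < n t) (unhit t r%:Z)%:R)).
    rewrite -big_split/= nE; apply: ler_sum => r _.
    have [u|u] := boolP (unhit t r); first by rewrite lerDr.
    by rewrite mem_set ?lerDl//; exact: Per_toeplitz_word.
  rewrite lerD2l; apply: le_trans (unhit_proportion t) _.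
  rewrite ler_wpM2l ?exprn_ge0 ?divr_ge0// ler_nat totient_count_coprime.
  rewrite -[leqRHS]subn0 -[leqRHS]muln1 -sum_nat_const_nat.
  by apply: leq_sum => i _; exact: leq_b1.
apply: (@squeeze_cvgr _ _ _ _ (fun t => 1 - (2 / 3) ^+ t) (fun=> 1)).
- by apply: nearW => t; exact: ndn.
- by rewrite -[X in _ --> X]subr0; apply: cvgB; [exact: cvg_cst|exact: cvg_two_thirds].
- exact: cvg_cst.
Qed.

(** A square hit at [s] falls into one of [2 * n s] residues around [0], each with at most
    [2 * (M %/ q).+1] roots below [M] since [q] is prime. After multiplication by [2 ^ (s + 3)] the
    two parts of [4 * n s * (M %/ q).+1] are at most [M / 2] each, by [kbig]: the constant one
    because [M] is at least [sqrt (n s.+1)], the other because [q] exceeds [2 ^ (s + 6) * n s]. *)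
Lemma count_hit_squares s M : (n s.+1 <= M ^ 2)%N ->
  (2 ^ (s + 3) * \sum_(0 <= m < M) hit s (m ^ 2)%N%:Z <= M)%N.
Proof.
move=> nM; set q := k s.+1; have q0 : (0 < q)%N by exact: prime_gt0 (kp s).
have nle : (n s <= n s.+1)%N by rewrite scale_le.
have h1 : (\sum_(0 <= m < M) hit s (m ^ 2)%N%:Z <= 4 * n s * (M %/ q).+1)%N.
  apply: (@leq_trans (\sum_(0 <= m < M) (\sum_(0 <= r < n s) (m ^ 2 == r %[mod q]) +
      \sum_(n s.+1 - n s <= r < n s.+1) (m ^ 2 == r %[mod q]))%N)).
    apply: leq_sum => m _; rewrite /hit modz_nat/= -/q.
    have qn : (q %| n s.+1)%N by rewrite nS dvdn_mulr.
    have E : (m ^ 2 == (m ^ 2) %% n s.+1 %[mod q])%N by rewrite modn_dvdm.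
    have -> : is_square q ((m ^ 2) %% n s.+1).
      by rewrite -is_squareE modn_dvdm// is_squareE is_square_sqr.
    have rn : ((m ^ 2) %% n s.+1 < n s.+1)%N by rewrite ltn_mod scale_gt0.
    move: ((m ^ 2) %% n s.+1)%N E rn => r E rn /=.
    have one a b : (a <= r < b)%N -> (1 <= \sum_(a <= i < b) (m ^ 2 == i %[mod q]))%N.
      by move=> rab; rewrite (bigD1_seq r) ?mem_index_iota ?iota_uniq//= E.
    have [rs|sr] := ltnP r (n s).
      by apply: leq_trans (leq_addr _ _); apply: one.
    have [rs|//] /= := leqP (n s.+1) (r + n s).
    by apply: leq_trans (leq_addl _ _); apply: one; rewrite rn andbT leq_subLR addnC.
  rewrite big_split/= [X in (X + _ <= _)%N]exchange_big/= [X in (_ + X <= _)%N]exchange_big/=.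
  have c a b : (\sum_(a <= r < b) \sum_(0 <= m < M) (m ^ 2 == r %[mod q]) <=
      (b - a) * (2 * (M %/ q).+1))%N.
    by rewrite -sum_nat_const_nat; apply: leq_sum => r _; exact: count_square_roots (kp s).
  apply: leq_trans (leq_add (c _ _) (c _ _)) _.
  by rewrite subn0 subKn// -mulnDl mulnA; lia.
apply: leq_trans (leq_mul (leqnn _) h1) _.
have h2 : (2 ^ (s + 6) * n s <= M)%N.
  rewrite -(@leq_exp2r _ _ 2)//; apply: leq_trans nM; rewrite expnMn nS.
  rewrite [(n s ^ 2)%N]expnS expn1 mulnA leq_mul2r; apply/orP; right; apply/ltnW; exact: kbig.
have h3 : (2 ^ (s + 6) * n s * (M %/ q) <= M)%N.
  apply: leq_trans (leq_trunc_div M q); rewrite mulnC leq_mul2l; apply/orP; right.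
  by apply/ltnW; exact: ltn_factor.
have e : (2 ^ (s + 6) = 8 * 2 ^ (s + 3))%N by rewrite -[6%N]/(3 + 3)%N addnA [in LHS]expnD mulnC.
move: h2 h3; rewrite e; move: (2 ^ (s + 3))%N (M %/ q)%N (n s) => u v w.
move=> h2 h3; have -> : (u * (4 * w * v.+1) = 4 * (u * w * v) + 4 * (u * w))%N by rewrite -addn1; ring.
move: h2 h3; rewrite -!mulnA; move: (u * w)%N (u * (w * v))%N => a b; lia.
Qed.

(** A square below [n t] that is unhit before [t] has the sign of [t]. At most [M / 4] squares are
    hit earlier, and each lowers the sum by at most [2], which leaves [M / 2]. *)
Lemma square_average_bound t :
  2^-1 <= (-1) ^+ odd t * square_average R x (n t).
Proof.
have ex : exists M, (n t <= M ^ 2)%N.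
  by exists (n t); rewrite -{1}[n t]expn1 leq_pexp2l// scale_gt0.
(* [M] is [sqrt (n t)] rounded up, so that [m < sqrt (n t)] means [m < M], and [n s.+1 <= M ^ 2] for
   all [s < t]. *)
have [M nM Mmin] := ex_minnP ex.
have MP m : (m ^ 2 < n t)%N = (m < M)%N.
  apply/idP/idP => h; rewrite ltnNge; apply/negP => h'.
    by move: (leq_trans h nM); rewrite ltn_exp2r// ltnNge h'.
  by have := Mmin _ h'; rewrite leqNgt h.
have Mn : (M <= n t)%N.
  by apply: Mmin; rewrite -{1}[n t]expn1 leq_pexp2l// scale_gt0.
have np : (0 : R) < (n t)%:R by rewrite ltr0n scale_gt0.
have sq0 : (0 : R) < Num.sqrt (n t)%:R by rewrite sqrtr_gt0.
have MR : Num.sqrt (n t)%:R <= M%:R :> R.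
  by rewrite -[leRHS]ger0_norm// -sqrtr_sqr ler_sqrt ?sqr_ge0// -natrX ler_nat.
pose E (m : nat) : R := (-1) ^+ odd t * sign0 R (iter (m ^ 2) left_shift x).
have avgE : (-1) ^+ odd t * square_average R x (n t) =
    (Num.sqrt (n t)%:R)^-1 * \sum_(0 <= m < M) E m.
  rewrite /square_average mulrCA; congr (_ * _); rewrite mulr_sumr.
  rewrite [RHS](big_nat_widen _ _ (n t))//; apply: eq_bigl => m /=.
  rewrite -MP -[m%:R]ger0_norm// -sqrtr_sqr ltr_sqrt ?np// -natrX ltr_nat//.
have EP m : (m < M)%N -> 1 - 2 * (~~ unhit t (m ^ 2)%N)%:R <= E m.
  move=> mM; rewrite /E /sign0 iter_left_shift add0r -signr_addb.
  have [u|u] /= := boolP (unhit t _); last first.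
    by case: (_ (+) _) => /=; rewrite ?expr0 ?expr1; lra.
  rewrite (@toeplitz_wordE t) ?addbb ?expr0; first lra.
    by apply: hit_small; move: mM; rewrite -MP; lia.
  by move=> i it; move/unhitP : u; apply.
have cnt : \sum_(0 <= m < M) (~~ unhit t (m ^ 2)%N)%:R <= M%:R / 4 :> R.
  apply: (@le_trans _ _ (\sum_(0 <= m < M) \sum_(0 <= s < t) (hit s (m ^ 2)%N)%:R)).
    apply: ler_sum => m _; have [u|/first_hit[s st [hs _]]] := boolP (unhit _ _).
      by apply: sumr_ge0.
    rewrite (bigD1_seq s) ?mem_index_iota ?iota_uniq//= hs lerDl.
    exact: sumr_ge0.
  rewrite exchange_big/=.
  apply: (@le_trans _ _ (\sum_(0 <= s < t) M%:R / 2 ^+ (s + 3))).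
    rewrite big_nat [leRHS]big_nat; apply: ler_sum => s /= st.
    rewrite ler_pdivlMr ?exprn_gt0// mulrC -natr_sum -natrX -natrM ler_nat.
    by apply: count_hit_squares; apply: leq_trans nM; exact: scale_le.
  rewrite -mulr_sumr ler_wpM2l ?ler0n//.
  have -> : \sum_(0 <= s < t) (2 ^+ (s + 3))^-1 = 4^-1 - (2 ^+ (t + 2))^-1 :> R.
    elim: (t) => [|r IH]; first by rewrite big_geq// add0n -natrX subrr.
    rewrite big_nat_recr//= IH !addnS !addn0 !exprS.
    by field.
  by rewrite lerBlDr lerDl invr_ge0 exprn_ge0.
have sumE : M%:R / 2 <= \sum_(0 <= m < M) E m.
  apply: (@le_trans _ _ (\sum_(0 <= m < M) (1 - 2 * (~~ unhit t (m ^ 2)%N)%:R))).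
    rewrite sumrB sumr_const_nat subn0 -mulr_sumr.
    by move: cnt; move: (\sum_(_ <= _ < _) _) => S; lra.
  by rewrite big_nat [leRHS]big_nat; apply: ler_sum => m /= mM; exact: EP.
rewrite avgE mulrC ler_pdivlMr//; apply: le_trans sumE.
by rewrite mulrC; lra.
Qed.

Lemma square_average_not_cvg : ~ cvg (square_average R x (n t) @[t --> \oo]).
Proof.
move=> /cvg_ex[l /cvgrPdist_lt/(_ (2^-1))[|t _ h]]; first by rewrite invr_gt0.
have /ltr_normlP[a1 a2] := h _ (leqnn t).
have /ltr_normlP[b1 b2] := h _ (leqnSn t).
have := square_average_bound t; have := square_average_bound t.+1; rewrite /=.
by case: (odd t); rewrite /= ?expr0 ?expr1; move: a1 a2 b1 b2; lra.
Qed.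

End RealEstimates.

End Construction.

Lemma scales_exist : exists n k : nat -> nat, [/\ n 0%N = 1%N,
  forall t, n t.+1 = (k t.+1 * n t)%N, forall t, prime (k t.+1)
  & forall t, ((2 ^ (t + 6)) ^ 2 * n t < k t.+1)%N].
Proof.
pose next t m := s2val (prime_above ((2 ^ (t + 6)) ^ 2 * m)).
pose n := fix n t := if t is t'.+1 then (next t' (n t') * n t')%N else 1%N.
exists n, (fun t => next t.-1 (n t.-1)); split=> // t /=.
  exact: (s2valP' (prime_above _)).
exact: (s2valP (prime_above _)).
Qed.

Theorem mainTheorem6 (R : realType) :
  exists (x : bisequence) (n k : nat -> nat),
    [/\ Toeplitz x,
        periodic_structure x n &
        Toeplitz_regular R x n] /\
    [/\ forall t : nat, n t.+1 = (k t.+1 * n t)%N /\ coprime (k t.+1) (n t),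
        forall t : nat, (2 ^ 4 * n t ^ 2 <= n t.+1)%N &
        (\esum_(p in prime_divisors n) ((p%:R : R)^-1)%:E < +oo)%E] /\
    ~ cvg (square_average R x (n t) @[t --> \oo]) /\
    satisfies_PNT R (orbit_closure x) left_shift.
Proof.
have [n [k [n0 nS kp kbig]]] := scales_exist.
exists (toeplitz_word n0 nS kp), n, k; split; first split.
- exact: (Toeplitz_toeplitz_word n0 nS kp).
- exact: (periodic_structure_toeplitz_word n0 nS kp).
- exact: (Toeplitz_regular_toeplitz_word n0 nS kp kbig).
split; first split.
- by move=> t; split=> //; exact: coprime_factor_scale kbig t.
- move=> t; rewrite nS -[(n t ^ 2)%N]mulnn mulnA leq_mul2r; apply/orP; right.
  apply/ltnW; apply: leq_ltn_trans (kbig t); rewrite leq_mul2r; apply/orP; right.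
  by rewrite -expnM leq_pexp2l//; lia.
- apply: (@esum_inv_lty R _ (fun t => k t.+1)).
  + exact: factor_inj n0 nS kp kbig.
  + move=> t; apply: leq_trans (ltnW (ltn_factor n0 nS kp kbig t)).
    by rewrite -[leqLHS]muln1 leq_mul ?(scale_gt0 n0 nS kp)// leq_pexp2l//; lia.
  + exact: prime_divisors_scale n0 nS kp.
split; first exact: square_average_not_cvg.
exact: satisfies_PNT_toeplitz_word.
Qed.
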